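(* Let $V,W\subset\mathbb{C}^n$ be germs at $0$ of complex analytic varieties with $0\in V\cap W$, let $A\subset\mathbb{C}^n$ be a set-germ at $0$ with $0\in\overline{A}$, and suppose there is a bi-Lipschitz homeomorphism germ $h:(\mathbb{C}^n,0)\to(\mathbb{C}^n,0)$ with $h(V)=W$. Then $LD^*(A)\cap LD^*(V)=\{0\}$ if and only if $LD^*(h(A))\cap LD^*(W)=\{0\}$.
   Context: A bi-Lipschitz homeomorphism germ $h:(\mathbb{C}^n,0)\to(\mathbb{C}^n,0)$ is a homeomorphism germ with $h(0)=0$ and constants $0<K_1\le K_2$ with $K_1\|x-y\|\le\|h(x)-h(y)\|\le K_2\|x-y\|$ near $0$. For a set-germ $A\subset\mathbb{C}^n$ at $0$ with $0\in\overline{A}$, the complex tangent cone is $LD^*(A)=\{v\in\mathbb{C}^n:\ \exists\, c_i\in\mathbb{C},\ \exists\, v_i\in A\setminus\{0\},\ v_i\to0,\ c_iv_i\to v\}$. *)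

(* Defs.v *)
From HB Require Import structures.
From mathcomp Require Import all_boot all_order all_algebra.
From mathcomp Require Import complex.
From mathcomp Require Import reals.
Set Implicit Arguments. Unset Strict Implicit. Unset Printing Implicit Defensive.
Import Order.TTheory GRing.Theory Num.Theory.
Local Open Scope ring_scope.

Section Defs.
Variable R : realType.
Local Notation C := R[i].

Definition cabs (z : C) : R := Num.sqrt ((@complex.Re R z) ^+ 2 + (@complex.Im R z) ^+ 2).

Definition cvec (n : nat) := 'I_n -> C.

Definition vadd n (x y : cvec n) : cvec n := fun i => x i + y i.
Definition vsub n (x y : cvec n) : cvec n := fun i => x i - y i.
Definition vscale n (c : C) (x : cvec n) : cvec n := fun i => c * x i.
Definition vzero n : cvec n := fun _ => 0.
Definition vbasis n (j : 'I_n) : cvec n := fun i => if i == j then 1 else 0.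

Definition vnorm n (x : cvec n) : R :=
  Num.sqrt (\sum_(i < n) ((@complex.Re R (x i)) ^+ 2 + (@complex.Im R (x i)) ^+ 2)).

Definition vconv n (u : nat -> cvec n) (l : cvec n) : Prop :=
  forall e : R, 0 < e -> exists N, forall k, (N <= k)%N -> vnorm (vsub (u k) l) < e.

Definition vball n (a : cvec n) (r : R) (z : cvec n) : Prop := vnorm (vsub z a) < r.

Definition ccont_at n (f : cvec n -> C) (z : cvec n) : Prop :=
  forall e : R, 0 < e -> exists d : R, 0 < d /\
    forall w, vnorm (vsub w z) < d -> cabs (f w - f z) < e.

Definition cpartial_diff n (f : cvec n -> C) (z : cvec n) (j : 'I_n) : Prop :=
  exists L : C, forall e : R, 0 < e -> exists d : R, 0 < d /\
    forall t : C, t != 0 -> cabs t < d ->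
      cabs ((f (vadd z (vscale t (vbasis j))) - f z) / t - L) < e.

(* holomorphic on the open set U (Osgood's definition: continuous and
   holomorphic in each variable separately) *)
Definition holomorphic_on n (U : cvec n -> Prop) (f : cvec n -> C) : Prop :=
  forall z, U z -> ccont_at f z /\ forall j, cpartial_diff f z j.

Definition analytic_germ n (V : cvec n -> Prop) : Prop :=
  exists (r : R) (k : nat) (f : 'I_k -> cvec n -> C),
    0 < r /\ (forall j, holomorphic_on (vball ((@vzero n)) r) (f j)) /\
    forall z, vball ((@vzero n)) r z -> (V z <-> forall j, f j z = 0).

Definition LDstar n (A : cvec n -> Prop) (v : cvec n) : Prop :=
  exists (c : nat -> C) (u : nat -> cvec n),
    (forall k, A (u k) /\ u k <> (@vzero n)) /\
    vconv u ((@vzero n)) /\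
    vconv (fun k => vscale (c k) (u k)) v.

(* h is a bi-Lipschitz homeomorphism germ (C^n,0) -> (C^n,0), with
   representative defined on the ball B(0,r) *)
Definition biLipschitz_germ n (h : cvec n -> cvec n) (r : R) : Prop :=
  0 < r /\ h ((@vzero n)) = (@vzero n) /\
  (exists K1 K2 : R, 0 < K1 /\ K1 <= K2 /\
     forall x y, vball ((@vzero n)) r x -> vball ((@vzero n)) r y ->
       K1 * vnorm (vsub x y) <= vnorm (vsub (h x) (h y)) /\
       vnorm (vsub (h x) (h y)) <= K2 * vnorm (vsub x y)) /\
  (* the image of the domain is a neighbourhood of 0 (homeomorphism germ) *)
  (exists s : R, 0 < s /\ forall y, vball ((@vzero n)) s y ->
       exists x, vball ((@vzero n)) r x /\ h x = y).

Definition gimage n (h : cvec n -> cvec n) (r : R) (A : cvec n -> Prop)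
  (y : cvec n) : Prop :=
  exists x, vball ((@vzero n)) r x /\ A x /\ h x = y.

Definition germ_eq n (A B : cvec n -> Prop) : Prop :=
  exists e : R, 0 < e /\ forall z, vball ((@vzero n)) e z -> (A z <-> B z).

Definition zero_in_closure n (A : cvec n -> Prop) : Prop :=
  forall e : R, 0 < e -> exists z, A z /\ vball ((@vzero n)) e z.

Definition meets_only_at0 n (X Y : cvec n -> Prop) : Prop :=
  forall v, X v /\ Y v <-> v = (@vzero n).

End Defs.
Arguments vzero {R} n.

(* Main.v *)
Require Import Defs.
From HB Require Import structures.
From mathcomp Require Import all_boot all_order all_algebra.
From mathcomp Require Import complex.
From mathcomp Require Import boolp classical_sets reals.
From mathcomp Require Import ring lra.
Set Implicit Arguments. Unset Strict Implicit. Unset Printing Implicit Defensive.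
Import Order.TTheory GRing.Theory Num.Theory.
Local Open Scope ring_scope.

(** The point is that an analytic germ [W] has the sequence selection property
along its tangent directions: if [v <> 0] lies in [LD*(W)], then for every small
complex [t] there is a point of [W] at distance [o(|t|)] of [t v].  Given
[v <> 0] in [LD*(h(A))] and in [LD*(W)], pick points of [h(A)] near [t v] (with
[t = 1 / c_i]) and points of [W] at distance [o(|t|)] of them; their preimages in
[A] and [V] are of size comparable to [|t|] and at distance [o(|t|)], so after
rescaling by [1 / t] a subsequence yields a nonzero common element of [LD*(A)]
and [LD*(V)].  The converse is the same argument for the inverse of [h].

The selection property is a statement on zeros of holomorphic functions of
[(t, y)], namely [f_j(t (v + y))]: if common zeros with [t <> 0] accumulate at the
origin, then every small [t] is the first coordinate of a common zero near the
origin.  This follows by induction on the number of variables: divide one function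
by the largest power of [t], make it regular in some coordinate by a linear
change, reduce the others modulo it by Weierstrass division, and eliminate that
coordinate by taking norms.  No dimension theory is involved.

The function theory rests on one Cauchy estimate, obtained without integrals from
Goursat's bisection argument applied to midpoint sums along squares.  Bounded
divided differences then give removable singularities, stability under bounded
pointwise limits, and Osgood's lemma. *)

(** * The modulus and geometric convergence *)

Section Modulus.
Variable R : realType.
Local Notation C := R[i].
Local Open Scope complex_scope.
Implicit Types (x y z : C) (r : R).

(** The multipliers that realise [v] in the two cones are unrelated, so a sequence of points of the
    analytic germ does not suffice: points are needed at every small complex scale [t], and in
    particular at the scales dictated by the other set. The elimination has to produce one root
    common to a whole family, whereas a norm detects the common roots of the divisor and one
    function only. Families are therefore closed under linear combinations first: if each of the
    finitely many roots of the divisor is missed by some member, a generic combination misses them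
    all and its norm is nonzero. This is why families are arbitrary predicates and not finite lists.
    The recurring factor [20 / rho] is the price of one divided difference on a disc of radius
    [rho]. Divided differences keep the radius and multiply the bound, so that Taylor remainders of
    every order live on one fixed polydisc; the constants [80], [40] and [8^-1] are chosen to beat
    powers of that factor. *)

Lemma cabs_normc z : cabs z = Normc.normc z.
Proof. by case: z. Qed.

Lemma cabs_ge0 z : 0 <= cabs z.
Proof. exact: sqrtr_ge0. Qed.

Lemma cabsM x y : cabs (x * y) = cabs x * cabs y.
Proof. by rewrite !cabs_normc Normc.normcM. Qed.

Lemma cabs0 : cabs (0 : C) = 0.
Proof. by rewrite cabs_normc Normc.normc0. Qed.

Lemma cabs1 : cabs (1 : C) = 1.
Proof. by rewrite cabs_normc Normc.normc1. Qed.

Lemma cabs_eq0 z : (cabs z == 0) = (z == 0).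
Proof.
apply/eqP/eqP => [|->]; last exact: cabs0.
by rewrite cabs_normc => /Normc.eq0_normc.
Qed.

Lemma cabs_gt0 z : (0 < cabs z) = (z != 0).
Proof. by rewrite lt_neqAle cabs_ge0 andbT eq_sym cabs_eq0. Qed.

Lemma cabsV z : cabs z^-1 = (cabs z)^-1.
Proof. by rewrite !cabs_normc Normc.normcV. Qed.

Lemma cabs_div x y : cabs (x / y) = cabs x / cabs y.
Proof. by rewrite cabsM cabsV. Qed.

Lemma cabsN z : cabs (- z) = cabs z.
Proof. by rewrite !cabs_normc normcN. Qed.

Lemma cabsBC x y : cabs (x - y) = cabs (y - x).
Proof. by rewrite -cabsN opprB. Qed.

Lemma cabsD x y : cabs (x + y) <= cabs x + cabs y.
Proof. by rewrite !cabs_normc; exact: le_normcD. Qed.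

Lemma cabsB x y : cabs (x - y) <= cabs x + cabs y.
Proof. by rewrite -(cabsN y) cabsD. Qed.

Lemma cabs_triB x y z : cabs (x - z) <= cabs (x - y) + cabs (y - z).
Proof. by rewrite (_ : x - z = (x - y) + (y - z)) ?cabsD //; ring. Qed.

Lemma cabs_sub_ge x y : cabs x - cabs y <= cabs (x - y).
Proof. by rewrite lerBlDr -{1}(subrK y x) cabsD. Qed.

Lemma cabsX z n : cabs (z ^+ n) = cabs z ^+ n.
Proof. by elim: n => [|n IH]; rewrite ?expr0 ?cabs1 // !exprS cabsM IH. Qed.

Lemma cabs_sum (I : Type) (s : seq I) (P : pred I) (F : I -> C) :
  cabs (\sum_(i <- s | P i) F i) <= \sum_(i <- s | P i) cabs (F i).
Proof.
elim/big_ind2 : _ => [|x a y b xa yb|//]; first by rewrite cabs0.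
by apply: le_trans (cabsD _ _) _; exact: lerD.
Qed.

Lemma cabs_prod (I : Type) (s : seq I) (P : pred I) (F : I -> C) :
  cabs (\prod_(i <- s | P i) F i) = \prod_(i <- s | P i) cabs (F i).
Proof. by rewrite (big_morph _ cabsM cabs1). Qed.

Lemma cabs_real r : cabs r%:C = `|r|.
Proof. by rewrite /cabs /= expr0n addr0 sqrtr_sqr. Qed.

Lemma cabs_real_ge0 r : 0 <= r -> cabs r%:C = r.
Proof. by move=> r0; rewrite cabs_real ger0_norm. Qed.

Lemma cabs_i : cabs ('i : C) = 1.
Proof. by rewrite /cabs /= expr0n expr1n add0r sqrtr1. Qed.

Lemma cabs_Re z : `|complex.Re z| <= cabs z.
Proof. by rewrite /cabs -sqrtr_sqr ler_sqrt ?addr_ge0 ?sqr_ge0// lerDl sqr_ge0. Qed.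

Lemma cabs_Im z : `|complex.Im z| <= cabs z.
Proof. by rewrite /cabs -sqrtr_sqr ler_sqrt ?addr_ge0 ?sqr_ge0// lerDr sqr_ge0. Qed.

Lemma cabs_ReIm z : cabs z <= `|complex.Re z| + `|complex.Im z|.
Proof.
rewrite -(ger0_norm (addr_ge0 (normr_ge0 (complex.Re z)) (normr_ge0 (complex.Im z)))).
rewrite -sqrtr_sqr /cabs ler_sqrt ?sqr_ge0//.
have := mulr_ge0 (normr_ge0 (complex.Re z)) (normr_ge0 (complex.Im z)).
by rewrite sqrrD !real_normK ?num_real//; lra.
Qed.

End Modulus.

Section Geometric.
Variable R : realType.
Local Notation C := R[i].
Local Open Scope complex_scope.

Lemma exprn_small (x e : R) : 0 <= x -> x < 1 -> 0 < e ->
  exists N, forall n, (N <= n)%N -> x ^+ n < e.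
Proof.
move=> x0 x1 e0.
have [->|xn0] := eqVneq x 0.
  by exists 1%N => -[|n]// _; rewrite exprS mul0r.
have xp : 0 < x by rewrite lt_neqAle eq_sym xn0.
have vp : 0 < x^-1 - 1 by rewrite subr_gt0 invf_gt1.
(* Bernoulli's inequality for [x^-1], which exceeds [1]. *)
have bern n : 1 + n%:R * (x^-1 - 1) <= x^-1 ^+ n.
  elim: n => [|n IH]; first by rewrite mul0r addr0 expr0.
  rewrite exprS -natr1; have n0 : (0 : R) <= n%:R by [].
  have := ler_wpM2l (ltW (lt_trans vp (_ : x^-1 - 1 < x^-1))) IH.
  have -> : x^-1 - 1 < x^-1 by lra.
  move=> /(_ isT); apply: le_trans; set v := x^-1 - 1.
  have -> : x^-1 = v + 1 by rewrite subrK.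
  by have := mulr_ge0 n0 (mulr_ge0 (ltW vp) (ltW vp)); rewrite -/v; nra.
pose N := (Num.bound (e^-1 / (x^-1 - 1))).
exists N => n Nn.
have h : e^-1 < x^-1 ^+ n.
  apply: lt_le_trans (bern n).
  have hN : e^-1 / (x^-1 - 1) < N%:R.
    by apply: le_lt_trans (archi_boundP _); rewrite ?ler_norm// divr_ge0 ?invr_ge0 ?ltW.
  rewrite ltr_pdivrMr// in hN.
  have : N%:R * (x^-1 - 1) <= n%:R * (x^-1 - 1) by rewrite ler_pM2r// ler_nat.
  by lra.
rewrite exprVn ltf_pV2 // in h; rewrite posrE //; exact: exprn_gt0.
Qed.

Lemma exprn_half_small (e : R) : 0 < e ->
  exists N, forall n, (N <= n)%N -> (2^-1 : R) ^+ n < e.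
Proof. by apply: exprn_small; lra. Qed.

(* [u k - 2 M / 2^k] increases to its supremum. *)
Lemma geometric_limit (u : nat -> R) (M : R) :
  (forall k, `|u k.+1 - u k| <= M * 2^-1 ^+ k) ->
  exists l, forall k, `|u k - l| <= 2 * M * 2^-1 ^+ k.
Proof.
move=> hu.
have M0 : 0 <= M by have := hu 0%N; rewrite expr0 mulr1; exact: le_trans.
pose h k : R := 2 * M * 2^-1 ^+ k.
have hS k : h k.+1 = h k - M * 2^-1 ^+ k by rewrite /h exprS; lra.
have h0 k : 0 <= h k by rewrite !mulr_ge0// exprn_ge0 ?invr_ge0.
have lo k n : u k - h k <= u (k + n)%N - h (k + n)%N.
  elim: n => [|n IH]; first by rewrite addn0.
  apply: le_trans IH _; rewrite addnS hS.
  by have := hu (k + n)%N; rewrite ler_norml => /andP[]; lra.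
have hi k n : u (k + n)%N + h (k + n)%N <= u k + h k.
  elim: n => [|n IH]; first by rewrite addn0.
  apply: le_trans IH; rewrite addnS hS.
  by have := hu (k + n)%N; rewrite ler_norml => /andP[]; lra.
have ub k j : u j - h j <= u k + h k.
  have := lo j k; have := hi k j; rewrite addnC => a b.
  by have := h0 (j + k)%N; lra.
pose E (x : R) : Prop := exists k, x = u k - h k.
have sE : has_sup E.
  split; first by exists (u 0%N - h 0%N), 0%N.
  by exists (u 0%N + h 0%N) => x [j ->].
exists (sup E) => k; rewrite -/(h k) ler_norml.
apply/andP; split.
  rewrite lerNl opprB lerBlDl; apply: ge_sup; first by case: sE.
  by move=> x [j ->]; rewrite ub.
rewrite lerBlDr addrC -lerBlDr; apply: ub_le_sup; last by exists k.
by case: sE.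
Qed.

Lemma cgeometric_limit (u : nat -> C) (M : R) :
  (forall k, cabs (u k.+1 - u k) <= M * 2^-1 ^+ k) ->
  exists l : C, forall k, cabs (u k - l) <= 4 * M * 2^-1 ^+ k.
Proof.
move=> hu.
have [a ha] : exists a, forall k, `|complex.Re (u k) - a| <= 2 * M * 2^-1 ^+ k.
  apply: geometric_limit => k; apply: le_trans (hu k); rewrite -raddfB; exact: cabs_Re.
have [b hb] : exists a, forall k, `|complex.Im (u k) - a| <= 2 * M * 2^-1 ^+ k.
  apply: geometric_limit => k; apply: le_trans (hu k); rewrite -raddfB; exact: cabs_Im.
exists (a +i* b)%C => k; apply: le_trans (cabs_ReIm _) _.
have -> : 4 * M * 2^-1 ^+ k = 2 * M * 2^-1 ^+ k + 2 * M * 2^-1 ^+ k by ring.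
by rewrite !raddfB /= lerD.
Qed.

End Geometric.

(** * Goursat's lemma and the Cauchy estimate *)

Section Goursat.
Variable R : realType.
Local Notation C := R[i].
Local Open Scope complex_scope.
Local Notation Re := (@complex.Re R).
Local Notation Im := (@complex.Im R).
Implicit Types (f g : C -> C) (z w p a : C) (l : R).

(** The increment form avoids division, so [t = 0] needs no exception. *)
Definition cdiff f z : Prop := exists L : C, forall e : R, 0 < e ->
  exists d : R, 0 < d /\ forall t : C, cabs t < d ->
    cabs (f (z + t) - f z - L * t) <= e * cabs t.

Lemma choose_threshold (I : finType) (P : I -> nat -> Prop) :
  (forall i, exists N, forall n, (N <= n)%N -> P i n) ->
  exists N, forall i n, (N <= n)%N -> P i n.
Proof.
move=> /choice[F hF]; exists (\max_i F i) => i n Fn; apply: hF.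
by apply: leq_trans Fn; exact: leq_bigmax.
Qed.

(** The mean of [f] over the midpoints of [3 ^ N] equal pieces of the segment from [p] to [p + v].
    Trisection, unlike bisection, leaves the centre of a square inside one subsquare and off all
    edges, as the treatment of a singularity at the centre requires. *)
Fixpoint mavg f N p v : C :=
  if N is N'.+1 then
    (mavg f N' p (v / 3) + mavg f N' (p + v / 3) (v / 3)
     + mavg f N' (p + 2 * (v / 3)) (v / 3)) / 3
  else f (p + v / 2).

(* Midpoint-rule approximation of the integral of [f] along the boundary of the
   square with lower left corner [p] and side [l]. *)
Definition bsum f N p l : C :=
  l%:C * (mavg f N p l%:C + 'i * mavg f N (p + l%:C) ('i * l%:C)
         - mavg f N (p + 'i * l%:C) l%:C - 'i * mavg f N p ('i * l%:C)).

(** A form of convexity: applied below to discs and to half-planes. *)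
Lemma mavg_ind (K : C -> Prop) f N p v :
  (forall x y z, K x -> K y -> K z -> K ((x + y + z) / 3)) ->
  (forall t : R, 0 <= t -> t <= 1 -> K (f (p + t%:C * v))) -> K (mavg f N p v).
Proof.
move=> hK; elim: N p v => [|N IH] p v hf /=.
  have -> : v / 2 = (2^-1 : R)%:C * v by rewrite fmorphV rmorph_nat mulrC.
  by apply: hf; lra.
have sub (k : R) : 0 <= k -> k <= 2 -> forall t : R, 0 <= t -> t <= 1 ->
    K (f (p + k%:C * (v / 3) + t%:C * (v / 3))).
  move=> k0 k2 t t0 t1.
  have -> : p + k%:C * (v / 3) + t%:C * (v / 3) = p + ((k + t) / 3)%:C * v.
    by rewrite rmorphM rmorphD fmorphV rmorph_nat; ring.
  by apply: hf; lra.
apply: hK; apply: IH => t t0 t1.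
- by have := sub 0 (lexx 0) (ler0n _ _) t t0 t1; rewrite mul0r addr0.
- by have := sub 1 ler01 (ler1n _ _) t t0 t1; rewrite mul1r.
- by have := sub 2 (ler0n _ _) (lexx _) t t0 t1; rewrite rmorph_nat.
Qed.

Lemma mavg_bound f N p v (B : R) :
  (forall t : R, 0 <= t -> t <= 1 -> cabs (f (p + t%:C * v)) <= B) ->
  cabs (mavg f N p v) <= B.
Proof.
apply: (mavg_ind (K := fun z => cabs z <= B)) => x y z hx hy hz.
rewrite cabs_div (_ : cabs 3 = 3); last first.
  by rewrite -(rmorph_nat (real_complex R)) cabs_real_ge0.
have := cabsD (x + y) z; have := cabsD x y.
by rewrite ler_pdivrMr//; lra.
Qed.

Lemma mavg_lin f g c N p v :
  mavg (fun z => f z + c * g z) N p v = mavg f N p v + c * mavg g N p v.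
Proof. by elim: N p v => [//|N IH] p v /=; rewrite !IH; ring. Qed.

Lemma mavg_affine a b N p v :
  mavg (fun z => a + b * z) N p v = a + b * (p + v / 2).
Proof. by elim: N p v => [//|N IH] p v /=; rewrite !IH; field. Qed.

Lemma bsum_lin f g c N p l :
  bsum (fun z => f z + c * g z) N p l = bsum f N p l + c * bsum g N p l.
Proof. by rewrite /bsum !mavg_lin; ring. Qed.

(** The midpoint rule is exact on affine functions, so the linear part in Goursat's argument drops
    out at every level [N], without a limit. *)
Lemma bsum_affine a b N p l : bsum (fun z => a + b * z) N p l = 0.
Proof. by rewrite /bsum !mavg_affine; field. Qed.

(** Level [N.+1] on the large square samples the same midpoints as level [N] on its nine subsquares,
    so the inner edges cancel exactly. *)
Lemma bsum_split f N p l (m := (l / 3)) : bsum f N.+1 p l =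
  \sum_(i < 3) \sum_(j < 3) bsum f N (p + i%:R * m%:C + j%:R * 'i * m%:C) m.
Proof.
(* [X a b] and [Y a b] are the means over the horizontal and the vertical grid edge that start at
   the grid point [(a, b)]. *)
pose X (a b : nat) := mavg f N (p + a%:R * m%:C + b%:R * 'i * m%:C) m%:C.
pose Y (a b : nat) := mavg f N (p + a%:R * m%:C + b%:R * 'i * m%:C) ('i * m%:C).
have E (i j : 'I_3) : bsum f N (p + i%:R * m%:C + j%:R * 'i * m%:C) m =
    m%:C * (X i j + 'i * Y i.+1 j - X i j.+1 - 'i * Y i j).
  rewrite /bsum /X /Y -!natr1; congr (_ * (_ + _ * _ - _ - _)).
    by congr (mavg _ _ _ _); ring.
  by congr (mavg _ _ _ _); ring.
under eq_bigr do under eq_bigr do rewrite E.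
rewrite !big_ord_recl !big_ord0 /= /bump /=.
have lm : l%:C / 3 = m%:C by rewrite /m rmorphM fmorphV rmorph_nat.
have lm' : l%:C = 3 * m%:C by rewrite -lm; field.
have ilm : 'i * l%:C / 3 = 'i * m%:C by rewrite -mulrA lm.
rewrite /bsum /= lm ilm.
have HX q (a b : nat) : q = p + a%:R * m%:C + b%:R * 'i * m%:C -> mavg f N q m%:C = X a b.
  by move=> ->.
have HY q (a b : nat) : q = p + a%:R * m%:C + b%:R * 'i * m%:C ->
  mavg f N q ('i * m%:C) = Y a b by move=> ->.
rewrite (HX p 0%N 0%N) ?(HX (p + m%:C) 1%N 0%N) ?(HX (p + 2 * m%:C) 2%N 0%N);
  try by ring.
rewrite (HX (p + 'i * l%:C) 0%N 3%N) ?(HX (p + 'i * l%:C + m%:C) 1%N 3%N)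
  ?(HX (p + 'i * l%:C + 2 * m%:C) 2%N 3%N); try by rewrite lm'; ring.
rewrite (HY p 0%N 0%N) ?(HY (p + 'i * m%:C) 0%N 1%N)
  ?(HY (p + 2 * ('i * m%:C)) 0%N 2%N); try by ring.
rewrite (HY (p + l%:C) 3%N 0%N) ?(HY (p + l%:C + 'i * m%:C) 3%N 1%N)
  ?(HY (p + l%:C + 2 * ('i * m%:C)) 3%N 2%N); try by rewrite lm'; ring.
by rewrite lm' /=; field.
Qed.

End Goursat.

Section ReIm.
Variable R : realType.
Local Notation C := R[i].
Local Open Scope complex_scope.
Local Notation Re := (@complex.Re R).
Local Notation Im := (@complex.Im R).
Implicit Types (x y z : C) (r : R).

Lemma cReD x y : Re (x + y) = Re x + Re y. Proof. exact: raddfD. Qed.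
Lemma cImD x y : Im (x + y) = Im x + Im y. Proof. exact: raddfD. Qed.
Lemma cReN x : Re (- x) = - Re x. Proof. exact: raddfN. Qed.
Lemma cImN x : Im (- x) = - Im x. Proof. exact: raddfN. Qed.
Lemma cReM x y : Re (x * y) = Re x * Re y - Im x * Im y.
Proof. by case: x y => a b [c d]. Qed.
Lemma cImM x y : Im (x * y) = Re x * Im y + Im x * Re y.
Proof. by case: x y => a b [c d]. Qed.
Lemma Re_nat n : Re n%:R = n%:R.
Proof. by rewrite -(rmorph_nat (real_complex R)). Qed.
Lemma Im_nat n : Im n%:R = 0.
Proof. by rewrite -(rmorph_nat (real_complex R)). Qed.

Lemma cReV z : Re z^-1 = Re z / (Re z ^+ 2 + Im z ^+ 2).
Proof. by case: z. Qed.

Lemma cImV z : Im z^-1 = - Im z / (Re z ^+ 2 + Im z ^+ 2).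
Proof. by case: z => a b /=; rewrite mulNr. Qed.

Definition ReImE := (cReD, cImD, cReN, cImN, cReM, cImM, Re_nat, Im_nat).

Lemma complex_eq x y : Re x = Re y -> Im x = Im y -> x = y.
Proof. by case: x y => a b [c d] /= -> ->. Qed.

End ReIm.

Section Goursat2.
Variable R : realType.
Local Notation C := R[i].
Local Open Scope complex_scope.
Local Notation Re := (@complex.Re R).
Local Notation Im := (@complex.Im R).
Implicit Types (f g : C -> C) (z w p a : C) (l : R).

Definition insq p l z :=
  [/\ Re p <= Re z, Re z <= Re p + l, Im p <= Im z & Im z <= Im p + l].

Lemma insq_trans p l q m z : insq p l q -> Re q + m <= Re p + l ->
  Im q + m <= Im p + l -> insq q m z -> insq p l z.
Proof. by move=> [? ? ? ?] ? ? [? ? ? ?]; split; lra. Qed.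

Lemma insq_dist p l z w : insq p l z -> insq p l w -> cabs (z - w) <= 2 * l.
Proof.
move=> [? ? ? ?] [? ? ? ?]; apply: le_trans (cabs_ReIm _) _.
have -> : 2 * l = l + l by ring.
by rewrite !ReImE lerD// ler_norml; apply/andP; split; lra.
Qed.

Lemma bsum_bound f N p l (B : R) : 0 <= l ->
  (forall z, insq p l z ->
     Re z = Re p \/ Re z = Re p + l \/ Im z = Im p \/ Im z = Im p + l ->
     cabs (f z) <= B) ->
  cabs (bsum f N p l) <= 4 * l * B.
Proof.
move=> l0 hf.
have -> : 4 * l * B = l * (4 * B) by ring.
rewrite /bsum cabsM cabs_real_ge0// ler_wpM2l//.
have tl (t : R) : 0 <= t -> t <= 1 -> 0 <= t * l <= l.
  by move=> t0 t1; rewrite mulr_ge0// ler_piMl.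
have h1 : cabs (mavg f N p l%:C) <= B.
  apply: mavg_bound => t t0 t1; have /andP[? ?] := tl t t0 t1.
  by apply: hf; [split|]; rewrite !ReImE /=; lra.
have h2 : cabs (mavg f N (p + l%:C) ('i * l%:C)) <= B.
  apply: mavg_bound => t t0 t1; have /andP[? ?] := tl t t0 t1.
  by apply: hf; [split|]; rewrite !ReImE /=; lra.
have h3 : cabs (mavg f N (p + 'i * l%:C) l%:C) <= B.
  apply: mavg_bound => t t0 t1; have /andP[? ?] := tl t t0 t1.
  by apply: hf; [split|]; rewrite !ReImE /=; lra.
have h4 : cabs (mavg f N p ('i * l%:C)) <= B.
  apply: mavg_bound => t t0 t1; have /andP[? ?] := tl t t0 t1.
  by apply: hf; [split|]; rewrite !ReImE /=; lra.
have := cabsB (mavg f N p l%:C + 'i * mavg f N (p + l%:C) ('i * l%:C)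
  - mavg f N (p + 'i * l%:C) l%:C) ('i * mavg f N p ('i * l%:C)).
have := cabsB (mavg f N p l%:C + 'i * mavg f N (p + l%:C) ('i * l%:C))
  (mavg f N (p + 'i * l%:C) l%:C).
have := cabsD (mavg f N p l%:C) ('i * mavg f N (p + l%:C) ('i * l%:C)).
rewrite !(cabsM 'i) cabs_i !mul1r; lra.
Qed.

Definition subcorner p l (i j : nat) : C :=
  p + i%:R * (l / 3)%:C + j%:R * 'i * (l / 3)%:C.

Lemma Re_subcorner p l i j : Re (subcorner p l i j) = Re p + i%:R * (l / 3).
Proof. by rewrite /subcorner !ReImE /=; ring. Qed.

Lemma Im_subcorner p l i j : Im (subcorner p l i j) = Im p + j%:R * (l / 3).
Proof. by rewrite /subcorner !ReImE /=; ring. Qed.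

Lemma insq_sub p l (i j : 'I_3) z : 0 < l ->
  insq (subcorner p l i j) (l / 3) z -> insq p l z.
Proof.
move=> l0; have I3 (k : 'I_3) : 0 <= (k%:R : R) <= 2.
  by rewrite ler0n (ler_nat _ k 2) -ltnS ltn_ord.
have /andP[? ?] := I3 i; have /andP[? ?] := I3 j.
apply: insq_trans; last 2 first.
- by rewrite Re_subcorner; nra.
- by rewrite Im_subcorner; nra.
by split; rewrite ?Re_subcorner ?Im_subcorner; nra.
Qed.

(** No integral is at hand, so its vanishing becomes a bound for all large [N]. This form passes
    from nine subsquares to the square, because nine thresholds have a maximum; a failure therefore
    descends to nested squares shrinking to a point. *)
Lemma goursat f p l : 0 < l -> (forall z, insq p l z -> cdiff f z) ->
  forall e, 0 < e -> exists N0, forall N, (N0 <= N)%N ->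
    cabs (bsum f N p l) <= e * l ^+ 2.
Proof.
move=> l0 hf e e0; apply: contrapT => bad0.
pose good p l := exists N0, forall N, (N0 <= N)%N -> cabs (bsum f N p l) <= e * l ^+ 2.
have step q m : exists q', ~ good q m ->
    ~ good q' (m / 3) /\ exists i j : 'I_3, q' = subcorner q m i j.
  have [gqm|bqm] := pselect (good q m); first by exists q => /(_ gqm).
  apply: contrapT => hq; apply: bqm.
  have gs (ij : 'I_3 * 'I_3) : good (subcorner q m ij.1 ij.2) (m / 3).
    apply: contrapT => bad; apply: hq; exists (subcorner q m ij.1 ij.2) => _.
    by split=> //; exists ij.1, ij.2.
  have [N0 hN0] := choose_threshold gs.
  exists N0.+1 => -[//|N] NN; rewrite bsum_split.
  have -> : e * m ^+ 2 = \sum_(i < 3) \sum_(j < 3) (e * (m / 3) ^+ 2).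
    by rewrite !sumr_const !card_ord; field.
  apply: le_trans (cabs_sum _ _ _) _; apply: ler_sum => i _.
  apply: le_trans (cabs_sum _ _ _) _; apply: ler_sum => j _.
  exact: (hN0 (i, j)).
have /choice[nx hnx] : forall qm : C * R, exists q' : C, ~ good qm.1 qm.2 ->
    ~ good q' (qm.2 / 3) /\ exists i j : 'I_3, q' = subcorner qm.1 qm.2 i j.
  by move=> [q m]; exact: step.
pose L k : R := l / 3 ^+ k.
have L0 k : 0 < L k by rewrite divr_gt0// exprn_gt0.
have LS k : L k.+1 = L k / 3 by rewrite /L exprS invfM mulrA mulrAC.
pose P := fix P k := if k is k'.+1 then nx (P k', L k') else p.
have badP k : ~ good (P k) (L k).
  elim: k => [|k IH]; first by rewrite /L expr0 divr1.
  by rewrite LS; have [] := hnx (P k, L k) IH.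
have PS k : exists i j : 'I_3, P k.+1 = subcorner (P k) (L k) i j.
  by have [] := hnx (P k, L k) (@badP k).
have subP k n z : insq (P (k + n)%N) (L (k + n)%N) z -> insq (P k) (L k) z.
  elim: n z => [|n IH] z; first by rewrite addn0.
  rewrite addnS => hz; apply: IH; have [i [j E]] := PS (k + n)%N.
  by move: hz; rewrite E LS => /insq_sub; apply.
have corner k : insq (P k) (L k) (P k) by have := L0 k; split; lra.
have L2 k : L k <= l * 2^-1 ^+ k.
  by rewrite /L ler_pM2l// -exprVn lerXn2r// ?nnegrE ?invr_ge0//; lra.
have [z hz] : exists z, forall k, cabs (P k - z) <= 4 * (2 * l) * 2^-1 ^+ k.
  apply: cgeometric_limit => k; rewrite -mulrA.
  apply: le_trans (_ : 2 * L k <= _); last by rewrite ler_pM2l.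
  apply: (@insq_dist (P k)); last exact: corner.
  by apply: (subP k 1%N); rewrite addn1; exact: corner.
(* The squares are closed and contain the later corners, which converge to [z]. *)
have inz k : insq (P k) (L k) z.
  have approx (e' : R) : 0 < e' -> exists2 w, insq (P k) (L k) w & cabs (w - z) < e'.
    move=> e'0.
    have l8 : 0 < 8 * l by rewrite mulr_gt0.
    have [N hN] := exprn_half_small (divr_gt0 e'0 l8).
    exists (P (k + N)%N); first by apply: subP; exact: corner.
    apply: le_lt_trans (hz _) _; have := hN (k + N)%N (leq_addl _ _).
    by rewrite ltr_pdivlMr//; lra.
  split; apply/ler_addgt0Pr => e' /approx[w [? ? ? ?]];
  have := cabs_Re (w - z); have := cabs_Im (w - z); rewrite !ReImE !ler_norml;
  by move=> /andP[? ?] /andP[? ?]; lra.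
have [|D hD] := hf z; first by have := inz 0%N; rewrite /L expr0 divr1.
(* Perimeter [4 * L k] times the error [e / 8 * (2 * L k)] is exactly [e * L k ^+ 2]. *)
have [d [d0 hd]] := hD (e / 8) (divr_gt0 e0 (ltr0n _ 8)).
have l2 : 0 < 2 * l by rewrite mulr_gt0.
have [k hk] := exprn_half_small (divr_gt0 d0 l2).
have {}hk : 2 * L k < d.
  have := hk k (leqnn _).
  by rewrite ltr_pdivlMr//; have := L2 k; lra.
apply: (@badP k); exists 0%N => N _.
pose g w := f w - f z - D * (w - z).
have -> : bsum f N (P k) (L k) = bsum g N (P k) (L k).
  have -> : g = (fun w => f w + (-1) * (f z - D * z + D * w)).
    by apply/funext => w; rewrite /g; ring.
  by rewrite bsum_lin bsum_affine mulr0 addr0.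
apply: le_trans (bsum_bound (B := e / 8 * (2 * L k)) _ _ _) _; last by lra.
  exact: ltW.
move=> w hw _; have hwz : cabs (w - z) <= 2 * L k := insq_dist hw (inz k).
rewrite /g -{1}[w](subrKC z); apply: le_trans (hd _ _) _.
  exact: le_lt_trans hk.
by rewrite ler_pM2l// divr_gt0.
Qed.

End Goursat2.

(** * Rules of complex differentiation *)

Section CdiffAlgebra.
Variable R : realType.
Local Notation C := R[i].
Implicit Types (f g : C -> C) (z w a c : C).

Lemma cdiff_local f g z (d : R) : 0 < d ->
  (forall t, cabs t < d -> f (z + t) = g (z + t)) -> cdiff f z -> cdiff g z.
Proof.
move=> d0 fg [L hL]; exists L => e /hL[d' [d'0 hd']].
exists (Num.min d d'); split=> [|t]; first by rewrite lt_min d0.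
rewrite lt_min => /andP[td td'].
have gz : f z = g z by have := fg 0; rewrite addr0; apply; rewrite cabs0.
by rewrite -fg// -gz hd'.
Qed.

Lemma cdiff_cst c z : cdiff (fun=> c) z.
Proof.
exists 0 => e e0; exists 1; split=> // t _.
by rewrite subrr mul0r subr0 cabs0 mulr_ge0 ?cabs_ge0// ltW.
Qed.

Lemma cdiff_id z : cdiff id z.
Proof.
exists 1 => e e0; exists 1; split=> // t _.
have -> : id (z + t) - id z - 1 * t = 0 by rewrite /=; ring.
by rewrite cabs0 mulr_ge0 ?cabs_ge0// ltW.
Qed.

Lemma cdiff_lip f z : cdiff f z -> exists K d : R, [/\ 0 <= K, 0 < d &
  forall t, cabs t < d -> cabs (f (z + t) - f z) <= K * cabs t].
Proof.
move=> [L /(_ 1 ltr01)[d [d0 hd]]]; exists (cabs L + 1), d.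
split=> //; first by rewrite addr_ge0 ?cabs_ge0.
move=> t /hd; rewrite mul1r => h.
have -> : f (z + t) - f z = (f (z + t) - f z - L * t) + L * t by ring.
by apply: le_trans (cabsD _ _) _; rewrite cabsM; lra.
Qed.

Lemma cdiff_cont f z (e : R) : cdiff f z -> 0 < e ->
  exists d : R, 0 < d /\ forall t, cabs t < d -> cabs (f (z + t) - f z) < e.
Proof.
move=> /cdiff_lip[K [d [K0 d0 h]]] e0.
have K1 : 0 < K + 1 by lra.
exists (Num.min d (e / (K + 1))); split=> [|t].
  by rewrite lt_min d0 divr_gt0.
rewrite lt_min ltr_pdivlMr// => /andP[/h td te].
by have := cabs_ge0 t; nra.
Qed.

Lemma cdiffD f g z : cdiff f z -> cdiff g z -> cdiff (fun w => f w + g w) z.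
Proof.
move=> [L hL] [M hM]; exists (L + M) => e e0.
have e2 : 0 < e / 2 by lra.
have [d [d0 hd]] := hL _ e2; have [d' [d'0 hd']] := hM _ e2.
exists (Num.min d d'); split=> [|t]; first by rewrite lt_min d0.
rewrite lt_min => /andP[/hd td /hd' td'].
have -> : f (z + t) + g (z + t) - (f z + g z) - (L + M) * t =
  (f (z + t) - f z - L * t) + (g (z + t) - g z - M * t) by ring.
by apply: le_trans (cabsD _ _) _; lra.
Qed.

Lemma cdiffM f g z : cdiff f z -> cdiff g z -> cdiff (fun w => f w * g w) z.
Proof.
move=> cf cg.
have [K [d1 [K0 d10 hK]]] := cdiff_lip cf.
have [d2 [d20 h2]] := cdiff_cont cg ltr01.
case: (cf) (cg) => [L hL] [M hM]; exists (L * g z + f z * M) => e e0.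
pose S := cabs (g z) + cabs (f z) + 1.
have S0 : 0 < S by rewrite /S; have := cabs_ge0 (g z); have := cabs_ge0 (f z); lra.
have e1 : 0 < e / (3 * S) by rewrite divr_gt0// mulr_gt0.
have L1 : 0 < 3 * (cabs L + 1) by have := cabs_ge0 L; lra.
have [d3 [d30 h3]] := cdiff_cont cg (divr_gt0 e0 L1).
have [d4 [d40 h4]] := hL _ e1; have [d5 [d50 h5]] := hM _ e1.
exists (Num.min (Num.min d2 d3) (Num.min d4 d5)); split=> [|t].
  by rewrite !lt_min d20 d30 d40.
rewrite !lt_min => /andP[/andP[/h2 t2 /h3 t3] /andP[/h4 t4 /h5 t5]].
have -> : f (z + t) * g (z + t) - f z * g z - (L * g z + f z * M) * t =
  (f (z + t) - f z - L * t) * g (z + t) + f z * (g (z + t) - g z - M * t)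
  + L * (g (z + t) - g z) * t by ring.
apply: le_trans (cabsD _ _) _; rewrite !cabsM.
have gt : cabs (g (z + t)) <= S.
  have := cabs_sub_ge (g (z + t)) (g z); have := cabs_ge0 (f z); rewrite /S; lra.
have fS : cabs (f z) <= S by have := cabs_ge0 (g z); rewrite /S; lra.
have eS : e / (3 * S) * S = e / 3 by field; rewrite gt_eqF.
have a1 : cabs (f (z + t) - f z - L * t) * cabs (g (z + t)) <= e / 3 * cabs t.
  apply: le_trans (ler_pM (cabs_ge0 _) (cabs_ge0 _) t4 gt) _.
  by rewrite mulrAC eS.
have a2 : cabs (f z) * cabs (g (z + t) - g z - M * t) <= e / 3 * cabs t.
  apply: le_trans (ler_pM (cabs_ge0 _) (cabs_ge0 _) fS t5) _.
  by rewrite mulrA [S * _]mulrC eS.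
have a3 : cabs L * cabs (g (z + t) - g z) * cabs t <= e / 3 * cabs t.
  apply: ler_wpM2r; first exact: cabs_ge0.
  move: t3; rewrite ltr_pdivlMr// => t3.
  by have := cabs_ge0 L; have := cabs_ge0 (g (z + t) - g z); nra.
have := cabsD ((f (z + t) - f z - L * t) * g (z + t)) (f z * (g (z + t) - g z - M * t)).
by rewrite !cabsM; lra.
Qed.

Lemma cdiffV f z : f z != 0 -> cdiff f z -> cdiff (fun w => (f w)^-1) z.
Proof.
move=> fz0 cf; have Fp : 0 < cabs (f z) by rewrite cabs_gt0.
set F := cabs (f z) in Fp.
have [d1 [d10 h1]] := cdiff_cont cf (divr_gt0 Fp (ltr0n _ 2)).
case: (cf) => L hL; exists (- L / f z ^+ 2) => e e0.
have e1 : 0 < e * F ^+ 2 / 4 by rewrite divr_gt0// mulr_gt0// exprn_gt0.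
have L1 : 0 < 4 * (cabs L + 1) by have := cabs_ge0 L; lra.
have e2 : 0 < e * F ^+ 3 / (4 * (cabs L + 1)).
  by rewrite divr_gt0// mulr_gt0// exprn_gt0.
have [d2 [d20 h2]] := hL _ e1; have [d3 [d30 h3]] := cdiff_cont cf e2.
exists (Num.min d1 (Num.min d2 d3)); split=> [|t].
  by rewrite !lt_min d10 d20.
rewrite !lt_min => /andP[/h1 t1 /andP[/h2 t2 /h3 t3]].
have G2 : F / 2 <= cabs (f (z + t)).
  by have := cabs_sub_ge (f z) (f (z + t)); rewrite cabsBC -/F; lra.
have fG : f (z + t) != 0 by rewrite -cabs_gt0; lra.
have -> : (f (z + t))^-1 - (f z)^-1 - - L / f z ^+ 2 * t =
  (L * (f (z + t) - f z) * t - f z * (f (z + t) - f z - L * t))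
  / (f z ^+ 2 * f (z + t)) by field; rewrite fz0 fG.
rewrite cabs_div cabsM cabsX -/F ler_pdivrMr ?mulr_gt0 ?exprn_gt0//; last by lra.
apply: le_trans (cabsB _ _) _; rewrite !cabsM -/F.
have a3 : cabs L * cabs (f (z + t) - f z) <= e * F ^+ 3 / 4.
  move: t3; rewrite ltr_pdivlMr// => t3.
  by have := cabs_ge0 L; have := cabs_ge0 (f (z + t) - f z); lra.
have {}a3 := ler_wpM2r (cabs_ge0 t) a3.
have a2 := ler_wpM2l (ltW Fp) t2.
have a4 : e * cabs t * (F ^+ 2 * (F / 2)) <= e * cabs t * (F ^+ 2 * cabs (f (z + t))).
  apply: ler_wpM2l; first by rewrite mulr_ge0 ?cabs_ge0// ltW.
  by rewrite ler_pM2l ?exprn_gt0.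
apply: le_trans a4.
have -> : e * cabs t * (F ^+ 2 * (F / 2)) =
  e * F ^+ 3 / 4 * cabs t + F * (e * F ^+ 2 / 4 * cabs t) by field.
exact: lerD.
Qed.

Lemma cdiffX f z n : cdiff f z -> cdiff (fun w => f w ^+ n) z.
Proof.
move=> cf; elim: n => [|n IH]; first exact: cdiff_cst.
have -> : (fun w => f w ^+ n.+1) = (fun w => f w * f w ^+ n).
  by apply/funext => w; rewrite exprS.
exact: cdiffM.
Qed.

Lemma cdiffZ f z c : cdiff f z -> cdiff (fun w => c * f w) z.
Proof. by apply: cdiffM; exact: cdiff_cst. Qed.

Lemma cdiffB f g z : cdiff f z -> cdiff g z -> cdiff (fun w => f w - g w) z.
Proof.
move=> cf cg.
have -> : (fun w => f w - g w) = (fun w => f w + -1 * g w).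
  by apply/funext => w; rewrite mulN1r.
by apply: cdiffD cf _; exact: cdiffZ.
Qed.

Lemma cdiff_subC z a : cdiff (fun w => w - a) z.
Proof. by apply: cdiffB; [exact: cdiff_id|exact: cdiff_cst]. Qed.

Lemma cdiff_prod (I : Type) (s : seq I) (F : I -> C -> C) z :
  (forall i, cdiff (F i) z) -> cdiff (fun w => \prod_(i <- s) F i w) z.
Proof.
move=> hF; elim: s => [|i s IH].
  have -> : (fun w => \prod_(i <- [::]) F i w) = (fun=> 1).
    by apply/funext => w; rewrite big_nil.
  exact: cdiff_cst.
have -> : (fun w => \prod_(i <- i :: s) F i w) =
    (fun w => F i w * \prod_(i <- s) F i w).
  by apply/funext => w; rewrite big_cons.
exact: cdiffM.
Qed.

Lemma cdiff_affine f a z c : cdiff f (a + z * c) -> cdiff (fun w => f (a + w * c)) z.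
Proof.
move=> [L hL]; exists (L * c) => e e0.
have c1 : 0 < cabs c + 1 by have := cabs_ge0 c; lra.
have [d [d0 hd]] := hL _ (divr_gt0 e0 c1).
exists (d / (cabs c + 1)); split=> [|t]; first exact: divr_gt0.
rewrite ltr_pdivlMr// => td.
have h : cabs (t * c) <= cabs t * (cabs c + 1).
  by rewrite cabsM ler_wpM2l ?cabs_ge0//; lra.
have -> : a + (z + t) * c = a + z * c + t * c by ring.
have -> : L * c * t = L * (t * c) by ring.
apply: le_trans (hd _ (le_lt_trans h td)) _.
apply: le_trans (ler_wpM2l _ h) _; first by rewrite ltW// divr_gt0.
by rewrite (_ : e / _ * _ = e * cabs t)//; field; rewrite gt_eqF.
Qed.

End CdiffAlgebra.

(** * The Cauchy estimate from boundary sums *)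

Section CauchyEstimate.
Variable R : realType.
Local Notation C := R[i].
Local Open Scope complex_scope.
Local Notation Re := (@complex.Re R).
Local Notation Im := (@complex.Im R).
Implicit Types (f g : C -> C) (z w p a : C) (l : R).

(** Lower left corner of the square of side [l] centred at [a]. *)
Definition lcorner a l : C := a - (l / 2)%:C - 'i * (l / 2)%:C.

Lemma Re_lcorner a l : Re (lcorner a l) = Re a - l / 2.
Proof. by rewrite /lcorner !ReImE /=; ring. Qed.

Lemma Im_lcorner a l : Im (lcorner a l) = Im a - l / 2.
Proof. by rewrite /lcorner !ReImE /=; ring. Qed.

Lemma subcorner_center a l : subcorner (lcorner a l) l 1 1 = lcorner a (l / 3).
Proof.
apply: complex_eq; rewrite ?Re_subcorner ?Im_subcorner ?Re_lcorner ?Im_lcorner; lra.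
Qed.

(* Around an isolated bounded singularity at the centre of the square only the
   central subsquare contributes, and its contribution is at most its perimeter
   times the bound. *)
Lemma bsum_pole g a (B d : R) : 0 <= B -> (forall z, cabs (z - a) < d -> cabs (g z) <= B) ->
  forall j l, 0 < l -> 2 * (l / 3 ^+ j) < d ->
  (forall z, insq (lcorner a l) l z -> z <> a -> cdiff g z) ->
  forall e, 0 < e -> exists N0, forall N, (N0 <= N)%N ->
    cabs (bsum g N (lcorner a l) l) <= 4 * (l / 3 ^+ j) * B + e.
Proof.
move=> B0 hB; elim=> [|j IH] l l0 ld hg e e0.
  exists 0%N => N _; move: ld; rewrite expr0 divr1 => ld.
  apply: le_trans (bsum_bound (B := B) _ _ _) _; [exact: ltW| |by lra].
  move=> z hz _; apply: hB; apply: le_lt_trans ld.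
  by apply: (insq_dist hz); split; rewrite ?Re_lcorner ?Im_lcorner; lra.
have m0 : 0 < l / 3 by lra.
have E : l / 3 / 3 ^+ j = l / 3 ^+ j.+1 by rewrite exprS invfM mulrA.
pose p := lcorner a l.
pose b (i k : nat) : R := if (i == 1%N) && (k == 1%N) then 4 * (l / 3 ^+ j.+1) * B else 0.
have sub (ik : 'I_3 * 'I_3) : exists N0, forall N, (N0 <= N)%N ->
    cabs (bsum g N (subcorner p l ik.1 ik.2) (l / 3)) <= b ik.1 ik.2 + e / 9.
  case: ik => i k /=; rewrite /b; case: ifPn => [/andP[/eqP -> /eqP ->]|ik].
    rewrite /p subcorner_center -E; apply: IH => //; first by rewrite E.
      move=> z hz; apply: hg; apply: (@insq_sub _ _ _ (inord 1) (inord 1)) => //.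
      by rewrite !inordK// subcorner_center.
    by lra.
  (* The other eight subsquares miss the centre [a], so Goursat's lemma applies to each with the
     allowance [e / 9]. *)
  have e' : 0 < e / 9 / (l / 3) ^+ 2.
    by rewrite divr_gt0 ?exprn_gt0//; lra.
  have [|N0 hN0] := @goursat R g (subcorner p l i k) (l / 3) m0 _ _ e'.
    move=> z hz; apply: hg; first exact: insq_sub hz.
    move=> za; move/negP: ik; apply; move: hz => [].
    rewrite Re_subcorner Im_subcorner Re_lcorner Im_lcorner za => h1 h2 h3 h4.
    have I3 (x : 'I_3) : [\/ x = 0%N :> nat, x = 1%N :> nat | x = 2%N :> nat].
      by case: x => -[|[|[|]]] //= _; [apply: Or31|apply: Or32|apply: Or33].
    by case: (I3 i) h1 h2 => ->; case: (I3 k) h3 h4 => -> //= *; exfalso; lra.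
  exists N0 => N /hN0; rewrite add0r (_ : e / 9 / _ * _ = e / 9)//.
  by field; rewrite gt_eqF.
have [N0 hN0] := choose_threshold sub; exists N0.+1 => -[//|N] NN.
rewrite bsum_split.
have -> : 4 * (l / 3 ^+ j.+1) * B + e = \sum_(i < 3) \sum_(k < 3) (b i k + e / 9).
  by rewrite !big_ord_recl !big_ord0 /b; set q := l / _; rewrite /=; field.
apply: le_trans (cabs_sum _ _ _) _; apply: ler_sum => i _.
apply: le_trans (cabs_sum _ _ _) _; apply: ler_sum => k _.
exact: (hN0 (i, k)).
Qed.

Lemma mavg_Im (u : C) f N p v (c : R) :
  (forall t : R, 0 <= t -> t <= 1 -> c <= Im (u * f (p + t%:C * v))) ->
  c <= Im (u * mavg f N p v).
Proof.
apply: (mavg_ind (K := fun z => c <= Im (u * z))) => x y z hx hy hz.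
have -> : u * ((x + y + z) / 3) = (3^-1 : R)%:C * (u * x + u * y + u * z).
  by rewrite fmorphV rmorph_nat; field.
by rewrite cImM !cImD /=; lra.
Qed.

(** Replaces the value [2 * pi * 'i] of the winding integral. On each side the component that enters
    the imaginary part is [s / (x ^+ 2 + s ^+ 2)] with [x] at most [s] in absolute value, hence at
    least [1 / (2 * s)]; four sides of length [2 * s] give [4]. *)
Lemma bsum_inv_ge a (s : R) N : 0 < s ->
  4 <= cabs (bsum (fun z => (z - a)^-1) N (lcorner a (2 * s)) (2 * s)).
Proof.
move=> s0; apply: le_trans (cabs_Im _); apply: le_trans (ler_norm _).
set p := lcorner a _; set F := fun z => _.
have key (x : R) : `|x| <= s -> (2 * s)^-1 <= s / (x ^+ 2 + s ^+ 2).
  move=> xs; have x2 : x ^+ 2 <= s ^+ 2.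
    by rewrite -(real_normK (num_real x)) lerXn2r ?nnegrE ?normr_ge0 ?(ltW s0).
  have s2 : 0 < s ^+ 2 by rewrite exprn_gt0.
  have den : 0 < x ^+ 2 + s ^+ 2 by have := sqr_ge0 x; lra.
  rewrite ler_pdivlMr// mulrC ler_pdivrMr; last by lra.
  by rewrite -subr_ge0; nra.
have hx (t : R) : 0 <= t -> t <= 1 -> `|2 * s * t - s| <= s.
  by move=> t0 t1; rewrite ler_norml; apply/andP; split; nra.
have h1 : (2 * s)^-1 <= Im (1 * mavg F N p (2 * s)%:C).
  apply: mavg_Im => t t0 t1; apply: le_trans (key _ (hx t t0 t1)) _.
  rewrite /F mul1r cImV !ReImE /=.
  by rewrite le_eqVlt; apply/orP; left; apply/eqP; congr (_ / _); field.
have h2 : (2 * s)^-1 <= Im ('i * mavg F N (p + (2 * s)%:C) ('i * (2 * s)%:C)).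
  apply: mavg_Im => t t0 t1; apply: le_trans (key _ (hx t t0 t1)) _.
  rewrite /F cImM cReV cImV !ReImE /=.
  rewrite le_eqVlt; apply/orP; left; apply/eqP.
  by rewrite mul0r add0r mul1r; congr (_ / _); field.
have h3 : (2 * s)^-1 <= Im (-1 * mavg F N (p + 'i * (2 * s)%:C) (2 * s)%:C).
  apply: mavg_Im => t t0 t1; apply: le_trans (key _ (hx t t0 t1)) _.
  rewrite /F mulN1r cImN cImV !ReImE /= -mulNr.
  by rewrite le_eqVlt; apply/orP; left; apply/eqP; congr (_ / _); field.
have h4 : (2 * s)^-1 <= Im (- 'i * mavg F N p ('i * (2 * s)%:C)).
  apply: mavg_Im => t t0 t1; apply: le_trans (key _ (hx t t0 t1)) _.
  rewrite /F mulNr cImN cImM cReV cImV !ReImE /=.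
  rewrite le_eqVlt; apply/orP; left; apply/eqP.
  by rewrite mul0r add0r mul1r -mulNr; congr (_ / _); field.
rewrite /bsum; set u1 := mavg _ _ _ _ in h1 *; set u2 := mavg _ _ _ _ in h2 *.
set u3 := mavg _ _ _ _ in h3 *; set u4 := mavg _ _ _ _ in h4 *.
have -> : (2 * s)%:C * (u1 + 'i * u2 - u3 - 'i * u4) =
  (2 * s)%:C * (1 * u1 + 'i * u2 + -1 * u3 + - 'i * u4) by ring.
rewrite cImM [Im (_%:C)]/= mul0r addr0 [Re (_%:C)]/= !cImD.
have -> : 4 = 2 * s * ((2 * s)^-1 + (2 * s)^-1 + (2 * s)^-1 + (2 * s)^-1).
  by field; rewrite gt_eqF.
by rewrite ler_pM2l; lra.
Qed.

(* Cauchy's formula with the constants left unoptimised: compare the boundary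
   sums of [f z / (z - a)] and [f a / (z - a)]. *)
Lemma cauchy_estimate f a (s M : R) : 0 < s ->
  (forall z, cabs (z - a) <= 2 * s -> cdiff f z) ->
  (forall z, s <= cabs (z - a) -> cabs (z - a) <= 2 * s -> cabs (f z) <= M) ->
  cabs (f a) <= 2 * M.
Proof.
move=> s0 df hM.
have sq z : insq (lcorner a (2 * s)) (2 * s) z -> cabs (z - a) <= 2 * s.
  move=> [h1 h2 h3 h4]; rewrite Re_lcorner Im_lcorner in h1 h2 h3 h4.
  apply: le_trans (cabs_ReIm _) _; rewrite !ReImE (_ : 2 * s = s + s); last by ring.
  by rewrite lerD// ler_norml; apply/andP; split; lra.
have dfa : cdiff f a by apply: df; rewrite subrr cabs0; lra.
have [K [d [K0 d0 hK]]] := cdiff_lip dfa.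
pose g z := (f z - f a) / (z - a).
have gK z : cabs (z - a) < d -> cabs (g z) <= K.
  move=> zd; rewrite /g cabs_div; have [->|za] := eqVneq z a.
    by rewrite !subrr cabs0 mul0r.
  rewrite ler_pdivrMr ?cabs_gt0 ?subr_eq0//.
  by have := hK _ zd; rewrite subrKC.
have dg z : insq (lcorner a (2 * s)) (2 * s) z -> z <> a -> cdiff g z.
  move=> /sq zs za; apply: cdiffM.
    by apply: cdiffB; [exact: df|exact: cdiff_cst].
  apply: cdiffV; last exact: cdiff_subC.
  by rewrite subr_eq0; apply/eqP.
have s2 : 0 < 2 * s by lra.
(* The [4] comes from [bsum_inv_ge]; [8 * M] is the perimeter [8 * s] times the bound [M / s] of
   [f z / (z - a)]; [e] absorbs the boundary sum of the bounded quotient [g]. *)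
suff key e : 0 < e -> cabs (f a) * 4 <= 8 * M + e.
  have {}key : cabs (f a) * 4 <= 8 * M by apply/ler_addgt0Pr.
  by lra.
move=> e0; have [j hj] : exists j, 2 * (2 * s / 3 ^+ j) < d /\ 4 * (2 * s / 3 ^+ j) * K <= e / 2.
  have m0 : 0 < Num.min (d / (4 * s)) (e / (16 * s * (K + 1))).
    by rewrite lt_min !divr_gt0 ?mulr_gt0//; lra.
  have [j /(_ j (leqnn _))] := exprn_half_small m0.
  rewrite lt_min !ltr_pdivlMr ?mulr_gt0//; last by lra.
  move=> /andP[h1 h2]; exists j.
  have h3 : (3 ^+ j)^-1 <= (2^-1 : R) ^+ j.
    by rewrite -exprVn lerXn2r ?nnegrE ?invr_ge0//; lra.
  move: h1 h2 h3; set v := (3 ^+ j)^-1; set w := 2^-1 ^+ j => h1 h2 h3.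
  have w0 : 0 <= w by rewrite exprn_ge0// invr_ge0.
  have h5 := ler_wpM2l (ltW s0) h3; have h6 := ler_wpM2r K0 h5.
  have h7 := mulr_ge0 (ltW s0) w0.
  by split; lra.
have [N0 /(_ _ (leqnn _))] := bsum_pole K0 gK s2 hj.1 dg (divr_gt0 e0 (ltr0n _ 2)).
set p := lcorner _ _ => small.
pose q z := f z / (z - a).
have Eg : bsum q N0 p (2 * s) =
    bsum g N0 p (2 * s) + f a * bsum (fun z => (z - a)^-1) N0 p (2 * s).
  by rewrite -bsum_lin; congr (bsum _ _ _ _); apply/funext => z; rewrite /q /g; ring.
have qb : cabs (bsum q N0 p (2 * s)) <= 4 * (2 * s) * (M / s).
  apply: bsum_bound; first exact: ltW.
  move=> z hz bz; have [h1 h2 h3 h4] := hz.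
  have zs : s <= cabs (z - a).
    have hRe := cabs_Re (z - a); have hIm := cabs_Im (z - a).
    move: hRe hIm bz; rewrite !ReImE /= => hRe hIm.
    move=> [b|[b|[b|b]]].
    - by apply: le_trans hRe; rewrite -normrN; apply: le_trans (ler_norm _); lra.
    - by apply: le_trans hRe; apply: le_trans (ler_norm _); lra.
    - by apply: le_trans hIm; rewrite -normrN; apply: le_trans (ler_norm _); lra.
    - by apply: le_trans hIm; apply: le_trans (ler_norm _); lra.
  have fM := hM z zs (sq _ hz).
  rewrite /q cabs_div ler_pM ?cabs_ge0 ?invr_ge0 ?cabs_ge0//.
  by rewrite lef_pV2 ?posrE//; exact: lt_le_trans zs.
have := bsum_inv_ge a N0 s0; rewrite -/p.
set lam := bsum (fun z => (z - a)^-1) _ _ _ in Eg *; move=> lam4.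
have fl : cabs (f a) * cabs lam <= 8 * M + e.
  have -> : cabs (f a) * cabs lam = cabs (bsum q N0 p (2 * s) - bsum g N0 p (2 * s)).
    by rewrite Eg addrAC subrr add0r cabsM.
  apply: le_trans (cabsB _ _) _.
  have <- : 4 * (2 * s) * (M / s) = 8 * M by field; rewrite gt_eqF.
  by have := hj.2; lra.
by apply: le_trans fl; rewrite ler_wpM2l ?cabs_ge0.
Qed.

End CauchyEstimate.

(** * Divided differences *)

Section Tame.
Variable R : realType.
Local Notation C := R[i].
Local Open Scope complex_scope.
Implicit Types (f g : C -> C) (z w p a b c : C) (rho M : R) (E : seq C).

Definition dq f b z : C := (f z - f b) / (z - b).

(* [M] bounds [f] on an outer annulus only; it then also bounds [f] on the inner
   disc, however large [f] is near [E]. *)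
Definition tame E rho M f :=
  [/\ forall z, cabs z < rho -> z \notin E -> cdiff f z,
      exists B, forall z, cabs z < rho -> cabs (f z) <= B &
      forall z, rho / 4 <= cabs z -> cabs z < rho -> cabs (f z) <= M].

(* The Cauchy estimate applies to [f ^+ N * q ^+ 2], which is differentiable also
   on [E]; then let [N] tend to infinity. *)
Lemma tame_max E rho M f a : 0 < rho -> 0 <= M -> tame E rho M f ->
  cabs a <= rho / 10 -> a \notin E -> cabs (f a) <= M.
Proof.
move=> r0 M0 [df [B hB] hM] ar aE.
pose q z := \prod_(e <- E) (z - e).
pose bnd (s : seq C) : R := \prod_(e <- s) (rho + cabs e).
have bnd0 s : 0 <= bnd s.
  by apply: prodr_ge0 => e _; rewrite addr_ge0 ?cabs_ge0// ltW.
have prod_le (s : seq C) z : cabs z < rho -> cabs (\prod_(e <- s) (z - e)) <= bnd s.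
  move=> zr; rewrite cabs_prod; apply: ler_prod => e _; rewrite cabs_ge0/=.
  by apply: le_trans (cabsB _ _) _; lra.
have B0 : 0 <= B by apply: le_trans (cabs_ge0 _) (hB 0 _); rewrite cabs0.
have est N : cabs (f a) ^+ N * cabs (q a) ^+ 2 <= 2 * (M ^+ N * bnd E ^+ 2).
  rewrite -!cabsX -cabsM.
  (* As [cabs a <= rho / 10], the disc of radius [2 * s] about [a] stays within radius
     [9 / 10 * rho], and points at distance at least [s] from [a] lie beyond [3 / 10 * rho], in the
     annulus where [M] is a bound. *)
  apply: (@cauchy_estimate R (fun z => f z ^+ N * q z ^+ 2) a (2 / 5 * rho)) => [|z zs|z sz zs].
  - by lra.
  - have zr : cabs z < rho by have := cabs_triB z a 0; rewrite !subr0; lra.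
    have [zE|zE] := boolP (z \in E); last first.
      apply: cdiffM; apply: cdiffX; first exact: df.
      by apply: cdiff_prod => e; exact: cdiff_subC.
    pose K := B ^+ N * bnd (rem z E) ^+ 2 + 1.
    have K0 : 0 < K by rewrite ltr_wpDl// mulr_ge0// exprn_ge0.
    (* At a point of [E] the square [q ^+ 2] vanishes to second order and [f] is bounded, so the
       derivative is [0]. *)
    exists 0 => e e0; exists (Num.min (rho - cabs z) (e / K)).
    split=> [|t]; first by rewrite lt_min subr_gt0 zr divr_gt0.
    rewrite lt_min ltr_pdivlMr// => /andP[tr te].
    have ztr : cabs (z + t) < rho by have := cabsD z t; lra.
    have -> : q z = 0 by rewrite /q (big_rem z)//= subrr mul0r.
    rewrite expr0n mulr0 mul0r !subr0 cabsM !cabsX.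
    have -> : cabs (q (z + t)) = cabs t * cabs (\prod_(e <- rem z E) (z + t - e)).
      by rewrite /q (big_rem z)//= cabsM addrAC subrr add0r.
    have p1 := prod_le (rem z E) _ ztr.
    have f1 : cabs (f (z + t)) ^+ N <= B ^+ N by rewrite lerXn2r ?nnegrE ?cabs_ge0 ?hB.
    have p2 : cabs (\prod_(e <- rem z E) (z + t - e)) ^+ 2 <= bnd (rem z E) ^+ 2.
      by rewrite lerXn2r ?nnegrE ?cabs_ge0.
    have f2 := ler_pM (exprn_ge0 _ (cabs_ge0 _)) (exprn_ge0 _ (cabs_ge0 _)) f1 p2.
    rewrite exprMn mulrCA.
    apply: le_trans (_ : cabs t ^+ 2 * K <= _).
      by rewrite ler_wpM2l ?exprn_ge0 ?cabs_ge0// /K; lra.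
    by have := cabs_ge0 t; rewrite expr2; nra.
  - have zr : cabs z < rho by have := cabs_triB z a 0; rewrite !subr0; lra.
    have zr4 : rho / 4 <= cabs z by have := cabsB z a; lra.
    rewrite cabsM !cabsX ler_pM ?exprn_ge0 ?cabs_ge0//.
      by rewrite lerXn2r ?nnegrE ?cabs_ge0 ?hM.
    by rewrite lerXn2r ?nnegrE ?cabs_ge0 ?prod_le.
rewrite leNgt; apply/negP => Mfa.
have fa0 : 0 < cabs (f a) by exact: le_lt_trans Mfa.
have qa0 : 0 < cabs (q a) ^+ 2.
  rewrite exprn_gt0// cabs_gt0 /q prodf_seq_neq0; apply/allP => e eE /=.
  by rewrite subr_eq0; apply: contraNneq aE => ->.
have b1 : 0 < 2 * bnd E ^+ 2 + 1 by have := exprn_ge0 2 (bnd0 E); lra.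
have [||N /(_ N (leqnn _))] := @exprn_small R (M / cabs (f a)) _ _ _ (divr_gt0 qa0 b1).
- by rewrite divr_ge0// ltW.
- by rewrite ltr_pdivrMr// mul1r.
rewrite expr_div_n ltr_pdivlMr// mulrAC ltr_pdivrMr ?exprn_gt0//.
by have := est N; have := exprn_ge0 N M0; lra.
Qed.

Lemma cdiff_dq f b z : z != b -> cdiff f z -> cdiff (dq f b) z.
Proof.
move=> zb df; apply: cdiffM.
  by apply: cdiffB => //; exact: cdiff_cst.
by apply: cdiffV (cdiff_subC _ _); rewrite subr_eq0.
Qed.

(** On the annulus [z] is at distance at least [3 / 20 * rho] from [b], and [cabs (f b) <= M] by
    [tame_max]; this is the origin of the factor [20 / rho]. At [b] itself the quotient is [0] by
    convention, so [b] joins the exceptional set, and the lemma can be iterated for higher divided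
    differences. *)
Lemma tame_dq E rho M f b : 0 < rho -> 0 <= M -> tame E rho M f ->
  cabs b <= rho / 10 -> b \notin E -> tame (b :: E) rho (20 / rho * M) (dq f b).
Proof.
move=> r0 M0 tf br bE; have fbM := tame_max r0 M0 tf br bE.
have [df [B hB] hM] := tf.
have brho : cabs b < rho by lra.
split.
- move=> z zr; rewrite inE negb_or => /andP[zb zE].
  by apply: cdiff_dq => //; exact: df.
- have [K [d [K0 d0 hK]]] := cdiff_lip (df b brho bE).
  have B0 : 0 <= B by apply: le_trans (cabs_ge0 _) (hB b brho).
  exists (K + 2 * B / d) => z zr; rewrite /dq cabs_div.
  have [->|zb] := eqVneq z b.
    have := divr_ge0 (mulr_ge0 (ler0n _ 2) B0) (ltW d0).
    by rewrite !subrr cabs0 mul0r; lra.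
  have zb0 : 0 < cabs (z - b) by rewrite cabs_gt0 subr_eq0.
  have Bd : 0 <= 2 * B / d by rewrite divr_ge0 ?mulr_ge0// ltW.
  rewrite ler_pdivrMr// mulrDl.
  have [zd|zd] := ltP (cabs (z - b)) d.
    by have := hK _ zd; rewrite subrKC; have := mulr_ge0 Bd (ltW zb0); lra.
  have h : 2 * B <= 2 * B / d * cabs (z - b).
    by rewrite mulrAC ler_pdivlMr// ler_wpM2l// mulr_ge0.
  have := cabsB (f z) (f b); have := hB z zr; have := hB b brho.
  by have := mulr_ge0 K0 (ltW zb0); lra.
- move=> z z4 zr; rewrite /dq cabs_div.
  have zb0 : rho * 3 / 20 <= cabs (z - b) by have := cabs_sub_ge z b; lra.
  have zb1 : 0 < cabs (z - b) by lra.
  rewrite ler_pdivrMr//.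
  apply: le_trans (_ : 20 / rho * M * (rho * 3 / 20) <= _); last first.
    by rewrite ler_wpM2l// mulr_ge0// divr_ge0// ltW.
  have -> : 20 / rho * M * (rho * 3 / 20) = 3 * M by field; rewrite gt_eqF.
  by have := cabsB (f z) (f b); have := hM z z4 zr; lra.
Qed.

Lemma tame_hol rho M f : (forall z, cabs z < rho -> cdiff f z) ->
  (forall z, cabs z < rho -> cabs (f z) <= M) -> tame [::] rho M f.
Proof.
by move=> df hM; split=> [z zr _|//|z _]; [exact: df|exists M|exact: hM].
Qed.

(** A Lipschitz difference quotient is Cauchy as its argument approaches [a], and its limit is the
    derivative. *)
Lemma lip_dq_cdiff f a (r K : R) : 0 < r -> 0 <= K ->
  (forall b c, b != a -> c != a -> cabs (b - a) < r -> cabs (c - a) < r ->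
     cabs (dq f a b - dq f a c) <= K * cabs (b - c)) -> cdiff f a.
Proof.
move=> r0 K0 h; have r2 k : 0 < r / 2 * 2^-1 ^+ k.
  by rewrite mulr_gt0 ?exprn_gt0 ?invr_gt0//; lra.
pose x k : C := a + (r / 2 * 2^-1 ^+ k)%:C.
have xa k : x k - a = (r / 2 * 2^-1 ^+ k)%:C by rewrite /x addrC addKr.
have cx k : cabs (x k - a) = r / 2 * 2^-1 ^+ k by rewrite xa cabs_real_ge0// ltW.
have xn k : x k != a by rewrite -subr_eq0 -cabs_gt0 cx.
have x1 k : (2^-1 : R) ^+ k <= 1 by rewrite exprn_ile1// ?invr_ge0//; lra.
have xr k : cabs (x k - a) < r by rewrite cx; have := x1 k; nra.
have [L hL] : exists L : C, forall k, cabs (dq f a (x k) - L) <= 4 * (K * r) * 2^-1 ^+ k.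
  apply: cgeometric_limit => k; apply: le_trans (h _ _ _ _ _ _) _ => //.
  rewrite -mulrA ler_wpM2l//; apply: le_trans (cabs_triB _ a _) _.
  rewrite cx (cabsBC a) cx exprS; have := r2 k.
  by set y := 2^-1 ^+ k; lra.
have bound b : b != a -> cabs (b - a) < r -> cabs (dq f a b - L) <= K * cabs (b - a).
  move=> ba br; apply/ler_addgt0Pr => e e0.
  have P0 : 0 < 5 * K * r + 1 by have := mulr_ge0 K0 (ltW r0); lra.
  have [k /(_ k (leqnn _)) hk] := exprn_half_small (divr_gt0 e0 P0).
  rewrite ltr_pdivlMr// in hk.
  apply: le_trans (cabs_triB _ (dq f a (x k)) _) _.
  have h1 := h b (x k) ba (xn k) br (xr k).
  have h2 := hL k.
  have h3 : cabs (b - x k) <= cabs (b - a) + r / 2 * 2^-1 ^+ k.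
    by rewrite -(cx k) (cabsBC (x k)); exact: cabs_triB.
  have h4 := ler_wpM2l K0 h3.
  have y0 : 0 <= (2^-1 : R) ^+ k by rewrite exprn_ge0 ?invr_ge0.
  move: hk h2 h4 y0; set y := 2^-1 ^+ k => hk h2 h4 y0.
  by have := mulr_ge0 (mulr_ge0 K0 (ltW r0)) y0; lra.
exists L => e e0; have K1 : 0 < K + 1 by lra.
exists (Num.min r (e / (K + 1))); split=> [|t]; first by rewrite lt_min r0 divr_gt0.
rewrite lt_min ltr_pdivlMr// => /andP[tr te].
have [->|t0] := eqVneq t 0.
  by rewrite addr0 subrr mulr0 subrr cabs0 mulr0.
have ata : a + t - a = t by rewrite addrC addKr.
have := bound (a + t); rewrite -subr_eq0 ata /dq ata => /(_ t0 tr) hb.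
have -> : f (a + t) - f a - L * t = ((f (a + t) - f a) / t - L) * t by field.
rewrite cabsM ler_wpM2r ?cabs_ge0//; apply: le_trans hb _.
by have := cabs_ge0 t; nra.
Qed.

Definition hol rho f := forall z, cabs z < rho -> cdiff f z.

Lemma hol_shift rho f a : hol rho f -> hol (rho - cabs a) (fun z => f (a + z)).
Proof.
move=> hf z zr; have -> : (fun z => f (a + z)) = (fun z => f (a + z * 1)).
  by apply/funext => y; rewrite mulr1.
by apply: cdiff_affine; apply: hf; rewrite mulr1; have := cabsD a z; lra.
Qed.

(** This is [tame_max] at [b] for the second divided difference, whose exceptional points are [c]
    and [a]. *)
Lemma dq2_bound rho M f a b c : 0 < rho -> 0 <= M -> hol rho f ->
  (forall z, cabs z < rho -> cabs (f z) <= M) ->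
  b != a -> c != a ->
  cabs a <= rho / 10 -> cabs b <= rho / 10 -> cabs c <= rho / 10 ->
  cabs (dq f a b - dq f a c) <= 20 / rho * (20 / rho * M) * cabs (b - c).
Proof.
move=> r0 M0 hf fM ba ca ar br cr.
have r20 : 0 <= 20 / rho by rewrite divr_ge0// ltW.
have [->|bc] := eqVneq b c; first by rewrite !subrr cabs0 mulr0.
have t0 := tame_hol hf fM.
have t1 := tame_dq r0 M0 t0 ar isT.
have t2 := tame_dq r0 (mulr_ge0 r20 M0) t1 cr (_ : c \notin [:: a]).
rewrite inE ca in t2; have {}t2 := t2 isT.
have := tame_max r0 (mulr_ge0 r20 (mulr_ge0 r20 M0)) t2 br.
rewrite !inE negb_or bc ba => /(_ isT).
by rewrite {1}/dq cabs_div ler_pdivrMr// cabs_gt0 subr_eq0.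
Qed.

(** The Lipschitz bound on difference quotients depends on [M] alone and not on [k], so it survives
    a pointwise limit and gives the derivative back through [lip_dq_cdiff]. *)
Lemma hol_limit rho M (F : nat -> C -> C) f : 0 <= M ->
  (forall k, hol rho (F k)) -> (forall k z, cabs z < rho -> cabs (F k z) <= M) ->
  (forall z, cabs z < rho -> forall e : R, 0 < e ->
     exists N, forall k, (N <= k)%N -> cabs (F k z - f z) < e) -> hol rho f.
Proof.
move=> M0 hF FM lim a ar.
pose r := rho - cabs a; have r0 : 0 < r by rewrite subr_gt0.
have inr z : cabs z < r -> cabs (a + z) < rho by have := cabsD a z; rewrite /r; lra.
have K0 : 0 <= 20 / r * (20 / r * M) by rewrite !mulr_ge0 ?invr_ge0// ltW.
suff : cdiff (fun z => f (a + z)) 0.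
  set g := fun z => f (a + z) => dg.
  have -> : f = (fun z => g (- a + z * 1)).
    by apply/funext => y; rewrite /g mulr1 addrA subrr add0r.
  by apply: cdiff_affine; rewrite mulr1 addrC subrr.
apply: (@lip_dq_cdiff _ _ (r / 10) _ _ K0); first by lra.
move=> b c b0 c0; rewrite !subr0 => br cr; apply/ler_addgt0Pr => e e0.
(* Errors below [e / m] in the values become [2 * (e / m) / cabs b] and [2 * (e / m) / cabs c] in
   the quotients, which add up to [e]. *)
pose m := 2 * ((cabs b)^-1 + (cabs c)^-1).
have bp : 0 < cabs b by rewrite cabs_gt0.
have cp : 0 < cabs c by rewrite cabs_gt0.
have m0 : 0 < m by rewrite mulr_gt0// addr_gt0// invr_gt0.
have em := divr_gt0 e0 m0.
have abr : cabs b < r by lra.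
have acr : cabs c < r by lra.
have a0r : cabs (0 : C) < r by rewrite cabs0.
have [N1 h1] := lim _ (inr _ a0r) _ em; have [N2 h2] := lim _ (inr _ abr) _ em.
have [N3 h3] := lim _ (inr _ acr) _ em; pose k := maxn N1 (maxn N2 N3).
have {h1} h1 := h1 k (leq_maxl _ _).
have {h2} h2 := h2 k (leq_trans (leq_maxl _ _) (leq_maxr _ _)).
have {h3} h3 := h3 k (leq_trans (leq_maxr _ _) (leq_maxr _ _)).
pose g z := F k (a + z); pose h z := f (a + z).
have hg : hol r g by exact: hol_shift.
have gM z : cabs z < r -> cabs (g z) <= M by move=> zr; apply/FM/inr.
have near x : x != 0 -> cabs (F k (a + x) - f (a + x)) < e / m ->
    cabs (dq g 0 x - dq h 0 x) <= 2 * (e / m) * (cabs x)^-1.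
  move=> x0 hx; rewrite /dq subr0 -mulrBl cabsM cabsV ler_wpM2r ?invr_ge0 ?cabs_ge0//.
  have -> : g x - g 0 - (h x - h 0) = (g x - h x) - (g 0 - h 0) by ring.
  by apply: le_trans (cabsB _ _) _; rewrite /g /h; lra.
have nb := near b b0 h2; have nc := near c c0 h3.
have br10 : cabs b <= r / 10 by lra.
have cr10 : cabs c <= r / 10 by lra.
have a10 : cabs (0 : C) <= r / 10 by rewrite cabs0; lra.
have := dq2_bound r0 M0 hg gM b0 c0 a10 br10 cr10.
have -> : e = 2 * (e / m) * (cabs b)^-1 + 2 * (e / m) * (cabs c)^-1.
  have : e = e / m * m by rewrite divfK// gt_eqF.
  by set q := e / m => {1}->; rewrite /m; ring.
have := cabs_triB (dq h 0 b) (dq g 0 b) (dq h 0 c).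
have := cabs_triB (dq g 0 b) (dq g 0 c) (dq h 0 c).
by rewrite -/h (cabsBC (dq h 0 b) (dq g 0 b)); lra.
Qed.

(* [0] when [f] is not differentiable at [a]. *)
Definition der f a : C :=
  if pselect (exists L : C, forall e : R, 0 < e -> exists d : R, 0 < d /\
    forall t : C, cabs t < d -> cabs (f (a + t) - f a - L * t) <= e * cabs t)
  is left H then projT1 (cid H) else 0.

Lemma derP f a : cdiff f a -> forall e : R, 0 < e -> exists d : R, 0 < d /\
  forall t : C, cabs t < d -> cabs (f (a + t) - f a - der f a * t) <= e * cabs t.
Proof. by move=> df; rewrite /der; case: pselect => // H; exact: (projT2 (cid H)). Qed.

Definition slope f z : C := if z == 0 then der f 0 else (f z - f 0) / z.

Lemma slopeE f z : f z = f 0 + z * slope f z.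
Proof.
by rewrite /slope; case: eqVneq => [->|z0]; [rewrite mul0r addr0|field].
Qed.

Lemma slope_dq f z : z != 0 -> slope f z = dq f 0 z.
Proof. by move=> z0; rewrite /slope (negPf z0) /dq subr0. Qed.

Lemma slope_cont0 f (e : R) : cdiff f 0 -> 0 < e ->
  exists d : R, 0 < d /\ forall t, cabs t < d -> cabs (slope f t - slope f 0) <= e.
Proof.
move=> df e0; have [d [d0 hd]] := derP df e0; exists d; split=> // t td.
have [->|t0] := eqVneq t 0; first by rewrite subrr cabs0 ltW.
have := hd t td; rewrite add0r {2}/slope eqxx /slope (negPf t0).
have -> : f t - f 0 - der f 0 * t = ((f t - f 0) / t - der f 0) * t by field.
by rewrite cabsM ler_pM2r// cabs_gt0.
Qed.

(** Within [rho / 10] the bound is [tame_max] for [dq f 0], beyond it a direct division. The point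
    [0] is exceptional for [dq f 0], so its value is reached as a limit. *)
Lemma slope_bound rho M f : 0 < rho -> 0 <= M -> hol rho f ->
  (forall z, cabs z < rho -> cabs (f z) <= M) ->
  forall z, cabs z < rho -> cabs (slope f z) <= 20 / rho * M.
Proof.
move=> r0 M0 hf fM.
have r20 : 0 <= 20 / rho by rewrite divr_ge0// ltW.
have o10 : cabs (0 : C) <= rho / 10 by rewrite cabs0; lra.
have t1 := tame_dq r0 M0 (tame_hol hf fM) o10 isT.
have inner z : z != 0 -> cabs z <= rho / 10 -> cabs (slope f z) <= 20 / rho * M.
  move=> z0 z10; rewrite slope_dq//; apply: (tame_max r0 (mulr_ge0 r20 M0) t1) => //.
  by rewrite inE.
move=> z zr; have [->|z0] := eqVneq z 0.
  apply/ler_addgt0Pr => e e0.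
  have df0 : cdiff f 0 by apply: hf; rewrite cabs0.
  have [d [d0 hd]] := slope_cont0 df0 e0.
  pose t : C := (Num.min (d / 2) (rho / 10))%:C.
  have tp : 0 < Num.min (d / 2) (rho / 10) by rewrite lt_min; lra.
  have ct : cabs t = Num.min (d / 2) (rho / 10) by rewrite cabs_real_ge0// ltW.
  have tn0 : t != 0 by rewrite -cabs_gt0 ct.
  have := inner t tn0; rewrite ct ge_min lexx orbT => /(_ isT) h1.
  have := hd t; rewrite ct gt_min => h2.
  have {}h2 : cabs (slope f t - slope f 0) <= e by apply: h2; apply/orP; left; lra.
  by have := cabs_sub_ge (slope f 0) (slope f t); rewrite (cabsBC (slope f 0)); lra.
have [z10|z10] := leP (cabs z) (rho / 10); first exact: inner.
rewrite /slope (negPf z0) cabs_div ler_pdivrMr ?cabs_gt0//.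
apply: le_trans (_ : 20 / rho * M * (rho / 10) <= _); last first.
  by rewrite ler_wpM2l ?(ltW z10)// mulr_ge0.
have -> : 20 / rho * M * (rho / 10) = 2 * M by field; rewrite gt_eqF.
have f0M : cabs (f 0) <= M by apply: fM; rewrite cabs0.
by have := cabsB (f z) (f 0); have := fM z zr; lra.
Qed.

(** Removable singularity. At [0] it suffices that the difference quotients of the slope are
    Lipschitz, which is a bound on a third divided difference of [f] with [0] as a double node. The
    double node is obtained by moving a third node [x] to [0]. *)
Lemma slope_hol rho M f : 0 < rho -> 0 <= M -> hol rho f ->
  (forall z, cabs z < rho -> cabs (f z) <= M) -> hol rho (slope f).
Proof.
move=> r0 M0 hf fM z zr.
have r20 : 0 <= 20 / rho by rewrite divr_ge0// ltW.
have [->|z0] := eqVneq z 0; last first.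
  apply: (@cdiff_local _ (dq f 0) _ _ (cabs z)); first by rewrite cabs_gt0.
    move=> t tz; rewrite slope_dq//; apply/eqP => h.
    have tE : t = - z by apply/eqP; rewrite -subr_eq0 opprK addrC h.
    by move: tz; rewrite tE cabsN ltxx.
  by apply: cdiff_dq => //; exact: hf.
have df0 : cdiff f 0 by apply: hf; rewrite cabs0.
have o10 : cabs (0 : C) <= rho / 10 by rewrite cabs0; lra.
have t1 := tame_dq r0 M0 (tame_hol hf fM) o10 isT.
pose M1 := 20 / rho * M; have M10 : 0 <= M1 by rewrite mulr_ge0.
pose M2 := 20 / rho * M1; have M20 : 0 <= M2 by rewrite mulr_ge0.
pose K := 20 / rho * M2; have K0 : 0 <= K by rewrite mulr_ge0.
(* The third divided difference with nodes [0], [x], [c], [b], cleared of denominators. *)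
have third b c x : b != 0 -> c != 0 -> x != 0 -> x != b -> x != c -> b != c ->
    cabs b <= rho / 10 -> cabs c <= rho / 10 -> cabs x <= rho / 10 ->
    cabs ((slope f b - slope f x) * (c - x) - (slope f c - slope f x) * (b - x))
    <= K * cabs (b - c) * (cabs (b - x) * cabs (c - x)).
  move=> b0 c0 x0 xb xc bc br cr xr.
  have t2 := tame_dq r0 M10 t1 xr; rewrite inE x0 in t2; have {}t2 := t2 isT.
  have t3 := tame_dq r0 M20 t2 cr; rewrite !inE negb_or c0 eq_sym xc in t3.
  have {}t3 := t3 isT.
  have := tame_max r0 K0 t3 br; rewrite !inE !negb_or bc b0 (eq_sym b) xb => /(_ isT).
  rewrite {1}/dq cabs_div ler_pdivrMr ?cabs_gt0 ?subr_eq0// {1 3}/dq -!slope_dq//.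
  have bx : b - x != 0 by rewrite subr_eq0 eq_sym.
  have cx : c - x != 0 by rewrite subr_eq0 eq_sym.
  move=> h.
  have -> : (slope f b - slope f x) * (c - x) - (slope f c - slope f x) * (b - x) =
    ((slope f b - slope f x) / (b - x) - (slope f c - slope f x) / (c - x))
    * ((b - x) * (c - x)) by field; rewrite bx cx.
  by rewrite !cabsM ler_wpM2r// mulr_ge0 ?cabs_ge0.
have r10 : 0 < rho / 10 by lra.
apply: (lip_dq_cdiff r10 K0) => b c b0 c0; rewrite !subr0 => br cr.
have [->|bc] := eqVneq b c; first by rewrite !subrr cabs0 mulr0.
have bp : 0 < cabs b by rewrite cabs_gt0.
have cp : 0 < cabs c by rewrite cabs_gt0.
have -> : dq (slope f) 0 b - dq (slope f) 0 c =
  ((slope f b - slope f 0) * c - (slope f c - slope f 0) * b) / (b * c).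
  by rewrite /dq !subr0; field; rewrite b0 c0.
rewrite cabs_div ler_pdivrMr; last by rewrite cabsM mulr_gt0.
rewrite cabsM; set D := cabs (b - c); have D0 : 0 <= D := cabs_ge0 _.
apply/ler_addgt0Pr => e e0.
pose Q := K * D * (cabs b + cabs c + 1) + cabs (slope f b - slope f c) + 1.
have Q0 : 0 < Q.
  have := mulr_ge0 (mulr_ge0 K0 D0) (addr_ge0 (addr_ge0 (ltW bp) (ltW cp)) ler01).
  by have := cabs_ge0 (slope f b - slope f c); rewrite /Q; lra.
have D1 : 0 < 2 * (D + 1) by lra.
have [d [d0 hd]] := slope_cont0 df0 (divr_gt0 e0 D1).
(* The node [x = xi] is distinct from [0], [b], [c], and so close to [0] that replacing it by [0]
   costs at most [e]: one half from the continuity of the slope, one half from [xi * Q]. *)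
pose xi := Num.min (Num.min (d / 2) (Num.min (1 : R) (e / (2 * Q))))
                   (Num.min (rho / 10) (Num.min (cabs b / 2) (cabs c / 2))).
have xi0 : 0 < xi by rewrite !lt_min ltr01 r10 !divr_gt0 ?mulr_gt0.
have : xi <= xi by [].
rewrite {2}/xi !le_min => /andP[/andP[xd /andP[x1 xe]] /andP[xr /andP[xb xc]]].
pose x : C := xi%:C; have cx : cabs x = xi by rewrite cabs_real_ge0// ltW.
have xn0 : x != 0 by rewrite -cabs_gt0 cx.
have xnb : x != b by apply/eqP => h; move: cx; rewrite h; lra.
have xnc : x != c by apply/eqP => h; move: cx; rewrite h; lra.
have := third b c x b0 c0 xn0 xnb xnc bc (ltW br) (ltW cr); rewrite cx => /(_ xr) hT; rewrite -/D in hT.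
have [hx1 hx2] : cabs (b - x) <= cabs b + xi /\ cabs (c - x) <= cabs c + xi.
  by rewrite -cx; split; exact: cabsB.
have := hd x; rewrite cx => /(_ ltac:(lra)) hs.
have -> : (slope f b - slope f 0) * c - (slope f c - slope f 0) * b =
  ((slope f b - slope f x) * (c - x) - (slope f c - slope f x) * (b - x))
  + ((slope f x - slope f 0) * (c - b) + x * (slope f b - slope f c)) by ring.
apply: le_trans (cabsD _ _) _.
have hP := ler_wpM2l (mulr_ge0 K0 D0) (ler_pM (cabs_ge0 _) (cabs_ge0 _) hx1 hx2).
have h1 : K * D * ((cabs b + xi) * (cabs c + xi)) <=
    K * D * (cabs b * cabs c) + xi * (K * D * (cabs b + cabs c + 1)).
  rewrite -subr_ge0 (_ : _ - _ = K * D * xi * (1 - xi)); last by ring.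
  by rewrite mulr_ge0 ?subr_ge0// mulr_ge0 ?(ltW xi0)// mulr_ge0.
have h2 : cabs ((slope f x - slope f 0) * (c - b) + x * (slope f b - slope f c)) <=
    e / (2 * (D + 1)) * D + xi * cabs (slope f b - slope f c).
  apply: le_trans (cabsD _ _) _; rewrite !cabsM cx lerD2r (cabsBC c) -/D.
  by rewrite ler_wpM2r.
have h3 : e / (2 * (D + 1)) * D <= e / 2.
  have -> : e / (2 * (D + 1)) * D = e * D / (2 * (D + 1)) by rewrite mulrAC.
  by rewrite ler_pdivrMr//; nra.
have h4 : xi * Q <= e / 2 by move: xe; rewrite ler_pdivlMr ?mulr_gt0//; lra.
have h5 : xi * Q = xi * (K * D * (cabs b + cabs c + 1)) +
  xi * cabs (slope f b - slope f c) + xi by rewrite /Q; ring.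
by lra.
Qed.

End Tame.

(** * Separately holomorphic functions *)

Section SeparatelyHolomorphic.
Variable R : realType.
Local Notation C := R[i].
Local Open Scope complex_scope.

Lemma common_lower_bound (I : finType) (r : I -> R) : (forall i, 0 < r i) ->
  exists e : R, 0 < e /\ forall i, e <= r i.
Proof.
move=> r0; have [N hN] := choose_threshold (fun i => exprn_half_small (r0 i)).
by exists (2^-1 ^+ N); split=> [|i]; [rewrite exprn_gt0 ?invr_gt0|rewrite ltW ?hN].
Qed.

Lemma hol_ext rho (f g : C -> C) : (forall z, cabs z < rho -> f z = g z) ->
  hol rho f -> hol rho g.
Proof.
move=> fg hf z zr; apply: (cdiff_local (d := rho - cabs z)) (hf z zr).
  by rewrite subr_gt0.
by move=> t tr; apply: fg; have := cabsD z t; lra.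
Qed.

Lemma quadratic_cdiff (f : C -> C) (K d : R) : 0 < d -> 0 <= K ->
  (forall t, cabs t < d -> cabs (f t) <= K * cabs t ^+ 2) -> cdiff f 0.
Proof.
move=> d0 K0 h; exists 0 => e e0; have K1 : 0 < K + 1 by lra.
exists (Num.min d (e / (K + 1))); split=> [|t]; first by rewrite lt_min d0 divr_gt0.
rewrite lt_min ltr_pdivlMr// => /andP[/h td te].
have -> : f 0 = 0.
  by apply/eqP; rewrite -cabs_eq0 eq_le cabs_ge0 andbT; have := h 0; rewrite cabs0 expr0n mulr0; apply.
rewrite add0r subr0 mul0r subr0; apply: le_trans td _.
by rewrite expr2; have := cabs_ge0 t; nra.
Qed.

(* The mixed second difference of [phi] is [O(|s|^2)] on the diagonal. *)
Lemma cdiff_diag (phi : C -> C -> C) (eps M : R) : 0 < eps -> 0 <= M ->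
  (forall s s', cabs s < eps -> cabs s' < eps -> cabs (phi s s') <= M) ->
  (forall s', cabs s' < eps -> hol eps (phi^~ s')) ->
  (forall s, cabs s < eps -> hol eps (phi s)) ->
  cdiff (fun s => phi s s) 0.
Proof.
move=> e0 M0 phiM h1 h2.
have o0 : cabs (0 : C) < eps by rewrite cabs0.
pose r s := phi s s - phi s 0 - phi 0 s + phi 0 0.
have -> : (fun s => phi s s) = (fun s => r s + (phi s 0 + phi 0 s - phi 0 0)).
  by apply/funext => s; rewrite /r; ring.
apply: cdiffD; last first.
  apply: cdiffB; last exact: cdiff_cst.
  by apply: cdiffD; [exact: (h1 0)|exact: (h2 0)].
have E20 : 0 <= 20 / eps by rewrite divr_ge0// ltW.
pose K := 20 / eps * (20 / eps * M).
apply: (@quadratic_cdiff _ K eps) => //; first by rewrite mulr_ge0// mulr_ge0.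
move=> s se.
have b1 s' : cabs s' < eps -> cabs (phi s s' - phi 0 s') <= cabs s * (20 / eps * M).
  move=> s'e; rewrite (slopeE (phi^~ s')) addrAC subrr add0r cabsM ler_wpM2l ?cabs_ge0//.
  apply: slope_bound => //; first exact: h1.
  by move=> z ze; exact: phiM.
have -> : r s = (phi s s - phi 0 s) - (phi s 0 - phi 0 0) by rewrite /r; ring.
pose psi s' := phi s s' - phi 0 s'.
rewrite -/(psi s) -/(psi 0) (slopeE psi) addrAC subrr add0r cabsM.
have hb : cabs (slope psi s) <= 20 / eps * (cabs s * (20 / eps * M)).
  apply: slope_bound => //; first by rewrite mulr_ge0 ?cabs_ge0// mulr_ge0.
  by move=> z ze; apply: cdiffB; apply: h2.
apply: le_trans (ler_wpM2l (cabs_ge0 s) hb) _.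
by rewrite /K expr2 le_eqVlt; apply/orP; left; apply/eqP; ring.
Qed.

Variable m : nat.
Implicit Types (x y a v : cvec R m) (i p : 'I_m) (s t : C) (rad : 'I_m -> R)
  (F G : cvec R m -> C) (M : R).

Definition upd x i s : cvec R m := fun k => if k == i then s else x k.

Lemma upd_same x i s : upd x i s i = s. Proof. by rewrite /upd eqxx. Qed.

Lemma upd_neq x i s k : k != i -> upd x i s k = x k.
Proof. by rewrite /upd => /negPf ->. Qed.

Lemma upd_id x i : upd x i (x i) = x.
Proof. by apply/funext => k; rewrite /upd; case: eqP => [->|]. Qed.

Lemma updK x i s t : upd (upd x i s) i t = upd x i t.
Proof. by apply/funext => k; rewrite /upd; case: eqP. Qed.

Lemma updC x i k s t : i != k -> upd (upd x i s) k t = upd (upd x k t) i s.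
Proof.
move=> ik; apply/funext => j; rewrite /upd.
by case: (eqVneq j k) => [->|//]; rewrite eq_sym (negPf ik).
Qed.

Definition polydisc rad x : Prop := forall i, cabs (x i) < rad i.

Lemma polydisc_upd rad x i s : polydisc rad x -> cabs s < rad i ->
  polydisc rad (upd x i s).
Proof. by move=> px si k; rewrite /upd; case: eqP => [->|]. Qed.

Lemma polydisc_gt0 rad x : polydisc rad x -> forall i, 0 < rad i.
Proof. by move=> px i; exact: le_lt_trans (cabs_ge0 _) (px i). Qed.

(* No continuity is required: by the Cauchy estimates bounded separately
   holomorphic functions are Lipschitz (Osgood). *)
Definition shol rad F : Prop :=
  (exists M, forall x, polydisc rad x -> cabs (F x) <= M) /\
  forall x i, polydisc rad x -> hol (rad i) (fun s => F (upd x i s)).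

Lemma shol_bound rad F : shol rad F ->
  exists M, 0 <= M /\ forall x, polydisc rad x -> cabs (F x) <= M.
Proof.
move=> [[M hM] _]; exists `|M|; split=> // x /hM; move/le_trans; apply.
exact: ler_norm.
Qed.

Lemma shol_ext rad F G : (forall x, polydisc rad x -> F x = G x) ->
  shol rad F -> shol rad G.
Proof.
move=> FG [[M hM] hF]; split; first by exists M => x px; rewrite -FG ?hM.
move=> x i px; apply: hol_ext (hF x i px) => z zr.
by rewrite FG//; exact: polydisc_upd.
Qed.

Lemma shol_sub rad rad' F : (forall i, rad' i <= rad i) -> shol rad F -> shol rad' F.
Proof.
move=> rr [[M hM] hF].
have pp x : polydisc rad' x -> polydisc rad x by move=> px i; exact: lt_le_trans (px i) _.
split; first by exists M => x /pp/hM.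
by move=> x i /pp px z zr; apply: hF => //; exact: lt_le_trans zr _.
Qed.

Lemma shol_cst rad s : shol rad (fun=> s).
Proof. by split; [exists (cabs s)|move=> x i _ z _; exact: cdiff_cst]. Qed.

Lemma shol_coord rad p : shol rad (fun x => x p).
Proof.
split; first by exists (rad p) => x /(_ p)/ltW.
move=> x i _ z _; rewrite /upd; case: eqP => _; first exact: cdiff_id.
exact: cdiff_cst.
Qed.

Lemma sholD rad F G : shol rad F -> shol rad G -> shol rad (fun x => F x + G x).
Proof.
move=> [[M hM] hF] [[N hN] hG]; split.
  exists (M + N) => x px; apply: le_trans (cabsD _ _) _.
  by rewrite lerD ?hM ?hN.
by move=> x i px z zr; apply: cdiffD; [exact: hF|exact: hG].
Qed.

Lemma sholM rad F G : shol rad F -> shol rad G -> shol rad (fun x => F x * G x).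
Proof.
move=> [[M hM] hF] [[N hN] hG]; split.
  by exists (M * N) => x px; rewrite cabsM ler_pM ?cabs_ge0 ?hM ?hN.
by move=> x i px z zr; apply: cdiffM; [exact: hF|exact: hG].
Qed.

Lemma sholZ rad s F : shol rad F -> shol rad (fun x => s * F x).
Proof. exact: sholM (shol_cst _ _). Qed.

Lemma sholN rad F : shol rad F -> shol rad (fun x => - F x).
Proof.
move=> /(sholZ (-1)); apply: shol_ext => x _; exact: mulN1r.
Qed.

Lemma sholX rad F n : shol rad F -> shol rad (fun x => F x ^+ n).
Proof.
move=> hF; elim: n => [|n IH]; first exact: shol_cst.
by apply: shol_ext (sholM hF IH) => x _; rewrite exprS.
Qed.

Lemma shol_sum rad (I : Type) (r : seq I) (P : pred I) (F : I -> cvec R m -> C) :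
  (forall k, shol rad (F k)) -> shol rad (fun x => \sum_(k <- r | P k) F k x).
Proof.
move=> hF; elim: r => [|k r IH].
  by apply: shol_ext (shol_cst _ 0) => x _; rewrite big_nil.
case Pk : (P k).
  by apply: shol_ext (sholD (hF k) IH) => x _; rewrite big_cons Pk.
by apply: shol_ext IH => x _; rewrite big_cons Pk.
Qed.

Lemma shol_prod rad (I : Type) (r : seq I) (P : pred I) (F : I -> cvec R m -> C) :
  (forall k, shol rad (F k)) -> shol rad (fun x => \prod_(k <- r | P k) F k x).
Proof.
move=> hF; elim: r => [|k r IH].
  by apply: shol_ext (shol_cst _ 1) => x _; rewrite big_nil.
case Pk : (P k).
  by apply: shol_ext (sholM (hF k) IH) => x _; rewrite big_cons Pk.
by apply: shol_ext IH => x _; rewrite big_cons Pk.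
Qed.

Lemma sholV rad F (eta : R) : 0 < eta -> (forall x, polydisc rad x -> eta <= cabs (F x)) ->
  shol rad F -> shol rad (fun x => (F x)^-1).
Proof.
move=> e0 eF [_ hF]; split.
  exists eta^-1 => x px; rewrite cabsV lef_pV2 ?posrE// ?eF//.
  exact: lt_le_trans (eF x px).
move=> x i px z zr; apply: cdiffV; last exact: hF.
by rewrite -cabs_gt0; apply: lt_le_trans e0 (eF _ _); exact: polydisc_upd.
Qed.

Lemma shol_limit rad (F : nat -> cvec R m -> C) G M : 0 <= M ->
  (forall k, shol rad (F k)) ->
  (forall k x, polydisc rad x -> cabs (F k x) <= M) ->
  (forall x, polydisc rad x -> forall e : R, 0 < e ->
     exists N, forall k, (N <= k)%N -> cabs (F k x - G x) < e) -> shol rad G.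
Proof.
move=> M0 hF FM lim; split.
  exists M => x px; apply/ler_addgt0Pr => e /(lim x px)[N /(_ N (leqnn _)) hN].
  by have := FM N x px; have := cabs_sub_ge (G x) (F N x); rewrite (cabsBC (G x)); lra.
move=> x i px; apply: (@hol_limit R (rad i) M (fun k s => F k (upd x i s))) => //.
- by move=> k; apply: (hF k).2.
- by move=> k z zr; apply: FM; exact: polydisc_upd.
- by move=> z zr; apply: lim; exact: polydisc_upd.
Qed.

Lemma shol_upd rad F p : (forall i, 0 < rad i) -> shol rad F ->
  shol rad (fun x => F (upd x p 0)).
Proof.
move=> r0 [[M hM] hF].
have p0 x : polydisc rad x -> polydisc rad (upd x p 0).
  by move=> px; apply: polydisc_upd => //; rewrite cabs0.
split; first by exists M => x /p0/hM.
move=> x i px; have [->|ip] := eqVneq i p.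
  by apply: hol_ext (_ : hol _ (fun=> F (upd x p 0))) => z _; rewrite ?updK//; exact: cdiff_cst.
by apply: hol_ext (hF _ i (p0 x px)) => z _; rewrite updC 1?eq_sym.
Qed.

Definition slope_at p F x : C := slope (fun s => F (upd x p s)) (x p).

Lemma slope_atE p F x : F x = F (upd x p 0) + x p * slope_at p F x.
Proof. by rewrite -(slopeE (fun s => F (upd x p s))) upd_id. Qed.

Lemma slope_at_bound rad p F M : 0 <= M -> shol rad F ->
  (forall x, polydisc rad x -> cabs (F x) <= M) ->
  forall x, polydisc rad x -> cabs (slope_at p F x) <= 20 / rad p * M.
Proof.
move=> M0 [_ hF] FM x px; apply: slope_bound => //.
- exact: polydisc_gt0 px p.
- exact: hF.
- by move=> z zr; apply: FM; exact: polydisc_upd.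
Qed.

(** In the variable [p] this is [slope_hol]. In another variable the slope is an honest quotient
    while [x p != 0]; at [x p = 0] it is a partial derivative, the bounded limit of the quotients at
    [tk k], and [hol_limit] applies. *)
Lemma shol_slope_at rad p F : shol rad F -> shol rad (slope_at p F).
Proof.
move=> sF; have [M [M0 FM]] := shol_bound sF; have [_ hF] := sF.
have SM := @slope_at_bound rad p F M M0 sF FM.
split; first by exists (20 / rad p * M).
move=> x i px; have r0 := polydisc_gt0 px.
have [->|ip] := eqVneq i p.
  apply: hol_ext (_ : hol _ (slope (fun s => F (upd x p s)))) => [z _|].
    rewrite /slope_at upd_same; congr slope.
    by apply/funext => s; rewrite updK.
  by apply: (slope_hol (M := M)) => //; [exact: hF|move=> z zr; apply: FM; exact: polydisc_upd].
have pi : p != i by rewrite eq_sym.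
have off0 y : polydisc rad y -> y p != 0 -> hol (rad i) (fun s => slope_at p F (upd y i s)).
  move=> py yp0.
  have -> : (fun s => slope_at p F (upd y i s)) =
      (fun s => (F (upd y i s) - F (upd (upd y p 0) i s)) * (y p)^-1).
    apply/funext => s; rewrite /slope_at upd_neq// /slope (negPf yp0).
    have E : upd (upd y i s) p (y p) = upd y i s by rewrite -{1}(upd_neq y s pi) upd_id.
    by rewrite E (updC _ _ _ ip).
  move=> z zr; apply: cdiffM (cdiff_cst _ _); apply: cdiffB; apply: hF => //.
  by apply: polydisc_upd => //; rewrite cabs0.
have [xp0|xp0] := eqVneq (x p) 0; last exact: off0.
pose tk k : C := (rad p / 2 * 2^-1 ^+ k)%:C.
have tk0 k : 0 < rad p / 2 * 2^-1 ^+ k.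
  by rewrite mulr_gt0 ?exprn_gt0 ?invr_gt0 ?divr_gt0.
have ctk k : cabs (tk k) = rad p / 2 * 2^-1 ^+ k by rewrite cabs_real_ge0// ltW.
have tkr k : cabs (tk k) < rad p.
  have : (2^-1 : R) ^+ k <= 1 by rewrite exprn_ile1 ?invr_ge0//; lra.
  by rewrite ctk; have := r0 p; nra.
pose Fk k s := slope_at p F (upd (upd x p (tk k)) i s).
apply: (@hol_limit R (rad i) (20 / rad p * M) Fk).
- by rewrite mulr_ge0// divr_ge0// ltW.
- move=> k; apply: off0; first exact: polydisc_upd.
  by rewrite upd_same -cabs_gt0 ctk.
- by move=> k z zr; apply: SM; do 2!apply: polydisc_upd => //.
move=> z zr e e0; have e2 : 0 < e / 2 by lra.
pose g s := F (upd (upd x i z) p s).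
have dg : cdiff g 0 by apply: hF; [exact: polydisc_upd|rewrite cabs0].
have [d [d0 hd]] := slope_cont0 dg e2.
have [N hN] := exprn_half_small (divr_gt0 d0 (divr_gt0 (r0 p) (ltr0n _ 2))).
exists N => k /hN; rewrite ltr_pdivlMr ?divr_gt0// mulrC -ctk => /hd h.
have -> : Fk k z = slope g (tk k).
  rewrite /Fk /slope_at upd_neq// upd_same; congr slope.
  by apply/funext => s; rewrite (updC _ _ _ pi) updK.
have -> : slope_at p F (upd x i z) = slope g 0 by rewrite /slope_at upd_neq// xp0.
by lra.
Qed.

(** The remainder of order [l] in the variable [x p], divided by [x p ^+ l]; its value at [x p = 0]
    is the Taylor coefficient of degree [l]. *)
Definition taylor p l F : cvec R m -> C := iter l (slope_at p) F.

Lemma shol_taylor rad p l F : shol rad F -> shol rad (taylor p l F).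
Proof. by move=> hF; elim: l => [//|l IH]; exact: shol_slope_at. Qed.

Lemma taylor_bound rad p l F M : 0 <= M -> shol rad F ->
  (forall x, polydisc rad x -> cabs (F x) <= M) ->
  forall x, polydisc rad x -> cabs (taylor p l F x) <= (20 / rad p) ^+ l * M.
Proof.
move=> M0 sF FM x px; have r0 := polydisc_gt0 px.
have r20 : 0 <= 20 / rad p by rewrite divr_ge0// ltW.
elim: l x px => [|l IH] x px; first by rewrite expr0 mul1r FM.
rewrite exprS -mulrA; apply: slope_at_bound => //.
- by rewrite mulr_ge0// exprn_ge0.
- exact: shol_taylor.
Qed.

Lemma taylorE p d F x : F x =
  \sum_(l < d) x p ^+ l * taylor p l F (upd x p 0) + x p ^+ d * taylor p d F x.
Proof.
elim: d => [|d IH]; first by rewrite big_ord0 expr0 mul1r add0r.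
rewrite {1}IH big_ord_recr /= -addrA; congr (_ + _).
by rewrite {1}(slope_atE p) exprSr /=; ring.
Qed.

(** The coordinates are set to [0] one after the other, each at a cost of at most [K * d] by the
    bound on slopes. *)
Lemma shol_cont0 rad F : (forall i, 0 < rad i) -> shol rad F ->
  forall e : R, 0 < e -> exists d : R, 0 < d /\
    forall x, polydisc rad x -> (forall i, cabs (x i) < d) -> cabs (F x - F (vzero m)) < e.
Proof.
move=> r0 sF e e0; have [M [M0 FM]] := shol_bound sF.
have [r [r_gt0 hr]] := common_lower_bound r0.
pose K := 20 / r * M; have K0 : 0 <= K by rewrite mulr_ge0// divr_ge0// ltW.
have KS p x : polydisc rad x -> cabs (slope_at p F x) <= K.
  move=> px; apply: le_trans (slope_at_bound p M0 sF FM px) _.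
  by rewrite ler_wpM2r// ler_wpM2l// lef_pV2 ?posrE.
have P0 : 0 < m%:R * K + 1 by have := mulr_ge0 (ler0n R m) K0; lra.
exists (e / (m%:R * K + 1)); split=> [|x px xd]; first exact: divr_gt0.
set d := e / _ in xd.
have d0 : 0 < d by exact: divr_gt0.
pose Z (k : nat) : cvec R m := fun i => if (i < k)%N then 0 else x i.
have pZ k : polydisc rad (Z k) by move=> i; rewrite /Z; case: ifP => _; rewrite ?cabs0.
have step k : (k <= m)%N -> cabs (F x - F (Z k)) <= k%:R * (K * d).
  elim: k => [_|k IH km].
    have -> : Z 0%N = x by apply/funext => i; rewrite /Z ltn0.
    by rewrite subrr cabs0 mul0r.
  have {}IH := IH (ltnW km); pose p := Ordinal km.
  have ZS : Z k.+1 = upd (Z k) p 0.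
    apply/funext => i; rewrite /Z /upd ltnS leq_eqVlt -val_eqE /=.
    by case: eqP.
  apply: le_trans (cabs_triB _ (F (Z k)) _) _.
  rewrite -natr1 mulrDl mul1r lerD// ZS (slope_atE p F (Z k)) addrAC subrr add0r.
  rewrite cabsM mulrC ler_pM ?cabs_ge0 ?KS// /Z ltnn; exact: ltW.
have := step m (leqnn _).
have -> : Z m = vzero m by apply/funext => i; rewrite /Z ltn_ord.
move/le_lt_trans; apply; have : d * (m%:R * K + 1) = e by rewrite divfK ?gt_eqF.
by lra.
Qed.

(** Makes linear and quadratic substitutions available for [shol]. The number [k] of coordinates
    that move with [t] grows by one at a time, and [cdiff_diag] merges the new coordinate with the
    earlier ones. *)
Lemma shol_line rad F a v s : shol rad F ->
  polydisc rad (fun i => a i + s * v i) -> cdiff (fun t => F (fun i => a i + t * v i)) s.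
Proof.
move=> sF pa; have [M [M0 FM]] := shol_bound sF; have [_ hF] := sF.
pose part k b t : cvec R m := fun i => if (i < k)%N then b i + t * v i else b i.
suff key k b : (k <= m)%N -> polydisc rad b -> cdiff (fun t => F (part k b t)) 0.
  have := key m _ (leqnn m) pa; set g := fun t => _ => dg.
  have -> : (fun t => F (fun i => a i + t * v i)) = (fun t => g (- s + t * 1)).
    apply/funext => t; rewrite /g; congr F; apply/funext => i.
    by rewrite /part ltn_ord; ring.
  by apply: cdiff_affine; rewrite mulr1 addrC subrr.
elim: k b => [|k IH] b km pb.
  by have -> : part 0%N b = fun=> b; [apply/funext => t; apply/funext => i|exact: cdiff_cst].
pose p := Ordinal km.
have [eps [eps0 heps]] : exists e : R, 0 < e /\ forall i, cabs (b i) + e * cabs (v i) < rad i.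
  have q0 i : 0 < (rad i - cabs (b i)) / (cabs (v i) + 1).
    by rewrite divr_gt0 ?subr_gt0// ltr_wpDl ?cabs_ge0.
  have [e [e0 he]] := common_lower_bound q0; exists e; split=> // i.
  have := he i; rewrite ler_pdivlMr ?ltr_wpDl ?cabs_ge0//; lra.
pose B t t' := upd (part k b t) p (b p + t' * v p).
have inB t t' : cabs t < eps -> cabs t' < eps -> polydisc rad (B t t').
  move=> te t'e i; rewrite /B /upd /part.
  have h (u : C) j : cabs u < eps -> cabs (b j + u * v j) < rad j.
    move=> ue; apply: le_lt_trans (cabsD _ _) _; rewrite cabsM.
    by apply: le_lt_trans (heps j); rewrite lerD2l ler_wpM2r ?cabs_ge0// ltW.
  by case: eqP => [->|_]; [exact: h|case: ifP => _; [exact: h|exact: pb]].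
have -> : (fun t => F (part k.+1 b t)) = (fun t => F (B t t)).
  apply/funext => t; congr F; apply/funext => i; rewrite /B /upd /part ltnS leq_eqVlt.
  by rewrite -val_eqE /=; case: eqP => [E|//]; rewrite (_ : i = p)//; exact: val_inj.
apply: (cdiff_diag (phi := fun t t' => F (B t t')) (M := M) eps0 M0).
- by move=> t t' te t'e; apply: FM; exact: inB.
- move=> t' t'e t te.
  have := IH (B t t') (ltnW km) (inB _ _ te t'e); set g := fun t => _ => dg.
  have -> : (fun u => F (B u t')) = (fun u => g (- t + u * 1)).
    apply/funext => u; rewrite /g; congr F; apply/funext => i; rewrite /B /upd /part.
    case: (ltnP i k) => ik; last by [].
    by rewrite -val_eqE /= ltn_eqF//; ring.
  by apply: cdiff_affine; rewrite mulr1 addrC subrr.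
- move=> t te t' t'e.
  have h := hF (B t t') p (inB _ _ te t'e) (b p + t' * v p).
  have -> : (fun u => F (B t u)) = (fun u => F (upd (B t t') p (b p + u * v p))).
    by apply/funext => u; rewrite /B updK.
  apply: (cdiff_affine (f := fun w => F (upd (B t t') p w))); apply: h.
  by have := inB _ _ te t'e p; rewrite /B upd_same.
Qed.

End SeparatelyHolomorphic.

(** * Weierstrass division *)

Section Weierstrass.
Variable R : realType.
Local Notation C := R[i].
Local Open Scope complex_scope.

Lemma geometric_eq0 (z : C) (K : R) :
  (forall k, cabs z <= K * 2^-1 ^+ k) -> z = 0.
Proof.
move=> h; apply/eqP; rewrite -cabs_eq0 eq_le cabs_ge0 andbT.
apply/ler_addgt0Pr => e e0; rewrite add0r.
have K0 : 0 <= K by have := h 0%N; rewrite expr0 mulr1; apply: le_trans; exact: cabs_ge0.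
have K1 : 0 < K + 1 by lra.
have [k /(_ k (leqnn _))] := exprn_half_small (divr_gt0 e0 K1).
rewrite ltr_pdivlMr// => hk; apply: le_trans (h k) _.
have : 0 <= (2^-1 : R) ^+ k by rewrite exprn_ge0 ?invr_ge0.
by lra.
Qed.

Variable m : nat.
Implicit Types (x y : cvec R m) (p : 'I_m) (rad : 'I_m -> R) (f h : cvec R m -> C).

Lemma sum_limit rad (g : nat -> cvec R m -> C) (B : R) : 0 <= B ->
  (forall k, shol rad (g k)) ->
  (forall k x, polydisc rad x -> cabs (g k x) <= B * 2^-1 ^+ k) ->
  exists G, [/\ shol rad G, forall x, polydisc rad x -> cabs (G x) <= 4 * B &
    forall K x, polydisc rad x ->
      cabs (\sum_(k < K) g k x - G x) <= 4 * B * 2^-1 ^+ K].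
Proof.
move=> B0 sg gB.
have /choice[G hG] : forall x, exists l : C, polydisc rad x ->
    forall K, cabs (\sum_(k < K) g k x - l) <= 4 * B * 2^-1 ^+ K.
  move=> x; have [px|px] := pselect (polydisc rad x); last by exists 0 => /px.
  have [K|l hl] := @cgeometric_limit R (fun K => \sum_(k < K) g k x) B; last by exists l.
  by rewrite big_ord_recr /= addrAC subrr add0r gB.
have GB x : polydisc rad x -> cabs (G x) <= 4 * B.
  by move=> /hG/(_ 0%N); rewrite big_ord0 sub0r cabsN expr0 mulr1.
exists G; split=> //; last by move=> K x /hG.
apply: (@shol_limit _ _ rad (fun K x => \sum_(k < K) g k x) G (8 * B)).
- by rewrite mulr_ge0.
- by move=> K; apply: shol_sum => k; exact: sg.
- move=> K x px; have h1 := hG x px K; have h2 := GB x px.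
  have : (2^-1 : R) ^+ K <= 1 by rewrite exprn_ile1 ?invr_ge0//; lra.
  move=> h3; have h4 := ler_wpM2l B0 h3.
  by have := cabs_sub_ge (\sum_(k < K) g k x) (G x); lra.
move=> x px e e0; have B1 : 0 < 4 * B + 1 by lra.
have [N hN] := exprn_half_small (divr_gt0 e0 B1).
exists N => K /hN; rewrite ltr_pdivlMr// => hK; apply: le_lt_trans (hG x px K) _.
have : 0 <= (2^-1 : R) ^+ K by rewrite exprn_ge0 ?invr_ge0.
by lra.
Qed.

(* Splitting off the Taylor polynomial of [f] in the variable [x p] leaves the
   remainder [- h * taylor p d f], smaller than [f]; iterate. *)
Lemma weierstrass_division p rad d h (kappa : R) :
  (forall i, 0 < rad i) -> shol rad h -> 0 <= kappa ->
  (forall x, polydisc rad x -> cabs (h x) <= kappa) ->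
  kappa * (20 / rad p) ^+ d <= 8^-1 ->
  forall f (M : R), 0 <= M -> shol rad f ->
  (forall x, polydisc rad x -> cabs (f x) <= M) ->
  exists q (r : 'I_d -> cvec R m -> C), 
  [/\ shol rad q /\ (forall l, shol rad (r l)),
      forall l x s, r l (upd x p s) = r l x,
      forall x, polydisc rad x ->
        f x = q x * (x p ^+ d + h x) + \sum_(l < d) r l x * x p ^+ l,
      forall x, polydisc rad x -> cabs (q x) <= 4 * ((20 / rad p) ^+ d * M) &
      forall l x, polydisc rad x -> cabs (r l x) <= 4 * ((20 / rad p) ^+ l * M)].
Proof.
move=> r0 sh k0 hk small f M M0 sf fM.
have r20 l : 0 <= (20 / rad p) ^+ l by rewrite exprn_ge0// divr_ge0// ltW.
pose fs k := iter k (fun g x => - (h x * taylor p d g x)) f.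
have sfs k : shol rad (fs k).
  by elim: k => [//|k IH]; apply/sholN/sholM => //; exact: shol_taylor.
have M2 k : 0 <= M * 2^-1 ^+ k by rewrite mulr_ge0// exprn_ge0 ?invr_ge0.
have fsM k x : polydisc rad x -> cabs (fs k x) <= M * 2^-1 ^+ k.
  elim: k x => [|k IH] x px; first by rewrite expr0 mulr1 fM.
  rewrite /= -/(fs k) cabsN cabsM.
  have b := taylor_bound p d (M2 k) (sfs k) IH px.
  apply: le_trans (ler_pM (cabs_ge0 _) (cabs_ge0 _) (hk x px) b) _.
  rewrite mulrA; apply: le_trans (ler_wpM2r (M2 k) small) _.
  by rewrite exprS; have := M2 k; lra.
have tB l k x : polydisc rad x ->
    cabs (taylor p l (fs k) x) <= (20 / rad p) ^+ l * M * 2^-1 ^+ k.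
  by move=> px; rewrite -mulrA; exact: taylor_bound (M2 k) (sfs k) (fsM k) x px.
have st l k : shol rad (taylor p l (fs k)) by exact: shol_taylor.
have [q [sq qB hq]] := sum_limit (mulr_ge0 (r20 d) M0) (st d) (tB d).
have /choice[r hr] := fun l : 'I_d => sum_limit (mulr_ge0 (r20 l) M0) (st l) (tB l).
have p0 x : polydisc rad x -> polydisc rad (upd x p 0).
  by move=> px; apply: polydisc_upd; rewrite ?cabs0.
exists q, (fun l x => r l (upd x p 0)); split=> //.
- split=> // l; apply: shol_upd => //; by have [] := hr l.
- by move=> l x s; rewrite updK.
- move=> x px; apply/eqP; rewrite -subr_eq0; apply/eqP.
  pose D := x p ^+ d + h x.
  (* The division after [K] rounds, exact up to the error [fs K x], which is at most [M / 2 ^ K]. *)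
  have part K : f x = (\sum_(k < K) taylor p d (fs k) x) * D
      + \sum_(l < d) (\sum_(k < K) taylor p l (fs k) (upd x p 0)) * x p ^+ l + fs K x.
    elim: K => [|K IH].
      by rewrite big_ord0 mul0r add0r big1 ?add0r// => l _; rewrite big_ord0 mul0r.
    have -> : \sum_(l < d) (\sum_(k < K.+1) taylor p l (fs k) (upd x p 0)) * x p ^+ l
      = \sum_(l < d) (\sum_(k < K) taylor p l (fs k) (upd x p 0)) * x p ^+ l
        + \sum_(l < d) x p ^+ l * taylor p l (fs K) (upd x p 0).
      by rewrite -big_split; apply: eq_bigr => l _; rewrite big_ord_recr mulrDl [X in _ + X]mulrC.
    by rewrite IH {1}(taylorE p d (fs K)) big_ord_recr mulrDl /= -/(fs K) /D; ring.
  pose S := \sum_(l < d) 4 * ((20 / rad p) ^+ l * M) * cabs (x p) ^+ l.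
  pose B := 4 * ((20 / rad p) ^+ d * M) * cabs D + S + M.
  apply: (@geometric_eq0 _ B) => K; rewrite {1}(part K).
  have -> : (\sum_(k < K) taylor p d (fs k) x) * D
      + \sum_(l < d) (\sum_(k < K) taylor p l (fs k) (upd x p 0)) * x p ^+ l + fs K x
      - (q x * D + \sum_(l < d) r l (upd x p 0) * x p ^+ l)
    = (\sum_(k < K) taylor p d (fs k) x - q x) * D
      + \sum_(l < d) (\sum_(k < K) taylor p l (fs k) (upd x p 0) - r l (upd x p 0)) * x p ^+ l
      + fs K x.
    have -> : \sum_(l < d) (\sum_(k < K) taylor p l (fs k) (upd x p 0) - r l (upd x p 0))
        * x p ^+ l = \sum_(l < d) (\sum_(k < K) taylor p l (fs k) (upd x p 0)) * x p ^+ l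
        - \sum_(l < d) r l (upd x p 0) * x p ^+ l.
      by rewrite -sumrB; apply: eq_bigr => l _; rewrite mulrBl.
    by ring.
  have -> : B * 2^-1 ^+ K = 4 * ((20 / rad p) ^+ d * M) * cabs D * 2^-1 ^+ K
      + S * 2^-1 ^+ K + M * 2^-1 ^+ K by rewrite /B; ring.
  apply: le_trans (cabsD _ _) _; apply: lerD; last exact: fsM.
  apply: le_trans (cabsD _ _) _; apply: lerD.
    by rewrite cabsM mulrAC ler_wpM2r ?cabs_ge0 ?hq.
  apply: le_trans (cabs_sum _ _ _) _; rewrite /S mulr_suml; apply: ler_sum => l _.
  rewrite cabsM cabsX mulrAC ler_wpM2r ?exprn_ge0 ?cabs_ge0//.
  by have [_ _] := hr l; apply; exact: p0.
- by move=> l x px; have [_ hB _] := hr l; apply/hB/p0.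
Qed.

(** Dividing [h] by [x p ^+ d + h x] with quotient [q] gives the polynomial with unit factor
    [1 - q]; the constant [8^-1] makes [cabs (q x) <= 1 / 2]. The last clause says that the leading
    term dominates at radius [rad p], which later confines all roots to the disc. *)
Lemma weierstrass_preparation p rad d h (kappa : R) :
  (forall i, 0 < rad i) -> shol rad h -> 0 <= kappa ->
  (forall x, polydisc rad x -> cabs (h x) <= kappa) ->
  kappa * (20 / rad p) ^+ d <= 8^-1 ->
  exists (u : cvec R m -> C) (r : 'I_d -> cvec R m -> C),
  [/\ forall l, shol rad (r l),
      forall l x s, r l (upd x p s) = r l x,
      forall x, polydisc rad x ->
        x p ^+ d + \sum_(l < d) r l x * x p ^+ l = u x * (x p ^+ d + h x),
      forall x, polydisc rad x -> u x != 0 &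
      forall x, polydisc rad x -> \sum_(l < d) cabs (r l x) * rad p ^+ l < rad p ^+ d].
Proof.
move=> r0 sh k0 hk small.
have [q [r [[sq sr] ri E qB rB]]] :=
  weierstrass_division r0 sh k0 hk small k0 sh hk.
exists (fun x => 1 - q x), r; split=> //.
- move=> x px; have := E x px; set S := \sum_(_ < _) _ => Ex.
  have -> : S = h x - q x * (x p ^+ d + h x) by rewrite {1}Ex; ring.
  by ring.
- move=> x px; apply/eqP => /eqP; rewrite subr_eq0 => /eqP q1.
  by have := qB x px; rewrite -q1 cabs1; lra.
move=> x px.
have rp := r0 p; have rpd := exprn_gt0 d rp.
have g l : (20 / rad p) ^+ l * rad p ^+ l = 20 ^+ l.
  by rewrite -exprMn divfK// gt_eqF.
have kd : kappa * 20 ^+ d <= rad p ^+ d / 8.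
  rewrite -(g d) mulrA; apply: le_trans (ler_wpM2r (ltW rpd) small) _.
  by rewrite mulrC.
have geo : 19 * \sum_(l < d) 20 ^+ l = 20 ^+ d - 1 :> R.
  elim: {+}d => [|j IH]; first by rewrite big_ord0 mulr0 expr0 subrr.
  by rewrite big_ord_recr /= mulrDr IH exprS; ring.
have S0 : \sum_(l < d) 20 ^+ l <= 20 ^+ d / 19 :> R by lra.
apply: (@le_lt_trans _ _ (\sum_(l < d) 4 * kappa * 20 ^+ l)).
  apply: ler_sum => l _; rewrite -(g l).
  have -> : 4 * kappa * ((20 / rad p) ^+ l * rad p ^+ l) =
    4 * ((20 / rad p) ^+ l * kappa) * rad p ^+ l by ring.
  by rewrite ler_wpM2r ?rB// exprn_ge0// ltW.
rewrite -mulr_sumr; have := ler_wpM2l k0 S0; lra.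
Qed.

End Weierstrass.

(** * Elimination of a variable *)

Section CommonRoots.
Variable F : closedFieldType.

(** A resultant in matrix form. If the polynomials are coprime, Bezout and Cayley-Hamilton invert
    [horner_mx A q]; a common root provides an eigenvector that it kills. *)
Lemma det_horner_mx_eq0 n (A : 'M[F]_n.+1) (q : {poly F}) :
  (\det (horner_mx A q) == 0) <->
  exists a, root (char_poly A) a /\ root q a.
Proof.
split=> [dA|[a [ra rq]]].
  have [cop|ncop] := boolP (coprimep (char_poly A) q).
    have /Bezout_eq1_coprimepP[[u v] /= uv] := cop.
    have : horner_mx A (u * char_poly A + v * q) = 1 by rewrite uv rmorph1.
    rewrite rmorphD !rmorphM /= Cayley_Hamilton mulr0 add0r => /(congr1 determinant).
    rewrite det1 -mulmxE det_mulmx (eqP dA) mulr0 => /eqP.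
    by rewrite eq_sym oner_eq0.
  have /closed_rootP[a] : size (gcdp (char_poly A) q) != 1%N by exact: ncop.
  by rewrite root_gcd => /andP[? ?]; exists a.
move: ra; rewrite -eigenvalue_root_char => /eigenvalueP[v vA v0].
apply/det0P; exists v => //.
have /factor_theorem[q' ->] := rq.
rewrite mulrC rmorphM /= -mulmxE mulmxA rmorphB /= horner_mx_X horner_mx_C.
by rewrite mulmxBr vA mul_mx_scalar subrr mul0mx.
Qed.

Lemma char_poly_companion n (P : {poly F}) : P \is monic -> size P = n.+1 ->
  char_poly (\matrix_(i < n, j < n)
    if i == n.-1 :> nat then - P`_j else (i.+1 == j :> nat)%:R) = P.
Proof.
move=> mP sP; have := companionmxK mP; rewrite /companionmx.
by move: (size P).-1 (congr1 predn sP) => k /= ->.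
Qed.

End CommonRoots.

Section Norm.
Variable R : realType.
Local Notation C := R[i].
Local Open Scope complex_scope.

Definition companion n (r : 'I_n.+1 -> C) : 'M[C]_n.+1 :=
  \matrix_(i, j) if i == n :> nat then - r j else (i.+1 == j :> nat)%:R.

(* The product of the values of [sum_l s_l X^l] at the roots of
   [X^n.+1 + sum_l r_l X^l], as a polynomial in the coefficients. *)
Definition root_norm n (r s : 'I_n.+1 -> C) : C :=
  \det (\sum_(l < n.+1) s l *: companion r ^+ l).

Definition monic_eval n (r : 'I_n.+1 -> C) a : C := a ^+ n.+1 + \sum_(l < n.+1) r l * a ^+ l.

Definition monic_poly n (r : 'I_n.+1 -> C) : {poly C} :=
  'X^(n.+1) + \poly_(l < n.+1) r (inord l).

Lemma size_monic_poly n (r : 'I_n.+1 -> C) : size (monic_poly r) = n.+2.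
Proof. by rewrite size_polyDl size_polyXn// ltnS size_poly. Qed.

Lemma monic_poly_monic n (r : 'I_n.+1 -> C) : monic_poly r \is monic.
Proof. by rewrite monicE lead_coefDl ?lead_coefXn// size_polyXn ltnS size_poly. Qed.

Lemma horner_monic_poly n (r : 'I_n.+1 -> C) a : (monic_poly r).[a] = monic_eval r a.
Proof.
rewrite hornerD hornerXn horner_poly; congr (_ + _).
by apply: eq_bigr => l _; rewrite inord_val.
Qed.

Lemma char_poly_monic n (r : 'I_n.+1 -> C) : char_poly (companion r) = monic_poly r.
Proof.
rewrite -[RHS](char_poly_companion (monic_poly_monic r) (size_monic_poly r)).
congr char_poly; apply/matrixP => i j; rewrite !mxE; case: ifP => // _.
by rewrite coefD coefXn coef_poly ltn_ord ltn_eqF ?ltn_ord// add0r inord_val.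
Qed.

Lemma root_norm_eq0 n (r s : 'I_n.+1 -> C) : root_norm r s = 0 <->
  exists a, monic_eval r a = 0 /\ \sum_(l < n.+1) s l * a ^+ l = 0.
Proof.
pose q : {poly C} := \sum_(l < n.+1) s l *: 'X^l.
have -> : root_norm r s = \det (horner_mx (companion r) q).
  rewrite /root_norm /q raddf_sum /=; congr determinant; apply: eq_bigr => l _.
  by rewrite linearZ /= rmorphXn /= horner_mx_X.
have qE a : q.[a] = \sum_(l < n.+1) s l * a ^+ l.
  by rewrite horner_sum; apply: eq_bigr => l _; rewrite hornerZ hornerXn.
split=> [/eqP/det_horner_mx_eq0[a []]|[a [ra sa]]].
  rewrite char_poly_monic /root horner_monic_poly qE => /eqP ra /eqP sa.
  by exists a.
apply/eqP/det_horner_mx_eq0; exists a.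
by rewrite char_poly_monic /root horner_monic_poly qE ra sa eqxx.
Qed.

Lemma monic_eval_roots n (r : 'I_n.+1 -> C) :
  exists L : seq C, forall a, monic_eval r a = 0 -> a \in L.
Proof.
have [L hL] := closed_field_poly_normal (monic_poly r); exists L => a ra.
have : root (monic_poly r) a by rewrite /root horner_monic_poly ra.
by rewrite hL rootZ ?root_prod_XsubC// (monicP (monic_poly_monic r)) oner_eq0.
Qed.

Variable m : nat.

Lemma shol_root_norm n (rad : 'I_m -> R) (r s : 'I_n.+1 -> cvec R m -> C) :
  (forall l, shol rad (r l)) -> (forall l, shol rad (s l)) ->
  shol rad (fun x => root_norm (r^~ x) (s^~ x)).
Proof.
move=> hr hs.
have hc i j : shol rad (fun x => companion (r^~ x) i j).
  have [E|E] := eqVneq (i : nat) n.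
    by apply: shol_ext (sholN (hr j)) => x _; rewrite mxE E eqxx.
  by apply: shol_ext (shol_cst rad (i.+1 == j :> nat)%:R) => x _; rewrite mxE (negPf E).
have hX l i j : shol rad (fun x => (companion (r^~ x) ^+ l) i j).
  elim: l i j => [|l IH] i j.
    by apply: shol_ext (shol_cst rad ((1 : 'M[C]_n.+1) i j)) => x _; rewrite expr0.
  have := @shol_sum R m rad 'I_n.+1 (index_enum _) xpredT
    (fun k x => companion (r^~ x) i k * (companion (r^~ x) ^+ l) k j)
    (fun k => sholM (hc i k) (IH k j)).
  by apply: shol_ext => x _; rewrite exprS -mulmxE mxE.
have hsum i j : shol rad (fun x => (\sum_(l < n.+1) s l x *: companion (r^~ x) ^+ l) i j).
  have := @shol_sum R m rad 'I_n.+1 (index_enum _) xpredT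
    (fun l x => s l x * (companion (r^~ x) ^+ l) i j) (fun l => sholM (hs l) (hX l i j)).
  by apply: shol_ext => x _; rewrite summxE; apply: eq_bigr => l _; rewrite mxE.
rewrite /root_norm; apply: shol_sum => w; apply: sholZ; apply: shol_prod => i.
exact: hsum.
Qed.

End Norm.

(** * Linear combinations that avoid finitely many zeros *)

Section Spans.
Variable R : realType.
Local Notation C := R[i].
Local Open Scope complex_scope.
Variable X : Type.
Implicit Types (S : (X -> C) -> Prop) (f g : X -> C).

Inductive lin_span S : (X -> C) -> Prop :=
| lin_span_gen f : S f -> lin_span S f
| lin_span_lin f g c : lin_span S f -> lin_span S g -> lin_span S (fun x => f x + c * g x).

Lemma exists_notin (L : seq C) : exists c : C, c \notin L.
Proof.
exists (1 + \sum_(z <- L) cabs z)%:C; apply/negP => cL.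
have s0 (s : seq C) : 0 <= \sum_(z <- s) cabs z.
  by apply: sumr_ge0 => z _; exact: cabs_ge0.
have : cabs (1 + \sum_(z <- L) cabs z)%:C <= \sum_(z <- L) cabs z.
  by rewrite {2}(big_rem _ cL) /= lerDl.
by rewrite cabs_real_ge0; have := s0 L; lra.
Qed.

(** A vector space over an infinite field is no finite union of proper subspaces: adding [c * g]
    spoils nothing once [c] avoids one ratio per point. [List.In] serves because [X] has no
    decidable equality. *)
Lemma lin_closed_avoid (V : (X -> C) -> Prop) (L : seq X) :
  (exists f, V f) ->
  (forall f g c, V f -> V g -> V (fun x => f x + c * g x)) ->
  (forall x, List.In x L -> exists2 f, V f & f x != 0) ->
  exists2 f, V f & forall x, List.In x L -> f x != 0.
Proof.
move=> V0 Vlin; elim: L => [|x L IH] hL; first by case: V0 => f Vf; exists f.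
have [y hy|f Vf fL] := IH; first by apply: hL; right.
have [|g Vg gx] := hL x; first by left.
have [c] := exists_notin ((- f x / g x) :: [seq - f y / g y | y <- L]).
rewrite inE negb_or => /andP[cx cL].
have neq y : g y != 0 -> c != - f y / g y -> f y + c * g y != 0.
  move=> gy; apply: contra => /eqP E; apply/eqP.
  have -> : - f y = c * g y by apply/eqP; rewrite eq_sym -addr_eq0 addrC E.
  by rewrite mulfK.
exists (fun y => f y + c * g y); first exact: Vlin.
move=> y [<-|yL]; first exact: neq.
have [gy|gy] := eqVneq (g y) 0; first by rewrite gy mulr0 addr0 fL.
apply: neq => //; apply: contraNneq cL => ->.
elim: {+}L yL => [//|z s IHs] /= [->|ys]; rewrite inE ?eqxx// IHs ?orbT//.
Qed.

End Spans.

(** * Weierstrass form after a linear change of coordinates *)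

Section Elimination.
Variable R : realType.
Local Notation C := R[i].
Local Open Scope complex_scope.

(* Each division by [x tau] may cost a factor [20 / delta], so the Taylor
   remainders tend to [0] only on a smaller polydisc. *)
Lemma factor_power m (tau : 'I_m) (delta : R) f y :
  shol (fun=> delta) f -> polydisc (fun=> delta / 80) y -> f y != 0 ->
  exists k (g : cvec R m -> C) y', [/\ shol (fun=> delta) g,
    forall x, polydisc (fun=> delta / 80) x -> f x = x tau ^+ k * g x,
    polydisc (fun=> delta / 80) y', y' tau = 0 & g y' != 0].
Proof.
move=> sf py fy; have d0 : 0 < delta by have := polydisc_gt0 py tau; lra.
have pd (x : cvec R m) : polydisc (fun=> delta / 80) x -> polydisc (fun=> delta) x.
  by move=> px i; apply: lt_le_trans (px i) _; lra.
have p0 x : polydisc (fun=> delta / 80) x -> polydisc (fun=> delta / 80) (upd x tau 0).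
  by move=> px; apply: polydisc_upd => //; rewrite cabs0 divr_gt0.
have ex : exists l, `[< exists x, polydisc (fun=> delta / 80) x /\
    taylor tau l f (upd x tau 0) != 0 >].
  apply: contrapT => nex; move/eqP: fy; apply.
  have [M [M0 fM]] := shol_bound sf.
  apply: (@geometric_eq0 _ _ M) => k.
  rewrite (taylorE tau k) big1 ?add0r => [|l _]; last first.
    have -> : taylor tau l f (upd y tau 0) = 0; last by rewrite mulr0.
    by apply: contrapT => /eqP h; apply: nex; exists l; apply/asboolP; exists y.
  rewrite cabsM cabsX.
  have h1 := taylor_bound tau k M0 sf fM (pd y py).
  have h2 : cabs (y tau) ^+ k <= (delta / 80) ^+ k.
    by rewrite lerXn2r ?nnegrE ?cabs_ge0 ?divr_ge0 ?ltW// py.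
  apply: le_trans (ler_pM (exprn_ge0 _ (cabs_ge0 _)) (cabs_ge0 _) h2 h1) _.
  rewrite mulrA -exprMn (_ : delta / 80 * (20 / delta) = 4^-1); last by field; rewrite gt_eqF.
  rewrite mulrC ler_wpM2l// lerXn2r ?nnegrE ?invr_ge0//; lra.
have [k /asboolP[x [px fx]] kmin] := ex_minnP ex.
exists k, (taylor tau k f), (upd x tau 0); split=> //.
- exact: shol_taylor.
- move=> z pz; rewrite (taylorE tau k f z) big1 ?add0r// => l _.
  have -> : taylor tau l f (upd z tau 0) = 0; last by rewrite mulr0.
  apply: contrapT => /eqP h; have := ltn_ord l; rewrite ltnNge => /negP; apply.
  by apply: kmin; apply/asboolP; exists z.
- exact: p0.
- by rewrite upd_same.
Qed.

(* Sends [e_p] to [y'], so that a function with [g y' != 0] becomes regular in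
   [x p]. *)
Definition shear m (p : 'I_m) (y' x : cvec R m) : cvec R m :=
  fun i => (if i == p then 0 else x i) + x p * y' i.

Definition rad_at m (p : 'I_m) (a b : R) : 'I_m -> R := fun i => if i == p then a else b.

(** The radius [40] against [delta / 80] leaves [delta / 2] for each of the two terms. It also
    exceeds twice the factor [20]-fold loss of a Taylor step at [x p = 1], the point sent to [y'],
    with ratio [20 / 40]. *)
Lemma polydisc_shear m (p : 'I_m) delta y' x : 0 < delta ->
  polydisc (fun=> delta / 80) y' -> polydisc (rad_at p 40 (delta / 2)) x ->
  polydisc (fun=> delta) (shear p y' x).
Proof.
move=> d0 py px i; apply: le_lt_trans (cabsD _ _) _; rewrite cabsM.
have := px p; rewrite /rad_at eqxx => xp; have yi := py i.
have h : cabs (x p) * cabs (y' i) <= 40 * (delta / 80).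
  by rewrite ler_pM ?cabs_ge0// ltW.
have := px i; rewrite /rad_at; case: eqP => _ ?; rewrite ?cabs0; lra.
Qed.

Lemma shol_shear m (p : 'I_m) delta y' (g : cvec R m -> C) : 0 < delta ->
  polydisc (fun=> delta / 80) y' -> shol (fun=> delta) g ->
  shol (rad_at p 40 (delta / 2)) (fun x => g (shear p y' x)).
Proof.
move=> d0 py sg; have [M [M0 gM]] := shol_bound sg.
have pT := polydisc_shear d0 py.
split; first by exists M => x /pT/gM.
move=> x i px s sr.
pose a := shear p y' (upd x i 0).
pose v : cvec R m := fun k => (if (k == i) && (k != p) then 1 else 0) + (if p == i then y' k else 0).
have E t : shear p y' (upd x i t) = (fun k => a k + t * v k).
  apply/funext => k; rewrite /a /v /shear /upd.
  case: (eqVneq k p) => [->|kp]; case: (eqVneq p i) => pi /=; rewrite ?andbF ?andbT.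
  - by ring.
  - by ring.
  - by rewrite -pi (negPf kp); ring.
  - by case: (eqVneq k i) => _; ring.
have -> : (fun t => g (shear p y' (upd x i t))) = (fun t => g (fun k => a k + t * v k)).
  by apply/funext => t; rewrite E.
apply: (shol_line sg); rewrite -E; apply: pT; exact: polydisc_upd.
Qed.

(** If all Taylor coefficients in [x p] vanished at the origin, [G] would vanish at the unit vector
    [ep], where the remainders are at most [M / 2 ^ k]; but [G ep = g y']. *)
Lemma exists_order m (p : 'I_m) delta y' (g : cvec R m -> C) : 0 < delta ->
  polydisc (fun=> delta / 80) y' -> shol (fun=> delta) g -> g y' != 0 ->
  let G := fun x => g (shear p y' x) in
  exists d, taylor p d G (vzero m) != 0 /\
    forall l, (l < d)%N -> taylor p l G (vzero m) = 0.
Proof.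
move=> d0 py sg gy G; have sG := @shol_shear _ p _ _ _ d0 py sg.
have [M [M0 GM]] := shol_bound sG.
have ex : exists l, taylor p l G (vzero m) != 0.
  apply: contrapT => nex; move/eqP: gy; apply.
  pose ep := upd (vzero m) p (1 : C).
  have pe : polydisc (rad_at p 40 (delta / 2)) ep.
    move=> i; rewrite /ep /upd /rad_at; case: eqP => _; rewrite ?cabs1 ?cabs0 ?divr_gt0//.
    by rewrite ltr1n.
  have ep0 : upd ep p 0 = vzero m by rewrite /ep updK -[RHS](upd_id _ p).
  have <- : G ep = g y'.
    rewrite /G; congr g; apply/funext => i; rewrite /shear /ep upd_same mul1r.
    by rewrite /upd; case: (i == p); rewrite add0r.
  apply: (@geometric_eq0 _ _ M) => k.
  rewrite (taylorE p k) big1 ?add0r => [|l _]; last first.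
    have -> : taylor p l G (upd ep p 0) = 0; last by rewrite mulr0.
    by rewrite ep0; apply: contrapT => /eqP h; apply: nex; exists l.
  rewrite {1}/ep upd_same expr1n mul1r.
  apply: le_trans (taylor_bound p k M0 sG GM pe) _.
  rewrite {1}/rad_at eqxx mulrC (_ : 20 / 40 = 2^-1)//; by field.
have [d hd dmin] := ex_minnP ex; exists d; split=> // l ld.
by apply: contrapT => /eqP/dmin; rewrite leqNgt ld.
Qed.

(** The remainder [U] of order [d] is a unit near the origin, and [h] collects the lower
    coefficients divided by it. They vanish at the origin and do not depend on [x p], so [h] becomes
    small by shrinking the other coordinates while the radius [rho] in [x p] stays fixed. *)
Lemma local_weierstrass_form m (p : 'I_m) rad (G : cvec R m -> C) d :
  (forall i, 0 < rad i) -> shol rad G -> taylor p d G (vzero m) != 0 ->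
  (forall l, (l < d)%N -> taylor p l G (vzero m) = 0) ->
  exists (rho : R) (U h : cvec R m -> C),
  [/\ 0 < rho /\ (forall i, rho <= rad i), shol (fun=> rho) h,
     forall x, polydisc (fun=> rho) x -> U x != 0 /\ G x = U x * (x p ^+ d + h x) &
     forall e : R, 0 < e -> exists e' : R, 0 < e' /\ forall x, polydisc (fun=> rho) x ->
       (forall i, i != p -> cabs (x i) < e') -> cabs (h x) <= e].
Proof.
move=> r0 sG U0 low; pose U := taylor p d G.
have sU : shol rad U by exact: shol_taylor.
pose eta := cabs (U (vzero m)) / 2.
have eta0 : 0 < eta by rewrite divr_gt0// cabs_gt0.
have [d1 [d10 hd1]] := shol_cont0 r0 sU eta0.
have [r [rp rr]] := common_lower_bound r0.
pose rho := Num.min r (Num.min d1 1).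
have rho0 : 0 < rho by rewrite !lt_min rp d10 ltr01.
have rho_rad i : rho <= rad i by rewrite ge_min rr.
have rho_d1 : rho <= d1 by rewrite !ge_min lexx orbT.
have rho1 : rho <= 1 by rewrite !ge_min lexx !orbT.
have prad (x : cvec R m) : polydisc (fun=> rho) x -> polydisc rad x.
  by move=> px i; exact: lt_le_trans (px i) (rho_rad i).
have Ueta x : polydisc (fun=> rho) x -> eta <= cabs (U x).
  move=> px; have := hd1 x (prad x px) (fun i => lt_le_trans (px i) rho_d1).
  have := cabs_sub_ge (U (vzero m)) (U x); rewrite (cabsBC (U (vzero m))) /eta; lra.
pose a l x := taylor p l G (upd x p 0).
have sa l : shol rad (a l) by apply: shol_upd => //; exact: shol_taylor.
pose A x := \sum_(l < d) x p ^+ l * a l x.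
have p0 (x : cvec R m) : polydisc (fun=> rho) x -> polydisc (fun=> rho) (upd x p 0).
  by move=> px; apply: polydisc_upd => //; rewrite cabs0.
have sA : shol (fun=> rho) A.
  (* Powers of the coordinate [x p] times coefficients that are already holomorphic on the larger
     polydisc. *)
  apply: shol_sum => l; apply: sholM; first exact/sholX/shol_coord.
  exact: shol_sub (sa l).
have U0' x : polydisc (fun=> rho) x -> U x != 0.
  by move=> px; rewrite -cabs_gt0; apply: lt_le_trans (Ueta x px).
exists rho, U, (fun x => A x * (U x)^-1); split=> //.
- apply: sholM => //; apply: (@sholV _ _ _ _ eta) => //.
  exact: shol_sub sU.
- move=> x px; split; first exact: U0'.
  rewrite {1}(taylorE p d G) mulrDr addrC; congr (_ + _); first by rewrite mulrC.
  by rewrite mulrCA divff ?mulr1// U0'.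
move=> e e0.
have dp : 0 < d%:R + 1 :> R by rewrite ltr_wpDl.
have q0 := divr_gt0 (mulr_gt0 e0 eta0) dp.
have al l : exists e' : R, 0 < e' /\ forall x, polydisc (fun=> rho) x ->
    (forall i, i != p -> cabs (x i) < e') -> (l < d)%N ->
    cabs (a l x) < e * eta / (d%:R + 1).
  have [e' [e'0 he']] := shol_cont0 r0 (shol_taylor p l sG) q0.
  exists e'; split=> // x px xe ld.
  have := he' (upd x p 0) (prad _ (p0 x px)); rewrite (low l ld) subr0; apply=> i.
  by rewrite /upd; case: eqVneq => [_|/xe//]; rewrite cabs0.
have /choice[eps heps] := fun l : 'I_d => al l.
have [e' [e'0 he']] := common_lower_bound (fun l => (heps l).1).
exists e'; split=> // x px xe; rewrite cabsM cabsV ler_pdivrMr ?cabs_gt0 ?U0'//.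
apply: le_trans (_ : e * eta <= _); last by rewrite ler_pM2l// Ueta.
apply: le_trans (cabs_sum _ _ _) _.
apply: (@le_trans _ _ (\sum_(l < d) e * eta / (d%:R + 1))).
  apply: ler_sum => l _; rewrite cabsM cabsX -[leRHS]mul1r.
  rewrite ler_pM ?exprn_ge0 ?cabs_ge0//.
    by rewrite exprn_ile1 ?cabs_ge0//; apply: le_trans rho1; exact/ltW/px.
  apply/ltW/(heps l).2 => // i ip; exact: lt_le_trans (xe i ip) (he' l).
rewrite sumr_const card_ord -[leLHS]mulr_natr.
have ee := ltW (mulr_gt0 e0 eta0).
by rewrite mulrAC ler_pdivrMr// ler_wpM2l//; lra.
Qed.

End Elimination.

(** * Projection along one coordinate *)

Section Projection.
Variable R : realType.
Local Notation C := R[i].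
Local Open Scope complex_scope.
Variable m : nat.
Implicit Types (p : 'I_m.+1) (w : cvec R m) (z : cvec R m.+1).

Definition insert p (a : C) w : cvec R m.+1 :=
  fun i => if unlift p i is Some j then w j else a.

Definition remove p z : cvec R m := fun j => z (lift p j).

Lemma insert_at p a w : insert p a w p = a.
Proof. by rewrite /insert unlift_none. Qed.

Lemma insert_lift p a w j : insert p a w (lift p j) = w j.
Proof. by rewrite /insert liftK. Qed.

Lemma upd_insert p a b w : upd (insert p a w) p b = insert p b w.
Proof.
apply/funext => i; rewrite /upd; case: (unliftP p i) => [j|] ->.
  by rewrite eq_sym (negPf (neq_lift p j)) !insert_lift.
by rewrite eqxx insert_at.
Qed.

Lemma insert_remove p a z : insert p a (remove p z) = upd z p a.
Proof.
apply/funext => i; rewrite /upd; case: (unliftP p i) => [j|] ->.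
  by rewrite eq_sym (negPf (neq_lift p j)) insert_lift.
by rewrite eqxx insert_at.
Qed.

Lemma polydisc_insert p rho delta a w : cabs a < rho -> polydisc (fun=> delta) w ->
  polydisc (rad_at p rho delta) (insert p a w).
Proof.
move=> ar pw i; rewrite /rad_at; case: (unliftP p i) => [j|] ->.
  by rewrite eq_sym (negPf (neq_lift p j)) insert_lift.
by rewrite eqxx insert_at.
Qed.

Lemma shol_insert p rho delta (F : cvec R m.+1 -> C) : 0 < rho ->
  shol (rad_at p rho delta) F -> shol (fun=> delta) (fun w => F (insert p 0 w)).
Proof.
move=> r0 [[M hM] hF]; have o0 : cabs (0 : C) < rho by rewrite cabs0.
split; first by exists M => w pw; apply: hM; exact: polydisc_insert.
move=> w j pw s sd.
have -> : (fun t => F (insert p 0 (upd w j t))) =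
    (fun t => F (upd (insert p 0 w) (lift p j) t)).
  apply/funext => t; congr F; apply/funext => i.
  case: (unliftP p i) => [k|] ->; last first.
    by rewrite insert_at upd_neq ?insert_at ?neq_lift.
  by rewrite insert_lift /upd (inj_eq lift_inj) insert_lift.
apply: hF; first exact: polydisc_insert.
by rewrite /rad_at eq_sym (negPf (neq_lift p j)).
Qed.

(* [S'] consists of the norms of the remainders of the members of [Fam] modulo
   [x p ^+ n.+1 + h x]. *)
Lemma projection p rho delta n (h : cvec R m.+1 -> C) (kappa : R)
    (Fam : (cvec R m.+1 -> C) -> Prop) (rad := rad_at p rho delta) :
  0 < rho -> 0 < delta -> shol rad h -> 0 <= kappa ->
  (forall x, polydisc rad x -> cabs (h x) <= kappa) ->
  kappa * (20 / rho) ^+ n.+1 <= 8^-1 ->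
  (exists f, Fam f) ->
  (forall f g c, Fam f -> Fam g -> Fam (fun x => f x + c * g x)) ->
  (forall f, Fam f -> shol rad f) ->
  exists S' : (cvec R m -> C) -> Prop,
  [/\ forall F, S' F -> shol (fun=> delta) F,
      forall z, polydisc rad z -> z p ^+ n.+1 + h z = 0 ->
        (forall f, Fam f -> f z = 0) -> forall F, S' F -> F (remove p z) = 0 &
      forall w, polydisc (fun=> delta) w -> (forall F, S' F -> F w = 0) ->
        exists a, [/\ cabs a < rho, a ^+ n.+1 + h (insert p a w) = 0 &
          forall f, Fam f -> f (insert p a w) = 0]].
Proof.
move=> rho0 delta0 sh k0 hk small [f0 Ff0] Flin Fshol.
have r0 i : 0 < rad i by rewrite /rad /rad_at; case: ifP.
have radp : rad p = rho by rewrite /rad /rad_at eqxx.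
have small' : kappa * (20 / rad p) ^+ n.+1 <= 8^-1 by rewrite radp.
have [u [r [sr ri rE u0 rlt]]] := weierstrass_preparation r0 sh k0 hk small'.
(* A relation and not a chosen remainder: combinations of remainders are then remainders of
   combinations, with no appeal to uniqueness of division. *)
pose rem f (s : 'I_n.+1 -> cvec R m.+1 -> C) :=
  [/\ forall l, shol rad (s l), forall l x b, s l (upd x p b) = s l x &
    exists q, forall x, polydisc rad x ->
      f x = q x * (x p ^+ n.+1 + h x) + \sum_(l < n.+1) s l x * x p ^+ l].
have rem_ex f : Fam f -> exists s, rem f s.
  move=> /Fshol sf; have [M [M0 fM]] := shol_bound sf.
  have [q [s [[_ ss] si sE _ _]]] := weierstrass_division r0 sh k0 hk small' M0 sf fM.
  by exists s; split=> //; exists q.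
pose S' F := exists f s, [/\ Fam f, rem f s &
  F = fun w => root_norm (fun l => r l (insert p 0 w)) (fun l => s l (insert p 0 w))].
exists S'; split.
- move=> F [f [s [_ [ss _ _] ->]]].
  exact: (shol_insert rho0 (shol_root_norm sr ss)).
- move=> z pz zP zF F [f [s [Ff [ss si [q qE]] ->]]]; apply/root_norm_eq0; exists (z p).
  rewrite insert_remove; split.
    rewrite /monic_eval; under eq_bigr => l _ do rewrite ri.
    by rewrite rE// zP mulr0.
  under eq_bigr => l _ do rewrite si.
  by have := qE z pz; rewrite zF// zP mulr0 add0r.
move=> w pw wS'.
pose rw l := r l (insert p 0 w); pose sw (s : 'I_n.+1 -> cvec R m.+1 -> C) a :=
  \sum_(l < n.+1) s l (insert p 0 w) * a ^+ l.
(* Otherwise every root of the divisor over [w] is missed by some remainder, hence one combination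
   misses all roots at once, although its norm at [w] is [0]. *)
have [a [ra sa]] : exists a, monic_eval rw a = 0 /\
    forall f s, Fam f -> rem f s -> sw s a = 0.
  apply: contrapT => none.
  have [L hL] := monic_eval_roots rw.
  pose V (phi : C -> C) := exists f s, [/\ Fam f, rem f s & phi = sw s].
  have [||a aL|phi [f [s [Ff fs ->]]] nz] := @lin_closed_avoid R C V
      [seq a <- L | monic_eval rw a == 0].
  - by have [s fs] := rem_ex f0 Ff0; exists (sw s), f0, s.
  - move=> _ _ c [f [s [Ff [ss si [q qE]] ->]]] [g [t [Fg [st ti [q' qE']] ->]]].
    exists (fun x => f x + c * g x), (fun l x => s l x + c * t l x); split.
    + exact: Flin.
    + split; [by move=> l; apply/sholD/sholZ|by move=> l x b; rewrite si ti|].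
      exists (fun x => q x + c * q' x) => x px; rewrite qE// qE'//.
      have -> : \sum_(l < n.+1) (s l x + c * t l x) * x p ^+ l =
          \sum_(l < n.+1) s l x * x p ^+ l + c * \sum_(l < n.+1) t l x * x p ^+ l.
        by rewrite mulr_sumr -big_split; apply: eq_bigr => l _ /=; ring.
      by ring.
    + apply/funext => a; rewrite /sw mulr_sumr -big_split.
      by apply: eq_bigr => l _ /=; ring.
  - have am : monic_eval rw a = 0.
      elim: L {hL} aL => //= b L IH; case: eqP => [E [<-//|]|_]; exact: IH.
    apply: contrapT => nV; apply: none; exists a; split=> // f s Ff fs.
    by apply: contrapT => /eqP nz; apply: nV; exists (sw s) => //; exists f, s.
  have /root_norm_eq0[a [ra sa]] : root_norm rw (fun l => s l (insert p 0 w)) = 0.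
    by apply: (wS' (fun w => root_norm (fun l => r l (insert p 0 w))
      (fun l => s l (insert p 0 w)))); exists f, s.
  suff aL : List.In a [seq a <- L | monic_eval rw a == 0].
    by have := nz a aL; rewrite /sw sa eqxx.
  have : a \in [seq a <- L | monic_eval rw a == 0] by rewrite mem_filter ra eqxx hL.
  elim: (filter _ _) => [//|b K IH]; rewrite inE => /orP[/eqP ->|/IH]; [by left|by right].
have rwE : (fun l => r l (insert p a w)) = rw.
  by apply/funext => l; rewrite /rw -(upd_insert p 0 a w) ri.
have mono (x y : R) (l N : nat) : 0 <= x -> x <= y -> (l <= N)%N ->
    x ^+ N * y ^+ l <= y ^+ N * x ^+ l.
  move=> x0 xy lN; have y0 := le_trans x0 xy; rewrite -(subnK lN) !exprD.
  have -> : y ^+ (N - l) * y ^+ l * x ^+ l = x ^+ l * y ^+ l * y ^+ (N - l) by ring.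
  have -> : x ^+ (N - l) * x ^+ l * y ^+ l = x ^+ l * y ^+ l * x ^+ (N - l) by ring.
  by rewrite ler_wpM2l ?mulr_ge0 ?exprn_ge0// lerXn2r.
(* Domination of the leading term at radius [rho] persists at any larger radius by [mono], so no
   root has modulus at least [rho]. *)
have ar : cabs a < rho.
  rewrite ltNge; apply/negP => rha.
  have p0 := @polydisc_insert p rho delta 0 w; rewrite cabs0 in p0.
  have := rlt _ (p0 rho0 pw); rewrite radp.
  have a0 : 0 < cabs a by apply: lt_le_trans rha.
  have : cabs a ^+ n.+1 <= \sum_(l < n.+1) cabs (rw l) * cabs a ^+ l.
    have -> : cabs a ^+ n.+1 = cabs (\sum_(l < n.+1) rw l * a ^+ l).
      rewrite -cabsX -cabsN; congr cabs; apply/eqP.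
      by rewrite eq_sym -addr_eq0 addrC; apply/eqP.
    apply: le_trans (cabs_sum _ _ _) _; apply: ler_sum => l _.
    by rewrite cabsM cabsX.
  set Sa := \sum_(l < _) _ => h1 h2.
  have h3 : rho ^+ n.+1 * Sa <= cabs a ^+ n.+1 * \sum_(l < n.+1) cabs (rw l) * rho ^+ l.
    rewrite /Sa !mulr_sumr; apply: ler_sum => l _.
    rewrite mulrCA [leRHS]mulrCA ler_wpM2l ?cabs_ge0//.
    by apply: mono; [exact: ltW|exact: rha|exact: ltnW (ltn_ord l)].
  have h4 : cabs a ^+ n.+1 * \sum_(l < n.+1) cabs (rw l) * rho ^+ l
      < cabs a ^+ n.+1 * rho ^+ n.+1 by rewrite ltr_pM2l ?exprn_gt0.
  have h5 : rho ^+ n.+1 * cabs a ^+ n.+1 <= rho ^+ n.+1 * Sa.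
    by rewrite ler_pM2l ?exprn_gt0.
  by lra.
have pz := polydisc_insert p ar pw.
have zP : a ^+ n.+1 + h (insert p a w) = 0.
  have := rE _ pz; rewrite insert_at.
  have -> : a ^+ n.+1 + \sum_(l < n.+1) r l (insert p a w) * a ^+ l = 0 by rewrite -[RHS]ra /monic_eval -rwE.
  by move=> /esym/eqP; rewrite mulf_eq0 (negPf (u0 _ pz)) => /eqP.
exists a; split=> // f Ff; have [s fs] := rem_ex f Ff; have [_ si [q qE]] := fs.
rewrite qE// insert_at zP mulr0 add0r -[RHS](sa f s Ff fs) /sw.
by apply: eq_bigr => l _; rewrite -(upd_insert p 0 a w) si.
Qed.

End Projection.

(** * Zeros over a punctured disc *)

Section EliminationTheorem.
Variable R : realType.
Local Notation C := R[i].
Local Open Scope complex_scope.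

(** The accumulating zeros have [x tau != 0], so they survive division by a power of [x tau] and
    force [g] to vanish at the origin. Hence [y'] is nonzero, which supplies [p]; and [y' tau = 0]
    lets the shear along [y'] preserve the coordinate [x tau]. *)
Lemma elimination_setup m (tau : 'I_m) (delta : R) (S : (cvec R m -> C) -> Prop) :
  0 < delta -> (forall f, S f -> shol (fun=> delta) f) ->
  (forall e : R, 0 < e -> exists x, [/\ polydisc (fun=> e) x, x tau != 0 &
     forall f, S f -> f x = 0]) ->
  (forall f, S f -> forall x, polydisc (fun=> delta / 80) x -> f x = 0) \/
  exists f k (g : cvec R m -> C) y' p,
    [/\ S f, shol (fun=> delta) g &
        forall x, polydisc (fun=> delta / 80) x -> f x = x tau ^+ k * g x] /\
    [/\ polydisc (fun=> delta / 80) y', y' tau = 0, p != tau, y' p != 0 &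
        g y' != 0 /\ g (vzero m) = 0].
Proof.
move=> delta0 Sshol zeros.
have [triv|ntriv] := pselect (forall f, S f ->
    forall x, polydisc (fun=> delta / 80) x -> f x = 0); first by left.
right.
have [f [Sf [y [py fy]]]] : exists f, S f /\ exists y,
    polydisc (fun=> delta / 80) y /\ f y != 0.
  apply: contrapT => h; apply: ntriv => f Sf y py; apply: contrapT => /eqP fy.
  by apply: h; exists f; split=> //; exists y.
have [k [g [y' [sg fE py' y'tau gy']]]] := factor_power tau (Sshol f Sf) py fy.
have g0 : g (vzero m) = 0.
  apply: contrapT => /eqP; rewrite -cabs_gt0 => ng0.
  have [d [d0 hd]] := shol_cont0 (fun=> delta0) sg ng0.
  have dm : 0 < Num.min d (delta / 80) by rewrite lt_min d0 divr_gt0.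
  have [x [px xtau xS]] := zeros _ dm.
  have [xd xdelta] : (forall i, cabs (x i) < d) /\ polydisc (fun=> delta / 80) x.
    by split=> i; have := px i; rewrite lt_min => /andP[].
  have xdelta' : polydisc (fun=> delta) x.
    by move=> i; apply: lt_le_trans (xdelta i) _; lra.
  have := fE x xdelta; rewrite (xS f Sf) => /esym/eqP.
  rewrite mulf_eq0 expf_eq0 (negPf xtau) andbF /= => /eqP gx.
  by have := hd x xdelta' xd; rewrite gx sub0r cabsN ltxx.
have [p yp] : exists p, y' p != 0.
  apply: contrapT => h; move/eqP: gy'; apply; rewrite -[RHS]g0; congr g.
  by apply/funext => i; apply: contrapT => /eqP yi; apply: h; exists i.
exists f, k, g, y', p; split; split=> //.
by apply: contraNneq yp => ->; rewrite y'tau.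
Qed.

Lemma shearK m (p : 'I_m) (y' x : cvec R m) : y' p != 0 ->
  shear p y' (fun i => if i == p then x p / y' p else x i - x p / y' p * y' i) = x.
Proof.
move=> yp; apply/funext => i; rewrite /shear eqxx.
by case: eqVneq => [->|_]; [rewrite add0r divfK|rewrite subrK].
Qed.

(** A substitute for curve selection that yields no curve: the zeros found need not depend
    continuously on [t]. *)
Theorem zeros_over_punctured_disc m (tau : 'I_m.+1) (delta : R)
    (S : (cvec R m.+1 -> C) -> Prop) :
  0 < delta -> (forall f, S f -> shol (fun=> delta) f) ->
  (forall e : R, 0 < e -> exists x, [/\ polydisc (fun=> e) x, x tau != 0 &
     forall f, S f -> f x = 0]) ->
  forall e : R, 0 < e -> exists d : R, 0 < d /\ forall t : C, t != 0 -> cabs t < d ->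
    exists x, [/\ polydisc (fun=> e) x, x tau = t & forall f, S f -> f x = 0].
Proof.
elim: m tau delta S => [|m IH] tau delta S delta0 Sshol zeros e e0;
  have [triv|[f1 [k [g [y' [p [[Sf1 sg fE] [py' y'tau ptau yp [gy' g0]]]]]]]]] :=
    elimination_setup delta0 Sshol zeros.
(* If all of [S] vanishes near the origin, the point [t] on the [tau] axis serves. *)
1,3: exists (Num.min e (delta / 80)); split=> [|t _]; first by rewrite lt_min e0 divr_gt0.
1,2: rewrite lt_min => /andP[te td]; exists (upd (vzero _) tau t).
1,2: have o0 (r : R) : 0 < r -> polydisc (fun=> r) (vzero _) by move=> r0 i; rewrite cabs0.
1,2: split=> [||f Sf]; rewrite ?upd_same//; first by apply: polydisc_upd => //; exact: o0.
1,2: by apply: triv => //; apply: polydisc_upd => //; apply: o0; rewrite divr_gt0.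
  (* In one variable there is no [p != tau], so the first alternative was the only one. *)
  by move: ptau; rewrite (ord1 p) (ord1 tau) eqxx.
pose T := shear p y'; pose G x := g (T x).
have pT := polydisc_shear delta0 py'.
have [d [Gd low]] := exists_order p delta0 py' sg gy'.
pose rad1 := rad_at p 40 (delta / 2).
have rad1_gt0 i : 0 < rad1 i by rewrite /rad1 /rad_at; case: ifP => _; lra.
have T0 : T (vzero _) = vzero _.
  by apply/funext => i; rewrite /T /shear mul0r addr0; case: ifP.
(* Order [0] is excluded by [g] vanishing at the origin, so the divisor has positive degree. *)
case: d Gd low => [|n] Gd low; first by move: Gd; rewrite /= -/T T0 g0 eqxx.
have sG : shol rad1 G by exact: shol_shear.
have [rho [U [h [[rho0 rho_rad] sh GE hsmall]]]] :=
  local_weierstrass_form rad1_gt0 sG Gd low.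
pose kappa := 8^-1 * (rho / 20) ^+ n.+1.
have kappa0 : 0 < kappa by rewrite mulr_gt0 ?exprn_gt0 ?divr_gt0 ?invr_gt0.
have [d1 [d10 hd1]] := hsmall kappa kappa0.
have [delta1 [delta10 delta1_d1 delta1_rho]] :
    exists r : R, [/\ 0 < r, r <= d1 & r <= rho].
  by exists (Num.min d1 rho); rewrite lt_min d10 rho0 !ge_min !lexx orbT.
pose rad := rad_at p rho delta1.
have rad_rho x : polydisc rad x -> polydisc (fun=> rho) x.
  move=> px i; apply: lt_le_trans (px i) _; rewrite /rad /rad_at.
  by case: ifP.
have rho_rad1 x : polydisc (fun=> rho) x -> polydisc rad1 x.
  by move=> px i; exact: lt_le_trans (px i) (rho_rad i).
have rad_rad1 i : rad i <= rad1 i.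
  apply: le_trans (rho_rad i); rewrite /rad /rad_at.
  by case: ifP.
have hk x : polydisc rad x -> cabs (h x) <= kappa.
  move=> px; apply: hd1 (rad_rho x px) _ => i ip; have := px i.
  by rewrite /rad /rad_at (negPf ip) => /lt_le_trans; apply.
have small : kappa * (20 / rho) ^+ n.+1 <= 8^-1.
  rewrite /kappa -mulrA -exprMn (_ : rho / 20 * (20 / rho) = 1) ?expr1n ?mulr1//.
  by field; rewrite gt_eqF.
have sh' : shol rad h.
  apply: shol_sub sh => i; rewrite /rad /rad_at.
  by case: ifP.
pose Fam F := exists2 f, lin_span S f & F = fun x => f (T x).
have span_shol f : lin_span S f -> shol (fun=> delta) f.
  by elim=> [f' /Sshol//|f' g' c _ sf' _ sg']; apply/sholD/sholZ.
have span0 x f : (forall f', S f' -> f' x = 0) -> lin_span S f -> f x = 0.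
  by move=> hS; elim=> [f' /hS//|f' g' c _ -> _ ->]; rewrite mulr0 addr0.
have [|f f' c|f|S' [S'shol S'zero S'lift]] :=
  @projection R m.+1 p rho delta1 n h kappa Fam rho0 delta10 sh' (ltW kappa0) hk small.
- by exists (fun x => f1 (T x)), f1 => //; exact: lin_span_gen.
- move=> [f2 sf2 ->] [f3 sf3 ->]; exists (fun x => f2 x + c * f3 x) => //.
  exact: lin_span_lin.
- move=> [f2 sf2 ->]; apply: shol_sub rad_rad1 _.
  by apply: shol_shear => //; exact: span_shol.
have [tau' tauE] : exists tau', tau = lift p tau'.
  case: (unliftP p tau) => [j ->|E]; first by exists j.
  by move: ptau; rewrite E eqxx.
have zeros' (e' : R) : 0 < e' -> exists w, [/\ polydisc (fun=> e') w, w tau' != 0 &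
    forall F, S' F -> F w = 0].
  move=> e'0.
  pose e1 := Num.min e' (Num.min delta1 (delta / 80)).
  have e10 : 0 < e1 by rewrite !lt_min e'0 delta10 divr_gt0.
  (* Dominates the norm of the inverse shear, so that [z] is as small as required. *)
  pose c := 2 * ((cabs (y' p))^-1 * (1 + delta) + 1).
  have cy : 0 < cabs (y' p) by rewrite cabs_gt0.
  have vy : 0 < (cabs (y' p))^-1 by rewrite invr_gt0.
  have vd : 0 <= (cabs (y' p))^-1 * (1 + delta) by rewrite mulr_ge0 ?(ltW vy)//; lra.
  have c1 : 1 <= c by rewrite /c; lra.
  have c0 : 0 < c by exact: lt_le_trans c1.
  have [x [px xtau xS]] := zeros (e1 / c) (divr_gt0 e10 c0).
  have xe i : cabs (x i) * c < e1 by have := px i; rewrite ltr_pdivlMr.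
  have xi i : cabs (x i) < e1.
    by apply: le_lt_trans (xe i); rewrite ler_peMr ?cabs_ge0.
  have xd : polydisc (fun=> delta / 80) x.
    by move=> i; have := xi i; rewrite !lt_min => /andP[_ /andP[]].
  pose z : cvec R m.+2 := fun i => if i == p then x p / y' p else x i - x p / y' p * y' i.
  have Tz : T z = x by exact: shearK.
  have ze i : cabs (z i) < e1.
    have h0 j : 2 * cabs (x j) + 2 * (cabs (x j) * ((cabs (y' p))^-1 * (1 + delta))) < e1.
      by have := xe j; rewrite /c; lra.
    have h1 : 2 * (cabs (x p / y' p) * (1 + delta)) <= e1.
      by have := h0 p; have := cabs_ge0 (x p); rewrite cabs_div; lra.
    have h2 := mulr_ge0 (cabs_ge0 (x p / y' p)) (ltW delta0).
    rewrite /z; case: eqVneq => [_|ip]; first by have := cabs_ge0 (x p / y' p); lra.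
    apply: le_lt_trans (cabsB _ _) _; rewrite cabsM.
    have h3 : cabs (x p / y' p) * cabs (y' i) <= cabs (x p / y' p) * delta.
      by rewrite ler_wpM2l ?cabs_ge0//; have := py' i; lra.
    have := h0 i; have := mulr_ge0 (cabs_ge0 (x i)) vd.
    by have := cabs_ge0 (x p / y' p); lra.
  have pz : polydisc rad z.
    move=> i; apply: lt_le_trans (ze i) _; rewrite /rad /rad_at.
    have e1_delta1 : e1 <= delta1 by rewrite !ge_min lexx !orbT.
    by case: ifP => _ //; exact: le_trans delta1_rho.
  have xtz : z tau = x tau.
    by rewrite -Tz /T /shear y'tau mulr0 addr0 eq_sym (negPf ptau).
  have gx : g x = 0.
    have := fE x xd; rewrite (xS f1 Sf1) => /esym/eqP.
    by rewrite mulf_eq0 expf_eq0 (negPf xtau) andbF /= => /eqP.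
  have zP : z p ^+ n.+1 + h z = 0.
    have [Uz] := GE z (rad_rho z pz); rewrite /G Tz gx => /esym/eqP.
    by rewrite mulf_eq0 (negPf Uz) => /eqP.
  exists (remove p z); split.
  - move=> j; apply: lt_le_trans (ze _) _; by rewrite ge_min lexx.
  - by rewrite /remove -tauE xtz.
  - apply: S'zero => // _ [f sf ->]; rewrite Tz; exact: span0.
(* The projection only places [a] in the disc of radius [rho]. It is in fact small, since
   [a ^+ n.+1 = - h z] and [h] is at most [e3 ^+ n.+1 / 2] once the other coordinates are below
   [d3]. *)
pose e3 := Num.min 1 (e / (2 * (1 + delta))).
have e30 : 0 < e3 by rewrite lt_min ltr01 divr_gt0//; lra.
have [d3 [d30 hd3]] := hsmall (e3 ^+ n.+1 / 2) (divr_gt0 (exprn_gt0 _ e30) (ltr0n _ 2)).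
pose e2 := Num.min (Num.min d3 (e / 2)) delta1.
have e20 : 0 < e2 by rewrite !lt_min d30 delta10 divr_gt0.
have [d2 [d20 hd2]] := IH tau' delta1 S' delta10 S'shol zeros' e2 e20.
exists d2; split=> // t t0 /(hd2 t t0)[w [pw wt wS']].
have pw1 : polydisc (fun=> delta1) w.
  by move=> j; have := pw j; rewrite !lt_min => /andP[].
have [a [ar aP aFam]] := S'lift w pw1 wS'.
have pz := polydisc_insert p ar pw1.
pose z := insert p a w.
have ae3 : cabs a < e3.
  have hz : cabs (h z) <= e3 ^+ n.+1 / 2.
    apply: hd3 (rad_rho _ pz) _ => i ip; rewrite /z.
    case: (unliftP p i) ip => [j|] ->; last by rewrite eqxx.
    by rewrite insert_lift => _; have := pw j; rewrite !lt_min => /andP[/andP[]].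
  have aE : cabs a ^+ n.+1 = cabs (h z).
    rewrite -cabsX -[in RHS]cabsN; congr cabs; apply/eqP.
    by rewrite -addr_eq0; apply/eqP.
  rewrite ltNge; apply/negP => ea.
  have : e3 ^+ n.+1 <= cabs a ^+ n.+1 by rewrite lerXn2r ?nnegrE ?cabs_ge0// ltW.
  by have := exprn_gt0 n.+1 e30; lra.
exists (T z); split.
- move=> i; rewrite /T /shear {2}/z insert_at.
  apply: le_lt_trans (cabsD _ _) _; rewrite cabsM.
  have h1 : cabs a * cabs (y' i) <= e3 * delta.
    rewrite ler_pM ?cabs_ge0 ?(ltW ae3)//; apply/ltW/(lt_le_trans (py' i)); lra.
  have h2 : e3 * (2 * (1 + delta)) <= e.
    by rewrite -ler_pdivlMr; [rewrite ge_min lexx orbT|lra].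
  have h3 : cabs (if i == p then 0 else z i) < e / 2.
    case: eqVneq => [_|ip]; first by rewrite cabs0 divr_gt0.
    rewrite /z; case: (unliftP p i) ip => [j|] ->; last by rewrite eqxx.
    by rewrite insert_lift => _; have := pw j; rewrite !lt_min => /andP[/andP[]].
  by lra.
- by rewrite /T /shear y'tau mulr0 addr0 eq_sym (negPf ptau) /z tauE insert_lift.
- move=> f Sf; apply: (aFam (fun x => f (T x))).
  by exists f => //; exact: lin_span_gen.
Qed.
End EliminationTheorem.

(** * Cones and bi-Lipschitz maps *)

Section Cones.
Variable R : realType.
Local Notation C := R[i].
Local Open Scope complex_scope.

Section Norms.
Variable n : nat.
Implicit Types (x y v : cvec R n).

Lemma cabs_sqr (z : C) : cabs z ^+ 2 = complex.Re z ^+ 2 + complex.Im z ^+ 2.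
Proof. by rewrite sqr_sqrtr// addr_ge0 ?sqr_ge0. Qed.

Lemma cabs_le_vnorm x i : cabs (x i) <= vnorm x.
Proof.
rewrite /vnorm ler_sqrt ?sumr_ge0// => [|k _]; last by rewrite addr_ge0 ?sqr_ge0.
rewrite (bigD1 i)//= lerDl sumr_ge0// => k _; by rewrite addr_ge0 ?sqr_ge0.
Qed.

Lemma vnorm_le_sum x : vnorm x <= \sum_(i < n) cabs (x i).
Proof.
have s0 (s : seq 'I_n) : 0 <= \sum_(i <- s) cabs (x i).
  by apply: sumr_ge0 => i _; exact: cabs_ge0.
rewrite -[leRHS](ger0_norm (s0 _)) -sqrtr_sqr /vnorm ler_sqrt ?sqr_ge0//.
under eq_bigr => i _ do rewrite -cabs_sqr.
elim: (index_enum _) => [|i s IH]; first by rewrite !big_nil expr0n.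
rewrite !big_cons sqrrD -addrA lerD2l; apply: le_trans IH _.
by rewrite lerDr mulrn_wge0// mulr_ge0 ?cabs_ge0.
Qed.

Lemma vnorm_lt x (e : R) : 0 < e -> (forall i, cabs (x i) < e / (n%:R + 1)) -> vnorm x < e.
Proof.
move=> e0 xe; apply: le_lt_trans (vnorm_le_sum x) _.
have n1 : 0 < n%:R + 1 :> R by rewrite ltr_wpDl.
apply: (@le_lt_trans _ _ (\sum_(i < n) e / (n%:R + 1))).
  by apply: ler_sum => i _; exact: ltW.
by rewrite sumr_const card_ord -[ltLHS]mulr_natr mulrAC ltr_pdivrMr// ltr_pM2l//; lra.
Qed.

Lemma vnorm_le x (e : R) : 0 <= e -> (forall i, cabs (x i) <= e) -> vnorm x <= n%:R * e.
Proof.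
move=> e0 xe; apply: le_trans (vnorm_le_sum x) _.
apply: (@le_trans _ _ (\sum_(i < n) e)); first by apply: ler_sum => i _.
by rewrite sumr_const card_ord -[leLHS]mulr_natr mulrC.
Qed.

Lemma vsub0 x : vsub x (vzero n) = x.
Proof. by apply/funext => i; rewrite /vsub subr0. Qed.

Lemma vneq0 x : x <> vzero n -> exists i, 0 < cabs (x i).
Proof.
move=> x0; apply: contrapT => h; apply: x0; apply/funext => i; apply: contrapT => /eqP xi.
by apply: h; exists i; rewrite cabs_gt0.
Qed.

Lemma vconv_coord (u : nat -> cvec R n) l :
  (forall i (e : R), 0 < e -> exists N, forall k, (N <= k)%N -> cabs (u k i - l i) < e) ->
  vconv u l.
Proof.
move=> h e e0; have n1 : 0 < n%:R + 1 :> R by rewrite ltr_wpDl.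
have [N hN] := choose_threshold (fun i => h i _ (divr_gt0 e0 n1)).
by exists N => k Nk; apply: vnorm_lt => // i; exact: hN.
Qed.

Lemma LDstarP (A : cvec R n -> Prop) v : LDstar A v ->
  forall e : R, 0 < e -> exists c x, [/\ A x, x <> vzero n,
    forall i, cabs (x i) < e & forall i, cabs (c * x i - v i) < e].
Proof.
move=> [c [u [uA [u0 cv]]]] e e0; have [N hN] := u0 e e0; have [N' hN'] := cv e e0.
pose k := maxn N N'; exists (c k), (u k); have [Au nu] := uA k; split=> // i.
  have := hN k (leq_maxl _ _); apply: le_lt_trans; rewrite vsub0; exact: cabs_le_vnorm.
have := hN' k (leq_maxr _ _); apply: le_lt_trans.
exact: (cabs_le_vnorm (vsub (vscale (c k) (u k)) v)).
Qed.

End Norms.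

(** Continuity at the origin gives the bound that [shol] asks for. All smaller radii [d'] are
    covered so that several functions can share one. *)
Lemma shol_of_holomorphic n (f : cvec R n -> C) (r : R) : 0 < r ->
  holomorphic_on (vball (vzero n) r) f ->
  exists d : R, 0 < d /\ forall d', d' <= d ->
    (forall x, polydisc (fun=> d') x -> vball (vzero n) r x) /\ shol (fun=> d') f.
Proof.
move=> r0 hf; have o0 : vball (vzero n) r (vzero n).
  by rewrite /vball vsub0; apply: vnorm_lt => // i; rewrite cabs0 divr_gt0// ltr_wpDl.
have [/(_ 1 ltr01)[d [d0 hd]] _] := hf _ o0.
have n1 : 0 < n%:R + 1 :> R by rewrite ltr_wpDl.
exists (Num.min r d / (n%:R + 1)); split; first by rewrite divr_gt0// lt_min r0.
move=> d' hd'.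
have small (x : cvec R n) : polydisc (fun=> d') x -> vnorm x < Num.min r d.
  move=> px; apply: vnorm_lt => [|i]; first by rewrite lt_min r0.
  exact: lt_le_trans (px i) hd'.
have inball (x : cvec R n) : polydisc (fun=> d') x -> vball (vzero n) r x.
  by move=> /small; rewrite /vball vsub0 lt_min => /andP[].
split=> //; split.
  exists (1 + cabs (f (vzero n))) => x /small; rewrite lt_min => /andP[_ xd].
  have := hd x; rewrite vsub0 => /(_ xd).
  by have := cabs_sub_ge (f x) (f (vzero n)); lra.
move=> x i px s sd; have py : polydisc (fun=> d') (upd x i s) by exact: polydisc_upd.
have [_ /(_ i)[L hL]] := hf _ (inball _ py); exists L => e /hL[d2 [d20 hd2]].
exists d2; split=> // t td; have [->|t0] := eqVneq t 0.
  by rewrite addr0 subrr mulr0 subrr cabs0 mulr0.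
have := hd2 t t0 td.
have -> : vadd (upd x i s) (vscale t (Defs.vbasis R i)) = upd x i (s + t).
  apply/funext => k; rewrite /vadd /vscale /Defs.vbasis /upd.
  by case: eqP => _; rewrite ?mulr1 ?mulr0 ?addr0.
move=> /ltW h; have -> : f (upd x i (s + t)) - f (upd x i s) - L * t =
  ((f (upd x i (s + t)) - f (upd x i s)) / t - L) * t by field.
by rewrite cabsM ler_wpM2r ?cabs_ge0.
Qed.

(* In the coordinates [(t, y)] with [x = t (v + y)], accumulation of zeros at
   the direction [v] becomes accumulation at the origin off [t = 0]. *)
Lemma cone_approx n (W : cvec R n -> Prop) (v : cvec R n) :
  analytic_germ W -> LDstar W v -> v <> vzero n ->
  forall e : R, 0 < e -> exists d : R, 0 < d /\ forall t : C, t != 0 -> cabs t < d ->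
    exists w, W w /\ forall i, cabs (w i - t * v i) <= e * cabs t.
Proof.
move=> [r [k [f [r0 [hf Wf]]]]] LWv v0 e e0.
have /choice[dj hdj] := fun j => shol_of_holomorphic r0 (hf j).
have [d1 [d10 hd1]] := common_lower_bound (fun j => (hdj j).1).
have n1 : 0 < n%:R + 1 :> R by rewrite ltr_wpDl.
pose d' := Num.min d1 (r / (n%:R + 1)).
have d'0 : 0 < d' by rewrite lt_min d10 divr_gt0.
have inball (x : cvec R n) : polydisc (fun=> d') x -> vball (vzero n) r x.
  move=> px; rewrite /vball vsub0; apply: vnorm_lt => // i.
  by apply: lt_le_trans (px i) _; rewrite ge_min lexx orbT.
have sf j : shol (fun=> d') (f j).
  by apply: ((hdj j).2 _ _).2; apply: le_trans (hd1 j); rewrite ge_min lexx.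
pose V := vnorm v; have V0 : 0 <= V by exact: sqrtr_ge0.
have V2 : 0 < V + 2 by lra.
have [delta [delta0 delta_1 delta_d']] :
    exists x : R, [/\ 0 < x, x <= 1 & x * (V + 2) <= d'].
  exists (Num.min 1 (d' / (V + 2))); split; first by rewrite lt_min ltr01 divr_gt0.
    by rewrite ge_min lexx.
  by rewrite -ler_pdivlMr// ge_min lexx orbT.
pose D (x : cvec R n.+1) : cvec R n := fun i => x ord0 * (v i + x (lift ord0 i)).
have pD x : polydisc (fun=> delta) x -> polydisc (fun=> d') (D x).
  move=> px i; rewrite /D cabsM.
  have h1 : cabs (v i + x (lift ord0 i)) <= V + 1.
    apply: le_trans (cabsD _ _) _; rewrite lerD ?cabs_le_vnorm//.
    exact/ltW/(lt_le_trans (px _)).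
  have h2 : cabs (x ord0) * (V + 2) < d'.
    by apply: lt_le_trans delta_d'; rewrite ltr_pM2r.
  have h3 := ler_wpM2l (cabs_ge0 (x ord0)) h1.
  by have := cabs_ge0 (x ord0); lra.
pose S (F : cvec R n.+1 -> C) := exists j, F = fun x => f j (D x).
have S0 x : polydisc (fun=> delta) x -> (forall F, S F -> F x = 0) <-> W (D x).
  move=> px; have bx := inball _ (pD x px); split=> [h|/(Wf _ bx) h _ [j ->]//].
  by apply/(Wf _ bx) => j; apply: (h (fun x => f j (D x))); exists j.
have Sshol F : S F -> shol (fun=> delta) F.
  move=> [j ->]; have [M [M0 fM]] := shol_bound (sf j).
  split; first by exists M => x /pD/fM.
  move=> x i px s sd.
  pose a := D (upd x i 0).
  pose b : cvec R n := fun l => if i == ord0 then v l + x (lift ord0 l)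
    else if lift ord0 l == i then x ord0 else 0.
  have E t : D (upd x i t) = (fun l => a l + t * b l).
    apply/funext => l; rewrite /a /b /D /upd.
    rewrite [lift ord0 l == i]eq_sym [ord0 == i]eq_sym.
    case: eqVneq => [->|i0]; first by rewrite (negPf (neq_lift _ _)); ring.
    by case: eqVneq => _; ring.
  have -> : (fun t => f j (D (upd x i t))) = (fun t => f j (fun l => a l + t * b l)).
    by apply/funext => t; rewrite E.
  by apply: (shol_line (sf j)); rewrite -E; apply: pD; exact: polydisc_upd.
have zeros (e' : R) : 0 < e' -> exists x, [/\ polydisc (fun=> e') x, x ord0 != 0 &
    forall F, S F -> F x = 0].
  move=> e'0; have [i0 vi0] := vneq0 v0.
  pose a := cabs (v i0) / 2; have a0 : 0 < a by rewrite divr_gt0.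
  pose e1 := Num.min e' delta; have e10 : 0 < e1 by rewrite lt_min e'0.
  (* The bound [a] keeps [cabs (c * w i0)] above [a]; with [cabs (w i0) < e1 * a] this forces
     [cabs c^-1 < e1]. *)
  pose e2 := Num.min e1 (Num.min a (e1 * a)).
  have e20 : 0 < e2 by rewrite lt_min e10 lt_min a0 mulr_gt0.
  have [c [w [Ww w0 wsmall cw]]] := LDstarP LWv e20.
  have cwa : a < cabs c * cabs (w i0).
    have := cw i0; rewrite !lt_min => /andP[_ /andP[h _]].
    have := cabs_sub_ge (v i0) (c * w i0); rewrite cabsBC cabsM.
    by move: h; rewrite /a; lra.
  have c0 : c != 0.
    by apply/eqP => c0; move: cwa; rewrite c0 cabs0 mul0r; lra.
  have cp : 0 < cabs c by rewrite cabs_gt0.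
  have tsmall : cabs c^-1 < e1.
    rewrite cabsV -[_^-1]mul1r ltr_pdivrMr//.
    have := wsmall i0; rewrite !lt_min => /andP[_ /andP[_ h]].
    have := ltr_pM2l cp (cabs (w i0)) (e1 * a); rewrite h => h'.
    by rewrite -(ltr_pM2r a0) mul1r; lra.
  pose x : cvec R n.+1 := fun i => if unlift ord0 i is Some l then c * w l - v l else c^-1.
  have x0 : x ord0 = c^-1 by rewrite /x unlift_none.
  have xl l : x (lift ord0 l) = c * w l - v l by rewrite /x liftK.
  have px i : cabs (x i) < e1.
    case: (unliftP ord0 i) => [l|] ->; last by rewrite x0.
    by rewrite xl; apply: lt_le_trans (cw l) _; rewrite ge_min lexx.
  exists x; split.
  - by move=> i; apply: lt_le_trans (px i) _; rewrite ge_min lexx.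
  - by rewrite x0 invr_eq0.
  apply/S0; first by move=> i; apply: lt_le_trans (px i) _; rewrite ge_min lexx orbT.
  rewrite (_ : D x = w)//; apply/funext => l; rewrite /D x0 xl.
  by rewrite subrKC mulKf.
pose e1 := Num.min e delta; have e10 : 0 < e1 by rewrite lt_min e0.
have [d [d0 hd]] := @zeros_over_punctured_disc R n ord0 delta S delta0 Sshol zeros e1 e10.
exists d; split=> // t t0 /(hd t t0)[x [px xt xS]].
exists (D x); split.
  by apply/S0 => // i; apply: lt_le_trans (px i) _; rewrite ge_min lexx orbT.
move=> i; rewrite /D xt mulrDr addrAC subrr add0r cabsM mulrC ler_wpM2r ?cabs_ge0//.
by apply: le_trans (ltW (px _)) _; rewrite ge_min lexx.
Qed.

End Cones.

(** * Convergent subsequences of bounded sequences *)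

Section Subsequences.
Variable R : realType.
Local Notation C := R[i].
Local Open Scope complex_scope.

(** The limit is the limit superior of [u]. The index map satisfies [k <= phi k] without being
    monotone, which is enough for limits to pass to it and for composition. *)
Lemma real_subsequence (u : nat -> R) (B : R) : (forall k, `|u k| <= B) ->
  exists (phi : nat -> nat) (l : R), (forall k, k <= phi k)%N /\
    forall k, `|u (phi k) - l| <= 2^-1 ^+ k.
Proof.
move=> uB; pose E (x : R) : Prop := exists N, forall k, (N <= k)%N -> - u k >= x.
have B0 k : - B <= u k /\ u k <= B by have := uB k; rewrite ler_norml => /andP[].
have Eub x : E x -> x <= B by move=> [N /(_ N (leqnn _))]; have [] := B0 N; lra.
have hE : has_sup E.
  split; first by exists (- B), 0%N => k _; have [] := B0 k; lra.
  by exists B => x /Eub.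
pose l := - sup E.
have near N (e : R) : 0 < e -> exists k, (N <= k)%N /\ `|u k - l| <= e.
  move=> e0; have [x Ex xs] : exists2 x, E x & sup E - e < x.
    exact: sup_adherent.
  have [N1 hN1] := Ex.
  have [k [Nk uk]] : exists k, (maxn N N1 <= k)%N /\ - u k < sup E + e.
    apply: contrapT => h; have : E (sup E + e).
      exists (maxn N N1) => k Nk; rewrite leNgt; apply/negP => uk.
      by apply: h; exists k.
    by move/(ub_le_sup hE.2); lra.
  exists k; move: Nk; rewrite geq_max => /andP[Nk N1k]; split=> //.
  have := hN1 k N1k; rewrite /l ler_norml => ?; apply/andP; split; lra.
have half0 k : 0 < (2^-1 : R) ^+ k by rewrite exprn_gt0 ?invr_gt0.
have /choice[phi hphi] := fun k => near k _ (half0 k).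
by exists phi, l; split=> k; have [] := hphi k.
Qed.

Definition cconv (u : nat -> C) (l : C) : Prop :=
  forall e : R, 0 < e -> exists N, forall k, (N <= k)%N -> cabs (u k - l) < e.

Lemma cconv_sub u l (phi : nat -> nat) : (forall k, k <= phi k)%N -> cconv u l ->
  cconv (u \o phi) l.
Proof.
move=> hphi ul e /ul[N hN]; exists N => k Nk; apply: hN.
exact: leq_trans Nk (hphi k).
Qed.

Lemma complex_subsequence (u : nat -> C) (B : R) : (forall k, cabs (u k) <= B) ->
  exists (phi : nat -> nat) (l : C), (forall k, k <= phi k)%N /\ cconv (u \o phi) l.
Proof.
move=> uB.
have [phi [a [hphi ha]]] : exists (phi : nat -> nat) (l : R), (forall k, k <= phi k)%N /\
    forall k, `|complex.Re (u (phi k)) - l| <= 2^-1 ^+ k.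
  by apply: (@real_subsequence (fun k => complex.Re (u k)) B) => k; exact: le_trans (cabs_Re _) (uB k).
have [psi [b [hpsi hb]]] : exists (psi : nat -> nat) (l : R), (forall k, k <= psi k)%N /\
    forall k, `|complex.Im (u (phi (psi k))) - l| <= 2^-1 ^+ k.
  apply: (@real_subsequence (fun k => complex.Im (u (phi k))) B) => k.
  exact: le_trans (cabs_Im _) (uB _).
exists (phi \o psi), (a +i* b); split=> [k|e e0].
  exact: leq_trans (hpsi k) (hphi _).
have [N hN] := exprn_half_small (divr_gt0 e0 (ltr0n _ 2)).
exists N => k Nk; apply: le_lt_trans (cabs_ReIm _) _; rewrite !ReImE /=.
have := ha (psi k); have := hb k; have := hN k Nk; have := hN _ (leq_trans Nk (hpsi k)).
by lra.
Qed.

Lemma vector_subsequence n (u : nat -> cvec R n) (B : R) :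
  (forall k i, cabs (u k i) <= B) ->
  exists (phi : nat -> nat) (l : cvec R n), (forall k, k <= phi k)%N /\
    forall i, cconv (fun k => u (phi k) i) (l i).
Proof.
move=> uB.
suff key j : (j <= n)%N -> exists (phi : nat -> nat) (l : cvec R n),
    (forall k, k <= phi k)%N /\
    forall i : 'I_n, (i < j)%N -> cconv (fun k => u (phi k) i) (l i).
  by have [phi [l [? h]]] := key n (leqnn n); exists phi, l; split=> // i; exact: h.
elim: j => [_|j IH jn]; first by exists id, (vzero n).
have [phi [l [hphi hl]]] := IH (ltnW jn); pose p := Ordinal jn.
have [psi [a [hpsi ha]]] := complex_subsequence (fun k => uB (phi k) p).
exists (phi \o psi), (upd l p a); split=> [k|i].
  exact: leq_trans (hpsi k) (hphi _).
rewrite ltnS leq_eqVlt => /orP[/eqP ij|ij].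
  have -> : i = p by exact: val_inj.
  by rewrite upd_same.
rewrite upd_neq; last by rewrite -val_eqE /= ltn_eqF.
exact: (cconv_sub hpsi (hl i ij)).
Qed.

End Subsequences.

Lemma vnorm_scale (R : realType) n (c : R[i]) (x : cvec R n) :
  vnorm (vscale c x) = cabs c * vnorm x.
Proof.
rewrite /vnorm; under eq_bigr => i _ do rewrite -cabs_sqr cabsM exprMn.
rewrite -mulr_sumr sqrtrM ?sqr_ge0// sqrtr_sqr ger0_norm ?cabs_ge0//.
by under [in RHS]eq_bigr => i _ do rewrite -cabs_sqr.
Qed.

(** * Transfer of common tangent directions along a bi-Lipschitz relation *)

Section Transfer.
Variable R : realType.
Variable n : nat.
Local Notation C := R[i].
Local Open Scope complex_scope.
Implicit Types (A V : cvec R n -> Prop) (v : cvec R n).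
Variables (K : R) (Rel : cvec R n -> cvec R n -> Prop).
Hypothesis K0 : 0 < K.
Hypothesis Rel0 : Rel (vzero n) (vzero n).
Hypothesis RelK : forall x x' y y', Rel x x' -> Rel y y' ->
  vnorm (vsub x y) <= K * vnorm (vsub x' y') /\
  vnorm (vsub x' y') <= K * vnorm (vsub x y).

(** Stated for a relation and not for a map, so that the inverse of [h] is covered by swapping the
    arguments of [Rel]. *)
Definition lifts A A' := exists s : R, 0 < s /\ forall a', A' a' ->
  vnorm a' < s -> exists2 a, A a & Rel a a'.

Lemma Rel_norm x x' : Rel x x' ->
  vnorm x <= K * vnorm x' /\ vnorm x' <= K * vnorm x.
Proof. by move=> /RelK/(_ Rel0); rewrite !vsub0. Qed.

Lemma Rel_neq0 x x' : Rel x x' -> x' <> vzero n -> x <> vzero n.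
Proof.
move=> xx' /vneq0[i xi] x0; have [_] := Rel_norm xx'.
have -> : vnorm x = 0.
  apply/eqP; rewrite eq_le sqrtr_ge0 andbT; apply: le_trans (vnorm_le_sum _) _.
  by rewrite big1// => j _; rewrite x0 cabs0.
by have := cabs_le_vnorm x' i; rewrite mulr0; lra.
Qed.

(** The zero vector is in the cone as soon as nonzero points of the set accumulate at the origin,
    with multipliers [0]. Since [meets_only_at0] asserts this membership too, it has to be
    transferred separately. *)
Lemma LDstar0_transfer A A' : lifts A A' -> LDstar A' (vzero n) -> LDstar A (vzero n).
Proof.
move=> [s [s0 hs]] LA'.
have near k : exists x, [/\ A x, x <> vzero n & vnorm x <= 2^-1 ^+ k].
  have h0 : 0 < (2^-1 : R) ^+ k by rewrite exprn_gt0 ?invr_gt0.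
  have n1 : 0 < n%:R + 1 :> R by rewrite ltr_wpDl.
  pose e := Num.min s (2^-1 ^+ k / K) / (n%:R + 1).
  have e0 : 0 < e by rewrite divr_gt0// lt_min s0 divr_gt0.
  have [c [a' [Aa' a'0 a'e _]]] := LDstarP LA' e0.
  have : vnorm a' < Num.min s (2^-1 ^+ k / K).
    by apply: vnorm_lt => //; rewrite lt_min s0 divr_gt0.
  rewrite lt_min ltr_pdivlMr// => /andP[a's a'k].
  have [a Aa aa'] := hs a' Aa' a's; exists a; split=> //; first exact: Rel_neq0 a'0.
  by have [h _] := Rel_norm aa'; lra.
have /choice[x hx] := near.
exists (fun=> 0), x; split; first by move=> k; have [] := hx k.
split=> e e0.
  have [N hN] := exprn_half_small e0; exists N => k /hN; apply: le_lt_trans.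
  by rewrite vsub0; have [] := hx k.
exists 0%N => k _; apply: vnorm_lt => // i.
by rewrite /vsub /vscale mul0r subr0 cabs0 divr_gt0// ltr_wpDl.
Qed.

(** The scale [t] is the inverse of a multiplier for [A']; [cone_approx] supplies the point of [V']
    at that very scale. The rescaled preimages converge along a subsequence, and their common limit
    [u] need not be related to [v]. *)
Lemma LDstar_transfer A A' V V' v : lifts A A' -> lifts V V' -> analytic_germ V' ->
  v <> vzero n -> LDstar A' v -> LDstar V' v ->
  exists u, [/\ u <> vzero n, LDstar A u & LDstar V u].
Proof.
move=> [s [s0 hs]] [s' [s'0 hs']] anV' v0 LA' LV'.
have [i0 vi0] := vneq0 v0.
have N0 : 0 <= n%:R :> R by [].
pose M := vnorm v; have M0 : 0 <= M by exact: sqrtr_ge0.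
(* With [b] below, the two-sided bound on the preimages divided by [t]: [B] gives compactness, [b]
   keeps the limit away from [0]. *)
pose B := K * (n%:R * (M + 1)).
have B0 : 0 <= B by rewrite mulr_ge0 ?(ltW K0)// mulr_ge0//; lra.
pose b := cabs (v i0) / (2 * K); have b0 : 0 < b by rewrite divr_gt0// mulr_gt0.
have near k : exists txy : C * (cvec R n * cvec R n),
    let: (t, (x, y)) := txy in
    [/\ A x /\ x <> vzero n, V y /\ y <> vzero n, t != 0 /\ cabs t <= 2^-1 ^+ k,
        (forall i, cabs (x i) <= B * cabs t) /\ b * cabs t <= vnorm x &
        forall i, cabs (x i - y i) <= 2^-1 ^+ k * cabs t].
  have h0 : 0 < (2^-1 : R) ^+ k by rewrite exprn_gt0 ?invr_gt0.
  have Kn : 0 < 2 * K * (n%:R + 1) by rewrite !mulr_gt0// ltr_wpDl.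
  (* The first two bounds keep points near [t * v] of size comparable to [cabs t]; the third makes
     the preimages [2^-1 ^+ k * cabs t] close after the loss of [K] and of the dimension. *)
  have [e [e0 e1 ev ek]] : exists e : R, [/\ 0 < e, e <= 1, e <= cabs (v i0) / 4 &
      e * (2 * K * (n%:R + 1)) <= 2^-1 ^+ k].
    exists (Num.min 1 (Num.min (cabs (v i0) / 4) (2^-1 ^+ k / (2 * K * (n%:R + 1))))).
    split; rewrite ?lt_min ?ltr01 ?divr_gt0//; rewrite ?ge_min ?lexx ?orbT//.
    by rewrite -ler_pdivlMr// !ge_min lexx !orbT.
  have [d [d0 hd]] := cone_approx anV' LV' v0 e0.
  pose n1 := n%:R * (M + 1) + 1.
  have n10 : 0 < n1 by have := mulr_ge0 N0 (addr_ge0 M0 ler01); rewrite /n1; lra.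
  have [t1 [t10 t1d t1k t1s t1s']] : exists t1 : R, [/\ 0 < t1, t1 <= d,
      t1 <= 2^-1 ^+ k, n1 * t1 <= s & n1 * t1 <= s'].
    exists (Num.min (Num.min d (2^-1 ^+ k)) (Num.min (s / n1) (s' / n1))).
    split; rewrite ?lt_min ?d0 ?h0 ?divr_gt0//; rewrite ?ge_min ?lexx ?orbT//.
      by rewrite mulrC -ler_pdivlMr// !ge_min lexx !orbT.
    by rewrite mulrC -ler_pdivlMr// !ge_min lexx !orbT.
  (* Points of [A'] this small need a multiplier [c] with [cabs c^-1 < t1]. *)
  pose e' := Num.min e (t1 * (cabs (v i0) / 2)).
  have e'0 : 0 < e' by rewrite lt_min e0 mulr_gt0// divr_gt0.
  have [c [a [Aa a0 asmall ca]]] := LDstarP LA' e'0.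
  have cai : cabs (v i0) / 2 < cabs c * cabs (a i0).
    have := ca i0; rewrite lt_min => /andP[h _].
    by have := cabs_sub_ge (v i0) (c * a i0); rewrite cabsBC cabsM; lra.
  have c0 : c != 0 by apply/eqP => c0; move: cai; rewrite c0 cabs0 mul0r; lra.
  have cp : 0 < cabs c by rewrite cabs_gt0.
  pose t := c^-1; have t0 : t != 0 by rewrite invr_eq0.
  have tp : 0 < cabs t by rewrite cabs_gt0.
  have tt1 : cabs t < t1.
    have v2 : 0 < cabs (v i0) / 2 by lra.
    rewrite /t cabsV -[_^-1]mul1r ltr_pdivrMr//.
    have := asmall i0; rewrite lt_min => /andP[_ h].
    have := ltr_pM2l cp (cabs (a i0)) (t1 * (cabs (v i0) / 2)); rewrite h => h'.
    by rewrite -(ltr_pM2r v2) mul1r; lra.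
  have av i : cabs (a i - t * v i) <= e * cabs t.
    have -> : a i - t * v i = (c * a i - v i) * t by rewrite /t; field.
    rewrite cabsM ler_wpM2r ?cabs_ge0//; have := ca i.
    by rewrite lt_min => /andP[/ltW].
  have [w [Vw wv]] := hd t t0 (lt_le_trans tt1 t1d).
  have bound (q : cvec R n) : (forall i, cabs (q i - t * v i) <= e * cabs t) ->
      vnorm q <= n%:R * ((M + 1) * cabs t) /\ cabs (v i0) / 2 * cabs t <= vnorm q.
    move=> qv; split.
      apply: vnorm_le => [|i]; first by rewrite mulr_ge0 ?cabs_ge0//; lra.
      have := cabs_sub_ge (q i) (t * v i); have := qv i; rewrite cabsM.
      have := ler_wpM2l (cabs_ge0 t) (cabs_le_vnorm v i); rewrite -/M.
      by have := ler_wpM2r (cabs_ge0 t) e1; lra.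
    apply: le_trans (cabs_le_vnorm q i0).
    have := cabs_sub_ge (t * v i0) (q i0); rewrite cabsBC cabsM => h1.
    by have := qv i0; have := ler_wpM2r (cabs_ge0 t) ev; have := mulr_gt0 vi0 tp; lra.
  have [aB ab] := bound a av; have [wB wb] := bound w wv.
  have nt : n%:R * ((M + 1) * cabs t) < n1 * t1.
    have h1 := ler_wpM2l (mulr_ge0 N0 (addr_ge0 M0 ler01)) (ltW tt1).
    by rewrite /n1; lra.
  have [x Ax xa] := hs a Aa (le_lt_trans aB (lt_le_trans nt t1s)).
  have [y Vy yw] := hs' w Vw (le_lt_trans wB (lt_le_trans nt t1s')).
  have w0 : w <> vzero n.
    move=> w0; have : vnorm w = 0.
      apply/eqP; rewrite eq_le sqrtr_ge0 andbT; apply: le_trans (vnorm_le_sum _) _.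
      by rewrite big1// => j _; rewrite w0 cabs0.
    by have := mulr_gt0 vi0 tp; lra.
  exists (t, (x, y)); split.
  - by split=> //; exact: Rel_neq0 xa a0.
  - by split=> //; exact: Rel_neq0 yw w0.
  - by split=> //; apply: le_trans (ltW tt1) _.
  - have [xN aN] := Rel_norm xa; split=> [i|].
      apply: le_trans (cabs_le_vnorm x i) _; apply: le_trans xN _.
      by have := ler_wpM2l (ltW K0) aB; rewrite /B; lra.
    rewrite -(ler_pM2l K0) /b; apply: le_trans aN.
    by rewrite mulrA (_ : K * _ = cabs (v i0) / 2)//; field; rewrite gt_eqF.
  move=> i; apply: le_trans (cabs_le_vnorm (vsub x y) i) _.
  have [xy _] := RelK xa yw; apply: le_trans xy _.
  have aw : vnorm (vsub a w) <= n%:R * (2 * e * cabs t).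
    apply: vnorm_le => [|j]; first by rewrite !mulr_ge0 ?cabs_ge0// ltW.
    apply: le_trans (cabs_triB _ (t * v j) _) _.
    by rewrite (cabsBC (t * v j)); have := av j; have := wv j; lra.
  have := ler_wpM2l (ltW K0) aw; have := ler_wpM2r (cabs_ge0 t) ek.
  by have := mulr_ge0 (ltW K0) (mulr_ge0 (ltW e0) (cabs_ge0 t)); lra.
have /choice[g hg] := near.
pose t k := (g k).1; pose x k := (g k).2.1; pose y k := (g k).2.2.
have {}hg k : [/\ A (x k) /\ x k <> vzero n, V (y k) /\ y k <> vzero n,
        t k != 0 /\ cabs (t k) <= 2^-1 ^+ k,
        (forall i, cabs (x k i) <= B * cabs (t k)) /\ b * cabs (t k) <= vnorm (x k) &
        forall i, cabs (x k i - y k i) <= 2^-1 ^+ k * cabs (t k)].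
  by have := hg k; rewrite /t /x /y; case: (g k) => ? [? ?].
pose z k : cvec R n := fun i => (t k)^-1 * x k i.
have tp k : 0 < cabs (t k) by have [_ _ [] ] := hg k; rewrite cabs_gt0.
have zB k i : cabs (z k i) <= B.
  have [_ _ _ [h _] _] := hg k; rewrite /z cabsM cabsV mulrC ler_pdivrMr//.
have [phi [u [hphi zu]]] := vector_subsequence zB.
have xsmall i : cconv (fun k => x (phi k) i) 0.
  move=> e e0; have B1 : 0 < B + 1 by lra.
  have [N hN] := exprn_half_small (divr_gt0 e0 B1); exists N => k Nk.
  have := hN _ (leq_trans Nk (hphi k)); rewrite ltr_pdivlMr// => hk.
  have [_ _ [_ tk] [h _] _] := hg (phi k); rewrite subr0; apply: le_lt_trans (h i) _.
  have := ler_wpM2l B0 tk; have := tp (phi k); lra.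
have yx k i : cabs (y k i - x k i) <= 2^-1 ^+ k * cabs (t k).
  by have [_ _ _ _ h] := hg k; rewrite cabsBC.
have half1 k : (2^-1 : R) ^+ k <= 1 by rewrite exprn_ile1 ?invr_ge0//; lra.
have half0 k : 0 < (2^-1 : R) ^+ k by rewrite exprn_gt0 ?invr_gt0.
exists u; split.
- move=> u0.
  have n1 : 0 < n%:R + 1 :> R by rewrite ltr_wpDl.
  have [N hN] := choose_threshold (fun i => zu i _ (divr_gt0 b0 n1)).
  have : vnorm (z (phi N)) < b.
    by apply: vnorm_lt => // i; have := hN i N (leqnn _); rewrite u0 subr0.
  have [_ _ _ [_ h] _] := hg (phi N).
  have : vnorm (x (phi N)) = cabs (t (phi N)) * vnorm (z (phi N)).
    rewrite -vnorm_scale; congr vnorm; apply/funext => i.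
    by rewrite /vscale /z mulVKf// -cabs_gt0.
  by move=> E; rewrite E mulrC ler_pM2l// in h; lra.
- exists (fun k => (t (phi k))^-1), (fun k => x (phi k)); split.
    by move=> k; have [] := hg (phi k).
  split; apply: vconv_coord => i; first exact: xsmall.
  exact: zu.
- exists (fun k => (t (phi k))^-1), (fun k => y (phi k)); split.
    by move=> k; have [] := hg (phi k).
  split; apply: vconv_coord => i e e0; have e2 : 0 < e / 2 by lra.
    have [N hN] := xsmall i _ e2; have [N' hN'] := exprn_half_small e2.
    exists (maxn N N') => k; rewrite geq_max => /andP[/hN h1 N'k].
    have h2 := hN' _ (leq_trans N'k (hphi k)).
    have [_ _ [_ tk] _ _] := hg (phi k).
    have h3 := ler_pM (ltW (half0 (phi k))) (ltW (tp (phi k))) (half1 (phi k)) tk.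
    rewrite mul1r in h3; apply: le_lt_trans (cabs_triB _ (x (phi k) i) _) _.
    by have := yx (phi k) i; rewrite /= in h1 *; lra.
  have [N hN] := zu i _ e2; have [N' hN'] := exprn_half_small e2.
  exists (maxn N N') => k; rewrite geq_max => /andP[/hN h1 N'k].
  have h2 := hN' _ (leq_trans N'k (hphi k)).
  have h3 : cabs ((t (phi k))^-1 * y (phi k) i - z (phi k) i) <= 2^-1 ^+ phi k.
    by rewrite /z -mulrBr cabsM cabsV mulrC ler_pdivrMr.
  apply: le_lt_trans (cabs_triB _ (z (phi k) i) _) _.
  by move: h1 h3; rewrite /vscale; lra.
Qed.

End Transfer.

(** * The graph of the germ and the equivalence *)

Section MainTheorem.
Variable R : realType.
Variable n : nat.
Implicit Types (A V W : cvec R n -> Prop) (h : cvec R n -> cvec R n).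

Definition graph h (r : R) (x y : cvec R n) : Prop := vball (vzero n) r x /\ y = h x.

Lemma graph_bilipschitz h r : biLipschitz_germ h r -> exists K : R,
  [/\ 0 < K, graph h r (vzero n) (vzero n) &
    forall x x' y y', graph h r x x' -> graph h r y y' ->
      vnorm (vsub x y) <= K * vnorm (vsub x' y') /\
      vnorm (vsub x' y') <= K * vnorm (vsub x y)].
Proof.
move=> [r0 [h0 [[K1 [K2 [K10 [K12 hK]]]] _]]].
exists (K1^-1 + K2); have K1v : 0 < K1^-1 by rewrite invr_gt0.
have K20 : 0 < K2 by exact: lt_le_trans K12.
split; first exact: addr_gt0.
  split=> //; rewrite /vball vsub0; apply: vnorm_lt => // i.
  by rewrite cabs0 divr_gt0// ltr_wpDl.
move=> x x' y y' [bx ->] [bY ->]; have [h1 h2] := hK x y bx bY.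
have p1 : 0 <= vnorm (vsub x y) by exact: sqrtr_ge0.
have p2 : 0 <= vnorm (vsub (h x) (h y)) by exact: sqrtr_ge0.
rewrite mulrC -ler_pdivlMr// in h1.
rewrite !mulrDl; split.
  by have := mulr_ge0 (ltW K20) p2; lra.
by have := mulr_ge0 (ltW K1v) p1; lra.
Qed.

Lemma lifts_image h r A : lifts (graph h r) A (gimage h r A).
Proof. by exists 1; split=> // _ [x [bx [Ax <-]]] _; exists x. Qed.

Lemma lifts_preimage h r A : 0 < r -> lifts (fun y x => graph h r x y) (gimage h r A) A.
Proof.
move=> r0; exists r; split=> // x Ax xr; have bx : vball (vzero n) r x by rewrite /vball vsub0.
by exists (h x) => //; exists x.
Qed.

Lemma lifts_germ_eq h r V W : germ_eq (gimage h r V) W -> lifts (graph h r) V W.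
Proof.
move=> [e [e0 he]]; exists e; split=> // w Ww we.
have /he : vball (vzero n) e w by rewrite /vball vsub0.
by move=> /proj2/(_ Ww)[x [bx [Vx <-]]]; exists x.
Qed.

Lemma lifts_germ_eq_inv h r V W : biLipschitz_germ h r -> germ_eq (gimage h r V) W ->
  lifts (fun y x => graph h r x y) W V.
Proof.
move=> bl [e [e0 he]]; have [K [K0 Rel0 RelK]] := graph_bilipschitz bl.
have [r0 _] := bl.
(* The radius [e / K] brings [h x] into the ball where the two germs agree. *)
exists (Num.min r (e / K)); split; first by rewrite lt_min r0 divr_gt0.
move=> x Vx; rewrite lt_min ltr_pdivlMr// => /andP[xr xe].
have bx : vball (vzero n) r x by rewrite /vball vsub0.
have [_] := RelK x (h x) _ _ (conj bx erefl) Rel0; rewrite !vsub0 => hx.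
exists (h x) => //; apply/he; first by rewrite /vball vsub0; lra.
by exists x.
Qed.

(** A nonzero common direction of the primed sets is pulled back along [Rel], while membership of
    [0] goes the other way; hence liftings in both directions. *)
Lemma meets_transfer A A' V V' (K : R) (Rel : cvec R n -> cvec R n -> Prop) : 0 < K ->
  Rel (vzero n) (vzero n) ->
  (forall x x' y y', Rel x x' -> Rel y y' ->
    vnorm (vsub x y) <= K * vnorm (vsub x' y') /\
    vnorm (vsub x' y') <= K * vnorm (vsub x y)) ->
  lifts Rel A A' -> lifts Rel V V' ->
  lifts (fun y x => Rel x y) A' A -> lifts (fun y x => Rel x y) V' V ->
  analytic_germ V' ->
  meets_only_at0 (LDstar A) (LDstar V) -> meets_only_at0 (LDstar A') (LDstar V').
Proof.
move=> K0 Rel0 RelK lA lV lA' lV' anV' meet v; split.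
  move=> [LA' LV']; apply: contrapT => v0.
  have [u [u0 LA LV]] := LDstar_transfer K0 Rel0 RelK lA lV anV' v0 LA' LV'.
  by apply: u0; apply/meet.
move=> ->; have [LA LV] := (meet (vzero n)).2 erefl.
have RelK' x x' y y' : Rel x' x -> Rel y' y ->
    vnorm (vsub x y) <= K * vnorm (vsub x' y') /\
    vnorm (vsub x' y') <= K * vnorm (vsub x y).
  by move=> xx' yy'; have [? ?] := RelK _ _ _ _ xx' yy'.
pose Rel' y x := Rel x y.
split; first exact: (@LDstar0_transfer R n K Rel' K0 Rel0 RelK' A' A lA' LA).
exact: (@LDstar0_transfer R n K Rel' K0 Rel0 RelK' V' V lV' LV).
Qed.

End MainTheorem.

Theorem theorem3p11 (R : realType) (n : nat) (V W A : cvec R n -> Prop)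
  (h : cvec R n -> cvec R n) (r : R) :
  analytic_germ V -> analytic_germ W ->
  V (vzero n) -> W (vzero n) ->
  zero_in_closure A ->
  biLipschitz_germ h r ->
  germ_eq (gimage h r V) W ->
  (meets_only_at0 (LDstar A) (LDstar V) <->
   meets_only_at0 (LDstar (gimage h r A)) (LDstar W)).
Proof.
move=> anV anW _ _ _ bl VW; have [K [K0 Rel0 RelK]] := graph_bilipschitz bl.
have [r0 _] := bl.
have RelK' x x' y y' : graph h r x' x -> graph h r y' y ->
    vnorm (vsub x y) <= K * vnorm (vsub x' y') /\
    vnorm (vsub x' y') <= K * vnorm (vsub x y).
  by move=> xx' yy'; have [? ?] := RelK _ _ _ _ xx' yy'.
have lA := lifts_image h r A; have lA' := lifts_preimage h A r0.
have lV := lifts_germ_eq VW; have lV' := lifts_germ_eq_inv bl VW.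
split; first exact: (meets_transfer K0 Rel0 RelK).
(* The inverse of [h] as the swapped graph; the analytic target is now [V]. *)
exact: (@meets_transfer R n _ _ _ _ K (fun y x => graph h r x y)).
Qed.
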